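(* Let $F\subseteq\mathbb{R}^2$ be a self-similar set, not contained in any affine line, with $0<\dim_H F<2$, generated by an IFS $\Phi=\{\phi_i\}_{i=1}^l$ of contracting similarities satisfying the strong separation condition. Let $g(z)=Az+t$ with $A\in GL(\mathbb{R}^2)$, $t\in\mathbb{R}^2$, satisfy $g(F)\subseteq F$. \begin{enumerate} \item If $|G_\Phi|=\infty$, then $g$ is a similarity, and there exist $k\in\mathbb{N}$ and finite words $I,J\in\{1,\dots,l\}^*$ such that $g^k\circ\phi_I=\phi_J$. \item If $|G_\Phi|<\infty$ and all maps in $\Phi$ have the same contraction ratio $\lambda\in(0,1)$, then $A$ is diagonalizable over $\mathbb{C}$, and its eigenvalues $\gamma_1,\gamma_2\in\mathbb{C}$ satisfy $|\gamma_1|=\lambda^p$, $|\gamma_2|=\lambda^q$ for some $p,q\in\mathbb{Q}$. \end{enumerate}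
   Context: A similarity of $\mathbb{R}^2$ is a map $z\mapsto \alpha Oz+t$ with $\alpha\neq 0$, $O\in O(\mathbb{R}^2)$ (its orthogonal part), $t\in\mathbb{R}^2$; it is contracting with contraction ratio $|\alpha|$ if $|\alpha|<1$. An IFS $\Phi=\{\phi_i\}_{i=1}^l$ ($l\ge2$) of contracting similarities has a unique nonempty compact attractor $F=\bigcup_i\phi_i(F)$; such $F$ is called self-similar. $\Phi$ satisfies the strong separation condition (SSC) if $\phi_i(F)\cap\phi_j(F)=\emptyset$ for $i\neq j$. $G_\Phi\le O(\mathbb{R}^2)$ denotes the group generated by the orthogonal parts of the maps in $\Phi$. For a word $I=(i_1,\dots,i_k)$, $\phi_I=\phi_{i_1}\circ\cdots\circ\phi_{i_k}$. *)

(* Defs.v *)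
From Stdlib Require Import Reals Lra QArith Qreals List.
Open Scope R_scope.

Definition R2 := (R * R)%type.

Definition dist2 (x y : R2) : R :=
  sqrt ((fst x - fst y)^2 + (snd x - snd y)^2).

Record mat2 := M2 { m11 : R; m12 : R; m21 : R; m22 : R }.

Definition mapp (A : mat2) (z : R2) : R2 :=
  (m11 A * fst z + m12 A * snd z, m21 A * fst z + m22 A * snd z).

Definition mmul (A B : mat2) : mat2 :=
  M2 (m11 A * m11 B + m12 A * m21 B) (m11 A * m12 B + m12 A * m22 B)
     (m21 A * m11 B + m22 A * m21 B) (m21 A * m12 B + m22 A * m22 B).

Definition mtr (A : mat2) : mat2 := M2 (m11 A) (m21 A) (m12 A) (m22 A).
Definition mid : mat2 := M2 1 0 0 1.
Definition mdet (A : mat2) : R := m11 A * m22 A - m12 A * m21 A.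

Definition orthogonal (O : mat2) : Prop := mmul (mtr O) O = mid.

Record sim := Sim { s_alpha : R; s_orth : mat2; s_trans : R2 }.

Definition is_similarity_data (f : sim) : Prop :=
  s_alpha f <> 0 /\ orthogonal (s_orth f).

Definition sim_app (f : sim) (z : R2) : R2 :=
  let w := mapp (s_orth f) z in
  (s_alpha f * fst w + fst (s_trans f), s_alpha f * snd w + snd (s_trans f)).

Definition contracting_sim (f : sim) : Prop :=
  is_similarity_data f /\ Rabs (s_alpha f) < 1.

Definition is_similarity_map (g : R2 -> R2) : Prop :=
  exists f : sim, is_similarity_data f /\ forall z, g z = sim_app f z.

(** An IFS with l maps: phi 0, ..., phi (l-1) (indices shifted by one). *)
Definition image (f : R2 -> R2) (E : R2 -> Prop) : R2 -> Prop :=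
  fun y => exists x, E x /\ f x = y.

Definition bounded (E : R2 -> Prop) : Prop :=
  exists M, forall x, E x -> dist2 x (0,0) <= M.

Definition closed2 (E : R2 -> Prop) : Prop :=
  forall x, (forall eps, eps > 0 -> exists y, E y /\ dist2 x y < eps) -> E x.

(** compact subsets of R^2 = closed and bounded (Heine-Borel) *)
Definition compact2 (E : R2 -> Prop) : Prop := closed2 E /\ bounded E.

Definition is_attractor (l : nat) (phi : nat -> sim) (F : R2 -> Prop) : Prop :=
  (exists x, F x) /\ compact2 F /\
  forall y, F y <-> exists i, (i < l)%nat /\ image (sim_app (phi i)) F y.

Definition SSC (l : nat) (phi : nat -> sim) (F : R2 -> Prop) : Prop :=
  forall i j, (i < l)%nat -> (j < l)%nat -> i <> j ->
    forall y, ~ (image (sim_app (phi i)) F y /\ image (sim_app (phi j)) F y).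

Definition in_affine_line (F : R2 -> Prop) : Prop :=
  exists a b c, (a <> 0 \/ b <> 0) /\ forall x, F x -> a * fst x + b * snd x = c.

Inductive in_G (l : nat) (phi : nat -> sim) : mat2 -> Prop :=
| G_id : in_G l phi mid
| G_mul : forall i M, (i < l)%nat -> in_G l phi M -> in_G l phi (mmul (s_orth (phi i)) M)
| G_mulinv : forall i M, (i < l)%nat -> in_G l phi M ->
    in_G l phi (mmul (mtr (s_orth (phi i))) M).

Definition G_finite (l : nat) (phi : nat -> sim) : Prop :=
  exists L : list mat2, forall M, in_G l phi M -> In M L.

Fixpoint phiw (phi : nat -> sim) (I : list nat) (z : R2) : R2 :=
  match I with
  | nil => z
  | i :: I' => sim_app (phi i) (phiw phi I' z)
  end.

Definition word_ok (l : nat) (I : list nat) : Prop := Forall (fun i => (i < l)%nat) I.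

Fixpoint iterf (k : nat) (g : R2 -> R2) (z : R2) : R2 :=
  match k with O => z | S k' => g (iterf k' g z) end.

Definition rpow (r s : R) : R := if Rle_dec r 0 then 0 else Rpower r s.

Definition H_null (s : R) (E : R2 -> Prop) : Prop :=
  forall eps, eps > 0 ->
    exists (U : nat -> R2 -> Prop) (r : nat -> R),
      (forall n, 0 <= r n) /\
      (forall n x y, U n x -> U n y -> dist2 x y <= r n) /\
      (forall x, E x -> exists n, U n x) /\
      (forall N, sum_f_R0 (fun n => rpow (r n) s) N <= eps).

(** d = dim_H E, i.e. d = inf { s > 0 | H^s(E) = 0 } (for d >= 0) *)
Definition is_dimH (E : R2 -> Prop) (d : R) : Prop :=
  (forall s, s > d -> s > 0 -> H_null s E) /\
  (forall s, 0 < s -> s < d -> ~ H_null s E).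

Definition Cx := (R * R)%type.
Definition Cadd (a b : Cx) : Cx := (fst a + fst b, snd a + snd b).
Definition Cmul (a b : Cx) : Cx :=
  (fst a * fst b - snd a * snd b, fst a * snd b + snd a * fst b).
Definition Cof (x : R) : Cx := (x, 0).
Definition Cmod (a : Cx) : R := sqrt (fst a ^ 2 + snd a ^ 2).

Definition eigpair (A : mat2) (g : Cx) (v : Cx * Cx) : Prop :=
  Cadd (Cmul (Cof (m11 A)) (fst v)) (Cmul (Cof (m12 A)) (snd v)) = Cmul g (fst v) /\
  Cadd (Cmul (Cof (m21 A)) (fst v)) (Cmul (Cof (m22 A)) (snd v)) = Cmul g (snd v).

(** A = P diag(g1,g2) P^{-1} over C, with columns v1, v2 of P; det P <> 0 *)
Definition diagonalizes_C (A : mat2) (g1 g2 : Cx) : Prop :=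
  exists v1 v2 : Cx * Cx,
    Cadd (Cmul (fst v1) (snd v2)) (Cmul (Cof (-1)) (Cmul (fst v2) (snd v1))) <> (0, 0) /\
    eigpair A g1 v1 /\ eigpair A g2 v2.

Definition affg (A : mat2) (t : R2) (z : R2) : R2 :=
  (fst (mapp A z) + fst t, snd (mapp A z) + snd t).

(* Main.v *)
(** Let [mu] be the self-similar measure with weights [r_i^s], [sum r_i^s = 1].  Cylinders
    are zoomed out by [phi_J^{-1}], so that every embedding [g o phi_I] becomes an embedding
    [phi_J^{-1} g phi_I] of definite size.

    Stability: an affine map close to, but different from, the identity sends a definite
    proportion of [F] off [F].  Hence the embeddings [f] with constant density, i.e. with
    [mu (f E) = c * mu E], whose determinant is bounded below are isolated, and by compactness
    there are finitely many of them.  Maximizing the density shows that each invertible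
    embedding [g] has constant density on some cylinder.

    If the group is infinite and [A] is not conformal, the normalized pieces
    [phi_J^{-1} g phi_I] have infinitely many linear parts, against finiteness.  If the powers
    of [A] stay boundedly far from degenerate, finiteness gives
    [phi_J^{-1} g^k phi_I = phi_J'^{-1} g^k' phi_I], hence [g^(k'-k) phi_J = phi_J'].

    If the group is finite and [A] has eigenvalues [|g2| < |g1|] (or is a Jordan block), then
    finiteness of the maps [phi_{x|n}^{-1} g phi_{x|n}] at a fixed point [x] yields a point fixed
    by some [phi_w] and by a conjugate of [g].  Near it, [F] is invariant under a homothety
    [Lam] and under [B], and contains points of the dominant eigenline; if [|g1|] and [Lam] were
    incommensurable (or [B] a Jordan block), [F] would contain a segment.  The other
    eigenvalue follows by applying this to [g^{-1} phi_V], which embeds [F] for some word [V]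
    because the image of [g] contains a cylinder. *)

Require Import Defs.
From Stdlib Require Import Reals QArith Qreals List.
From Stdlib Require Import ZArith Lra Lia Psatz FinFun.
From Stdlib Require Import Classical ClassicalEpsilon ssreflect.
Import ListNotations.
Open Scope R_scope.

(** * Affine maps of the plane *)

(** The scale-invariant quantity [|det A| / frob A ^ 2] decides what finiteness can give. A
    normalized piece has size about 1, so its determinant is bounded below only as far as this
    quantity is for the map it comes from. Along the powers of [g] it stays bounded below when [A]
    is conformal or has non-real eigenvalues; with eigenvalues of different moduli, or a Jordan
    block, the normalized powers flatten onto a line. In those cases finiteness is applied to a
    single map around its fixed point, where normalization is a conjugation and keeps the
    determinant.

    Measure theory is reduced to counting cylinders that meet a set, so that no measurability has to
    be shown for images or neighbourhoods. Where additivity would be natural, superadditivity at a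
    level that separates the two sets takes its place.

    Strong separation enters through the constant [gap]: a point of [F] closer than [gap * r_I] to a
    point of the cylinder [I] belongs to that cylinder. Most thresholds below are chosen to make
    this apply. *)

Definition vadd (x y : R2) : R2 := (fst x + fst y, snd x + snd y).
Definition vsub (x y : R2) : R2 := (fst x - fst y, snd x - snd y).
Definition vscal (c : R) (x : R2) : R2 := (c * fst x, c * snd x).
Definition dot (x y : R2) : R := fst x * fst y + snd x * snd y.
Definition cross (x y : R2) : R := fst x * snd y - snd x * fst y.
Definition vnorm (x : R2) : R := sqrt (fst x ^ 2 + snd x ^ 2).
Definition frob (A : mat2) : R :=
  sqrt (m11 A ^ 2 + m12 A ^ 2 + m21 A ^ 2 + m22 A ^ 2).

Lemma R2_ext (x y : R2) : fst x = fst y -> snd x = snd y -> x = y.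
Proof. by case: x y => [a b] [c d] /= -> ->. Qed.

Lemma mat2_ext (A B : mat2) :
  m11 A = m11 B -> m12 A = m12 B -> m21 A = m21 B -> m22 A = m22 B -> A = B.
Proof. by case: A B => [a b c d] [a' b' c' d'] /= -> -> -> ->. Qed.

Ltac plane :=
  repeat (apply: R2_ext || apply: mat2_ext);
  rewrite /affg /mapp /mmul /mtr /mid /vadd /vsub /vscal /dot /cross /mdet /=.

Lemma vnorm_ge0 x : 0 <= vnorm x.
Proof. exact: sqrt_pos. Qed.

Lemma vnorm_sq x : vnorm x ^ 2 = fst x ^ 2 + snd x ^ 2.
Proof. rewrite /vnorm pow2_sqrt //; nra. Qed.

Lemma frob_ge0 A : 0 <= frob A.
Proof. exact: sqrt_pos. Qed.

Lemma frob_sq A : frob A ^ 2 = m11 A ^ 2 + m12 A ^ 2 + m21 A ^ 2 + m22 A ^ 2.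
Proof. rewrite /frob pow2_sqrt //; nra. Qed.

Lemma sq_le a b : 0 <= b -> a ^ 2 <= b ^ 2 -> a <= b.
Proof. move=> Hb H; case: (Rle_lt_dec a b) => // Hlt; nra. Qed.

Lemma sq_eq a b : 0 <= a -> 0 <= b -> a ^ 2 = b ^ 2 -> a = b.
Proof. move=> Ha Hb H; apply: Rle_antisym; apply: sq_le => //; lra. Qed.

Lemma dist2_vnorm x y : dist2 x y = vnorm (vsub x y).
Proof. by []. Qed.

Lemma dot_le x y : dot x y <= vnorm x * vnorm y.
Proof.
have := vnorm_ge0 x; have := vnorm_ge0 y => Hy Hx.
apply: sq_le; first by nra.
rewrite Rpow_mult_distr !vnorm_sq /dot.
have := pow2_ge_0 (fst x * snd y - snd x * fst y); nra.
Qed.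

Lemma vnorm_triang x y : vnorm (vadd x y) <= vnorm x + vnorm y.
Proof.
have := vnorm_ge0 x; have := vnorm_ge0 y => Hy Hx.
apply: sq_le; first by lra.
have := dot_le x y; have := vnorm_sq x; have := vnorm_sq y.
rewrite (vnorm_sq (vadd x y)) /dot /vadd /=; nra.
Qed.

Lemma vnorm_sym x y : vnorm (vsub x y) = vnorm (vsub y x).
Proof. rewrite /vnorm /vsub /=; f_equal; ring. Qed.

Lemma dist2_sym x y : dist2 x y = dist2 y x.
Proof. exact: vnorm_sym. Qed.

Lemma dist2_ge0 x y : 0 <= dist2 x y.
Proof. exact: sqrt_pos. Qed.

Lemma dist2_triang x y z : dist2 x z <= dist2 x y + dist2 y z.
Proof.
rewrite !dist2_vnorm.
have -> : vsub x z = vadd (vsub x y) (vsub y z) by plane; ring.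
exact: vnorm_triang.
Qed.

Lemma vnorm_0 : vnorm (0, 0) = 0.
Proof. by rewrite /vnorm /= !Rmult_0_l Rplus_0_l sqrt_0. Qed.

Lemma vnorm_eq0 x : vnorm x = 0 -> x = (0, 0).
Proof. move=> H; have := vnorm_sq x; rewrite H => H'; apply: R2_ext => /=; nra. Qed.

Lemma vnorm_pos x : x <> (0, 0) -> 0 < vnorm x.
Proof.
move=> H; case: (vnorm_ge0 x) => // H0; case: H; by apply: vnorm_eq0.
Qed.

Lemma dist2_xx x : dist2 x x = 0.
Proof. rewrite dist2_vnorm -vnorm_0; f_equal; plane; ring. Qed.

Lemma dist2_eq0 x y : dist2 x y = 0 -> x = y.
Proof. rewrite dist2_vnorm => /vnorm_eq0; rewrite /vsub => -[H1 H2]; apply: R2_ext; lra. Qed.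

Lemma vnorm_scal c x : vnorm (vscal c x) = Rabs c * vnorm x.
Proof.
apply: sq_eq; [exact: vnorm_ge0 | |].
  apply: Rmult_le_pos; [exact: Rabs_pos | exact: vnorm_ge0].
rewrite Rpow_mult_distr !vnorm_sq pow2_abs /vscal /=; ring.
Qed.

Lemma fst_le_vnorm x : Rabs (fst x) <= vnorm x.
Proof.
apply: sq_le; first exact: vnorm_ge0.
rewrite vnorm_sq pow2_abs; nra.
Qed.

Lemma snd_le_vnorm x : Rabs (snd x) <= vnorm x.
Proof.
apply: sq_le; first exact: vnorm_ge0.
rewrite vnorm_sq pow2_abs; nra.
Qed.

Lemma vnorm_le_abs x : vnorm x <= Rabs (fst x) + Rabs (snd x).
Proof.
have Ha := Rabs_pos (fst x); have Hb := Rabs_pos (snd x).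
apply: sq_le; first lra.
have E1 := pow2_abs (fst x); have E2 := pow2_abs (snd x).
rewrite vnorm_sq; nra.
Qed.

Lemma cross_le x y : Rabs (cross x y) <= vnorm x * vnorm y.
Proof.
have := vnorm_ge0 x; have := vnorm_ge0 y => Hy Hx.
apply: sq_le; first by nra.
rewrite Rpow_mult_distr !vnorm_sq pow2_abs /cross.
have := pow2_ge_0 (fst x * fst y + snd x * snd y); nra.
Qed.

Lemma frob_bound A z : vnorm (mapp A z) <= frob A * vnorm z.
Proof.
have Ha := frob_ge0 A; have Hz := vnorm_ge0 z.
apply: sq_le; first by nra.
rewrite Rpow_mult_distr frob_sq !vnorm_sq /mapp /=.
have := pow2_ge_0 (m11 A * snd z - m12 A * fst z).
have := pow2_ge_0 (m21 A * snd z - m22 A * fst z); nra.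
Qed.

Lemma frob_le_abs A :
  frob A <= Rabs (m11 A) + Rabs (m12 A) + Rabs (m21 A) + Rabs (m22 A).
Proof.
have H1 := Rabs_pos (m11 A); have H2 := Rabs_pos (m12 A).
have H3 := Rabs_pos (m21 A); have H4 := Rabs_pos (m22 A).
apply: sq_le; first lra.
rewrite frob_sq -(pow2_abs (m11 A)) -(pow2_abs (m12 A)) -(pow2_abs (m21 A)) -(pow2_abs (m22 A)); nra.
Qed.

Lemma det_le_frob A : 2 * Rabs (mdet A) <= frob A ^ 2.
Proof.
rewrite frob_sq /mdet.
have H1 := pow2_ge_0 (m11 A - m22 A); have H2 := pow2_ge_0 (m12 A + m21 A).
have H3 := pow2_ge_0 (m11 A + m22 A); have H4 := pow2_ge_0 (m12 A - m21 A).
rewrite /Rabs; case: Rcase_abs => _; nra.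
Qed.

(** * Matrix algebra and invertible affine maps *)

Definition mscal (c : R) (A : mat2) : mat2 :=
  M2 (c * m11 A) (c * m12 A) (c * m21 A) (c * m22 A).
Definition msub (A B : mat2) : mat2 :=
  M2 (m11 A - m11 B) (m12 A - m12 B) (m21 A - m21 B) (m22 A - m22 B).
Definition minv (A : mat2) : mat2 :=
  M2 (m22 A / mdet A) (- m12 A / mdet A) (- m21 A / mdet A) (m11 A / mdet A).

Lemma mdet_mul A B : mdet (mmul A B) = mdet A * mdet B.
Proof. rewrite /mdet /mmul /=; ring. Qed.

Lemma mmul_assoc A B C : mmul A (mmul B C) = mmul (mmul A B) C.
Proof. plane; ring. Qed.

Lemma mmul_1l A : mmul mid A = A.
Proof. plane; ring. Qed.

Lemma mmul_1r A : mmul A mid = A.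
Proof. plane; ring. Qed.

Lemma mtr_mul A B : mtr (mmul A B) = mmul (mtr B) (mtr A).
Proof. plane; ring. Qed.

Lemma mapp_mul A B z : mapp (mmul A B) z = mapp A (mapp B z).
Proof. plane; ring. Qed.

Lemma mapp_sub A x y : mapp A (vsub x y) = vsub (mapp A x) (mapp A y).
Proof. plane; ring. Qed.

Lemma mapp_scal A c x : mapp A (vscal c x) = vscal c (mapp A x).
Proof. plane; ring. Qed.

Lemma minvl A : mdet A <> 0 -> mmul (minv A) A = mid.
Proof. move=> H; rewrite /minv; plane; field; exact: H. Qed.

Lemma minvr A : mdet A <> 0 -> mmul A (minv A) = mid.
Proof. move=> H; rewrite /minv; plane; field; exact: H. Qed.

Lemma mdet_id : mdet mid = 1.
Proof. rewrite /mdet /=; ring. Qed.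

Lemma mdet_inv A : mdet A <> 0 -> mdet (minv A) = / mdet A.
Proof.
move=> H; apply: (Rmult_eq_reg_l (mdet A)) => //.
by rewrite -mdet_mul minvr // mdet_id Rinv_r.
Qed.

(** The adjugate of a 2 by 2 matrix has the same entries up to order and sign, hence the same
    Frobenius norm. *)
Lemma frob_inv A : mdet A <> 0 -> frob (minv A) = frob A / Rabs (mdet A).
Proof.
move=> H; have Hd := Rabs_pos_lt _ H.
apply: sq_eq; first exact: frob_ge0.
  apply: Rmult_le_pos; [exact: frob_ge0 | left; exact: Rinv_0_lt_compat].
rewrite Rpow_mult_distr !frob_sq pow_inv pow2_abs /=.
by field.
Qed.

Lemma frob_pos A : mdet A <> 0 -> 0 < frob A.
Proof.
move=> H; have := det_le_frob A; have := Rabs_pos_lt _ H; have := frob_ge0 A; nra.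
Qed.

Definition aff := (mat2 * R2)%type.
Definition ap (f : aff) (z : R2) : R2 := affg (fst f) (snd f) z.
Definition acomp (f g : aff) : aff := (mmul (fst f) (fst g), ap f (snd g)).
Definition ainv (f : aff) : aff :=
  (minv (fst f), vscal (-1) (mapp (minv (fst f)) (snd f))).
Definition aid : aff := (mid, (0, 0)).
Definition adet (f : aff) : R := mdet (fst f).

Lemma ap_comp f g z : ap (acomp f g) z = ap f (ap g z).
Proof. rewrite /ap; plane; ring. Qed.

Lemma acomp_assoc f g h : acomp f (acomp g h) = acomp (acomp f g) h.
Proof.
rewrite /acomp /= mmul_assoc; f_equal; rewrite /ap; plane; ring.
Qed.

Lemma ap_id z : ap aid z = z.
Proof. rewrite /ap; plane; ring. Qed.

Lemma acomp_1l f : acomp aid f = f.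
Proof. case: f => A t; rewrite /acomp /= mmul_1l; f_equal; exact: ap_id. Qed.

Lemma acomp_1r f : acomp f aid = f.
Proof. case: f => A t; rewrite /acomp /= mmul_1r; f_equal; rewrite /ap; plane; ring. Qed.

Lemma ap_sub f x y : vsub (ap f x) (ap f y) = mapp (fst f) (vsub x y).
Proof. rewrite /ap; plane; ring. Qed.

Lemma adet_comp f g : adet (acomp f g) = adet f * adet g.
Proof. exact: mdet_mul. Qed.

Lemma adet_inv f : adet f <> 0 -> adet (ainv f) = / adet f.
Proof. exact: mdet_inv. Qed.

Lemma adet_inv_neq0 f : adet f <> 0 -> adet (ainv f) <> 0.
Proof. move=> H; rewrite adet_inv //; exact: Rinv_neq_0_compat. Qed.

Lemma adet_comp_neq0 f g : adet f <> 0 -> adet g <> 0 -> adet (acomp f g) <> 0.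
Proof. move=> H1 H2; rewrite adet_comp; nra. Qed.

Lemma acompVl f : adet f <> 0 -> acomp (ainv f) f = aid.
Proof.
move=> H; rewrite /acomp /ainv /aid /= minvl //; f_equal; rewrite /ap; plane; ring.
Qed.

Lemma acompVr f : adet f <> 0 -> acomp f (ainv f) = aid.
Proof.
move=> H; rewrite /acomp /ainv /aid /= minvr //; f_equal.
rewrite /ap /=.
have -> : affg (fst f) (snd f) (vscal (-1) (mapp (minv (fst f)) (snd f)))
  = vsub (snd f) (mapp (mmul (fst f) (minv (fst f))) (snd f)) by plane; ring.
rewrite minvr //; plane; ring.
Qed.

Lemma apVl f z : adet f <> 0 -> ap (ainv f) (ap f z) = z.
Proof. by move=> H; rewrite -ap_comp acompVl // ap_id. Qed.

Lemma apVr f z : adet f <> 0 -> ap f (ap (ainv f) z) = z.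
Proof. by move=> H; rewrite -ap_comp acompVr // ap_id. Qed.

Lemma ap_lip f x y : dist2 (ap f x) (ap f y) <= frob (fst f) * dist2 x y.
Proof. rewrite !dist2_vnorm ap_sub; exact: frob_bound. Qed.

(** This is the Lipschitz bound of the inverse map, read backwards. *)
Lemma ap_expand f x y : adet f <> 0 ->
  Rabs (adet f) / frob (fst f) * dist2 x y <= dist2 (ap f x) (ap f y).
Proof.
move=> H; have Hd := Rabs_pos_lt _ H; have Hf := frob_pos _ H.
have := ap_lip (ainv f) (ap f x) (ap f y).
rewrite !apVl //= frob_inv // -/(adet f) => H1.
apply: (Rmult_le_reg_l (frob (fst f) / Rabs (adet f))).
  exact: Rdiv_lt_0_compat.
by have -> : frob (fst f) / Rabs (adet f) * (Rabs (adet f) / frob (fst f) * dist2 x y)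
  = dist2 x y by field; lra.
Qed.

Lemma Rabs_le_bounds a b : Rabs a <= b -> - b <= a <= b.
Proof. rewrite /Rabs; case: Rcase_abs; lra. Qed.

(** * Convergent subsequences *)

Definition extraction (sg : nat -> nat) : Prop := forall n, (sg n < sg (S n))%nat.

Lemma extraction_lt sg : extraction sg -> forall m n, (m < n)%nat -> (sg m < sg n)%nat.
Proof.
move=> H m n; elim: n => [|n IH] Hmn; first lia.
have := H n; case: (Nat.eq_dec m n) => [-> //|Hne]; have := IH ltac:(lia); lia.
Qed.

Lemma extraction_ge sg : extraction sg -> forall n, (n <= sg n)%nat.
Proof. by move=> H; elim=> [|n IH]; first lia; have := H n; lia. Qed.

Lemma choice_fun {A B : Type} (P : A -> B -> Prop) :
  (forall a, exists b, P a b) -> exists f : A -> B, forall a, P a (f a).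
Proof.
move=> H; exists (fun a => proj1_sig (constructive_indefinite_description _ (H a))) => a.
exact: (proj2_sig (constructive_indefinite_description _ (H a))).
Qed.

Lemma inv_Sn_pos n : 0 < / INR (S n).
Proof. apply: Rinv_0_lt_compat; exact: lt_0_INR (Nat.lt_0_succ n). Qed.

Lemma inv_Sn_small e : 0 < e -> exists N, forall n, (N <= n)%nat -> / INR (S n) < e.
Proof.
move=> He; case: (archimed_cor1 e He) => N [HN HN0]; exists N => n Hn.
apply: Rle_lt_trans HN; apply: Rinv_le_contravar; first exact: lt_0_INR.
apply: le_INR; lia.
Qed.

Lemma bolzano (u : nat -> R) (M : R) : (forall n, Rabs (u n) <= M) ->
  exists sg, extraction sg /\ exists v, Un_cv (fun n => u (sg n)) v.
Proof.
move=> Hu.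
have [v Hv] : exists v, ValAdh u v.
  apply: (Bolzano_Weierstrass u (fun c => - M <= c <= M)); first exact: compact_P3.
  by move=> n; have := Hu n => /Rabs_le_bounds.
have Hpick : forall Nk : nat * nat, exists p, (fst Nk <= p)%nat /\ Rabs (u p - v) < / INR (S (snd Nk)).
  move=> [N k] /=.
  case: (Hv (disc v (mkposreal _ (inv_Sn_pos k))) N) => [|p [Hp Hd]].
    by exists (mkposreal _ (inv_Sn_pos k)) => x.
  by exists p; split.
case: (choice_fun _ Hpick) => pick Hp.
pose sg := fix sg n := match n with O => pick (O, O) | S n' => pick (S (sg n'), S n') end.
exists sg; split.
  by move=> n; have := proj1 (Hp (S (sg n), S n)).
exists v => e He; case: (inv_Sn_small e He) => N HN; exists N => n Hn.
apply: Rlt_trans (HN n Hn); rewrite /Rdist.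
case: n Hn => [|n] Hn; exact: (proj2 (Hp (_, _))).
Qed.

Lemma Un_cv_extract u v sg : extraction sg -> Un_cv u v -> Un_cv (fun n => u (sg n)) v.
Proof.
move=> Hs Hu e He; case: (Hu e He) => N HN; exists N => n Hn; apply: HN.
have := extraction_ge _ Hs n; lia.
Qed.

Lemma bolzano_fin (k : nat) (u : nat -> nat -> R) (M : R) :
  (forall j n, Rabs (u j n) <= M) ->
  exists sg, extraction sg /\ exists v, forall j, (j < k)%nat -> Un_cv (fun n => u j (sg n)) (v j).
Proof.
move=> Hu; elim: k => [|k [sg [Hs [v Hv]]]].
  by exists (fun n => n); split => [n|]; [lia | exists (fun _ => 0) => j Hj; lia].
case: (bolzano (fun n => u k (sg n)) M) => [n|tau [Ht [w Hw]]]; first exact: Hu.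
exists (fun n => sg (tau n)); split.
  by move=> n; apply: extraction_lt => //; apply: Ht.
exists (fun j => match Nat.eq_dec j k with left _ => w | right _ => v j end) => j Hj.
case: Nat.eq_dec => [-> //|Hne].
by apply: (Un_cv_extract (fun n => u j (sg n))) => //; apply: Hv; lia.
Qed.

Lemma bolzano_R2 (z : nat -> R2) (M : R) : (forall n, vnorm (z n) <= M) ->
  exists sg, extraction sg /\ exists w,
    forall e, 0 < e -> exists N, forall n, (N <= n)%nat -> dist2 (z (sg n)) w < e.
Proof.
move=> Hz.
pose u j n := match j with O => fst (z n) | _ => snd (z n) end.
case: (bolzano_fin 2 u M) => [j n|sg [Hs [v Hv]]].
  apply: Rle_trans (Hz n); case: j => [|j]; [exact: fst_le_vnorm | exact: snd_le_vnorm].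
exists sg; split=> //; exists (v 0%nat, v 1%nat) => e He.
case: (Hv 0%nat ltac:(lia) (e / 2)) => [|N0 H0]; first lra.
case: (Hv 1%nat ltac:(lia) (e / 2)) => [|N1 H1]; first lra.
exists (max N0 N1) => n Hn; rewrite dist2_vnorm.
apply: Rle_lt_trans (vnorm_le_abs _) _ => /=.
have := H0 n ltac:(lia); have := H1 n ltac:(lia); rewrite /Rdist /u; lra.
Qed.

Definition adist (f g : aff) : R :=
  Rabs (m11 (fst f) - m11 (fst g)) + Rabs (m12 (fst f) - m12 (fst g)) +
  Rabs (m21 (fst f) - m21 (fst g)) + Rabs (m22 (fst f) - m22 (fst g)) +
  Rabs (fst (snd f) - fst (snd g)) + Rabs (snd (snd f) - snd (snd g)).

Lemma bolzano_aff (f : nat -> aff) (M : R) :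
  (forall n, frob (fst (f n)) <= M) -> (forall n, vnorm (snd (f n)) <= M) ->
  exists sg, extraction sg /\ exists g,
    forall e, 0 < e -> exists N, forall n, (N <= n)%nat -> adist (f (sg n)) g < e.
Proof.
move=> HA Ht.
pose u j n := match j with
  | 0 => m11 (fst (f n)) | 1 => m12 (fst (f n)) | 2 => m21 (fst (f n)) | 3 => m22 (fst (f n))
  | 4 => fst (snd (f n)) | _ => snd (snd (f n)) end%nat.
have Hsq a A : a ^ 2 <= frob A ^ 2 -> Rabs a <= frob A.
  by move=> H; apply: sq_le; [exact: frob_ge0 | rewrite pow2_abs].
case: (bolzano_fin 6 u M) => [j n|sg [Hs [v Hv]]].
  have := frob_sq (fst (f n)) => E.
  do 4 (case: j => [|j]; first by apply: Rle_trans (HA n); apply: Hsq => /=; nra).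
  case: j => [|j]; apply: Rle_trans (Ht n); [exact: fst_le_vnorm | exact: snd_le_vnorm].
exists sg; split=> //.
exists (M2 (v 0%nat) (v 1%nat) (v 2%nat) (v 3%nat), (v 4%nat, v 5%nat)) => e He.
have Hn j : (j < 6)%nat -> exists N, forall n, (N <= n)%nat -> Rabs (u j (sg n) - v j) < e / 6.
  by move=> Hj; case: (Hv j Hj (e / 6)) => [|N HN]; [lra | exists N].
case: (Hn 0%nat ltac:(lia)) => N0 H0; case: (Hn 1%nat ltac:(lia)) => N1 H1.
case: (Hn 2%nat ltac:(lia)) => N2 H2; case: (Hn 3%nat ltac:(lia)) => N3 H3.
case: (Hn 4%nat ltac:(lia)) => N4 H4; case: (Hn 5%nat ltac:(lia)) => N5 H5.
exists (N0 + N1 + N2 + N3 + N4 + N5)%nat => n HN.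
have := H0 n ltac:(lia); have := H1 n ltac:(lia); have := H2 n ltac:(lia).
have := H3 n ltac:(lia); have := H4 n ltac:(lia); have := H5 n ltac:(lia).
rewrite /u /adist /=; lra.
Qed.

Lemma adist_frob f g : frob (msub (fst f) (fst g)) <= adist f g.
Proof.
apply: Rle_trans (frob_le_abs _) _; rewrite /adist /=.
have := Rabs_pos (fst (snd f) - fst (snd g)); have := Rabs_pos (snd (snd f) - snd (snd g)); lra.
Qed.

Lemma adist_trans f g : vnorm (vsub (snd f) (snd g)) <= adist f g.
Proof.
apply: Rle_trans (vnorm_le_abs _) _; rewrite /adist /=.
have := Rabs_pos (m11 (fst f) - m11 (fst g)); have := Rabs_pos (m12 (fst f) - m12 (fst g)).
have := Rabs_pos (m21 (fst f) - m21 (fst g)); have := Rabs_pos (m22 (fst f) - m22 (fst g)); lra.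
Qed.

Lemma adist_ap f g z : dist2 (ap f z) (ap g z) <= adist f g * (1 + vnorm z).
Proof.
have -> : dist2 (ap f z) (ap g z) =
  vnorm (vadd (mapp (msub (fst f) (fst g)) z) (vsub (snd f) (snd g))).
  rewrite dist2_vnorm; f_equal; rewrite /ap; plane; ring.
have := vnorm_triang (mapp (msub (fst f) (fst g)) z) (vsub (snd f) (snd g)).
have := frob_bound (msub (fst f) (fst g)) z; have := adist_frob f g; have := adist_trans f g.
have := vnorm_ge0 z; nra.
Qed.

(** * Cylinders of a self-similar set with strong separation *)

(** Unlike [sum_f_R0], this sum can be empty, so that [n] is exactly the number of maps of an
    IFS. *)
Fixpoint bsum (n : nat) (f : nat -> R) : R :=
  match n with O => 0 | S n' => bsum n' f + f n' end.

Lemma bsum_le n f g : (forall i, (i < n)%nat -> f i <= g i) -> bsum n f <= bsum n g.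
Proof.
elim: n => [|n IH] H /=; first lra.
have := H n ltac:(lia); have := IH (fun i Hi => H i ltac:(lia)); lra.
Qed.

Lemma bsum_ext n f g : (forall i, (i < n)%nat -> f i = g i) -> bsum n f = bsum n g.
Proof. by move=> H; apply: Rle_antisym; apply: bsum_le => i Hi; rewrite H //; lra. Qed.

Lemma bsum_add n f g : bsum n (fun i => f i + g i) = bsum n f + bsum n g.
Proof. elim: n => [|n IH] /=; [lra | rewrite IH; lra]. Qed.

Lemma bsum_scal n c f : bsum n (fun i => c * f i) = c * bsum n f.
Proof. elim: n => [|n IH] /=; [lra | rewrite IH; lra]. Qed.

Lemma bsum_ge0 n f : (forall i, (i < n)%nat -> 0 <= f i) -> 0 <= bsum n f.
Proof.
elim: n => [|n IH] H /=; first lra.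
have := H n ltac:(lia); have := IH (fun i Hi => H i ltac:(lia)); lra.
Qed.

Lemma bsum_ge_term n f j : (forall i, (i < n)%nat -> 0 <= f i) -> (j < n)%nat -> f j <= bsum n f.
Proof.
elim: n => [|n IH] H Hj /=; first lia.
have Hn := H n ltac:(lia); have Hs := bsum_ge0 n f (fun i Hi => H i ltac:(lia)).
case: (Nat.eq_dec j n) => [->|Hne]; first lra.
have := IH (fun i Hi => H i ltac:(lia)) ltac:(lia); lra.
Qed.

(** The deficit [g j - f j] of one index is kept in the total. In this form a loss inside one
    cylinder passes to the whole set. *)
Lemma bsum_le_but n f g j : (forall i, (i < n)%nat -> f i <= g i) -> (j < n)%nat ->
  bsum n f <= bsum n g - g j + f j.
Proof.
move=> H Hj.
suff : g j + -1 * f j <= bsum n g + -1 * bsum n f by lra.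
rewrite -bsum_scal -bsum_add; apply: (bsum_ge_term n (fun i => g i + -1 * f i)) => // i Hi.
have := H i Hi; lra.
Qed.

(* [ex] is the similarity dimension. *)
Record ifs := Ifs {
  nm : nat;
  mp : nat -> sim;
  att : R2 -> Prop;
  ex : R;
  diam : R;
  gap : R;
  rlo : R;
  rhi : R;
  mp_orth : forall i, (i < nm)%nat -> orthogonal (s_orth (mp i));
  mp_lo : forall i, (i < nm)%nat -> rlo <= Rabs (s_alpha (mp i));
  mp_hi : forall i, (i < nm)%nat -> Rabs (s_alpha (mp i)) <= rhi;
  rlo_pos : 0 < rlo;
  rhi_lt1 : rhi < 1;
  att_inh : exists x, att x;
  att_closed : closed2 att;
  att_self : forall y, att y <-> exists i, (i < nm)%nat /\ image (sim_app (mp i)) att y;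
  att_diam : forall x y, att x -> att y -> dist2 x y <= diam;
  diam_pos : 0 < diam;
  att_gap : forall i j x y, (i < nm)%nat -> (j < nm)%nat -> i <> j -> att x -> att y ->
    gap <= dist2 (sim_app (mp i) x) (sim_app (mp j) y);
  gap_pos : 0 < gap;
  ex_ge0 : 0 <= ex;
  ex_sum : bsum nm (fun i => Rpower (Rabs (s_alpha (mp i))) ex) = 1;
  att_tri : exists a b c, att a /\ att b /\ att c /\ cross (vsub b a) (vsub c a) <> 0
}.

Definition rat (Phi : ifs) (i : nat) : R := Rabs (s_alpha (mp Phi i)).
Definition wgt (Phi : ifs) (i : nat) : R := Rpower (rat Phi i) (ex Phi).
Definition simaff (f : sim) : aff := (mscal (s_alpha f) (s_orth f), s_trans f).
Definition word (Phi : ifs) (I : list nat) : Prop := word_ok (nm Phi) I.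

Fixpoint waff (Phi : ifs) (I : list nat) : aff :=
  match I with nil => aid | i :: I' => acomp (simaff (mp Phi i)) (waff Phi I') end.
Fixpoint wrat (Phi : ifs) (I : list nat) : R :=
  match I with nil => 1 | i :: I' => rat Phi i * wrat Phi I' end.
Fixpoint wwgt (Phi : ifs) (I : list nat) : R :=
  match I with nil => 1 | i :: I' => wgt Phi i * wwgt Phi I' end.
Definition cyl (Phi : ifs) (I : list nat) (y : R2) : Prop :=
  exists x, att Phi x /\ ap (waff Phi I) x = y.

Lemma ap_simaff f z : ap (simaff f) z = sim_app f z.
Proof. rewrite /ap /simaff /sim_app; plane; ring. Qed.

Lemma ap_waff Phi I z : ap (waff Phi I) z = phiw (mp Phi) I z.
Proof. by elim: I => [|i I IH] /=; rewrite ?ap_id // ap_comp IH ap_simaff. Qed.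

Section Words.
Context (Phi : ifs).
Local Notation F := (att Phi).

Lemma word_cons i I : word Phi (i :: I) <-> (i < nm Phi)%nat /\ word Phi I.
Proof. by split=> [H | [H1 H2]]; [inversion H | constructor]. Qed.

Lemma word_nil : word Phi [].
Proof. by constructor. Qed.

Lemma word_app I J : word Phi I -> word Phi J -> word Phi (I ++ J).
Proof. by move=> H1 H2; apply/Forall_app. Qed.

Lemma word_app_inv I J : word Phi (I ++ J) -> word Phi I /\ word Phi J.
Proof. by move=> /Forall_app. Qed.

Lemma waff_app I J : waff Phi (I ++ J) = acomp (waff Phi I) (waff Phi J).
Proof. by elim: I => [|i I IH] /=; rewrite ?acomp_1l // IH acomp_assoc. Qed.

Lemma wrat_app I J : wrat Phi (I ++ J) = wrat Phi I * wrat Phi J.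
Proof. elim: I => [|i I IH] /=; rewrite ?IH; ring. Qed.

Lemma wwgt_app I J : wwgt Phi (I ++ J) = wwgt Phi I * wwgt Phi J.
Proof. elim: I => [|i I IH] /=; rewrite ?IH; ring. Qed.

Lemma rat_pos i : (i < nm Phi)%nat -> 0 < rat Phi i.
Proof. move=> Hi; have := mp_lo Phi i Hi; have := rlo_pos Phi; rewrite /rat; lra. Qed.

Lemma wgt_pos i : 0 < wgt Phi i.
Proof. exact: exp_pos. Qed.

Lemma wrat_pos I : word Phi I -> 0 < wrat Phi I.
Proof.
elim: I => [|i I IH] /=; first lra.
by move=> /word_cons [H1 H2]; apply: Rmult_lt_0_compat; [exact: rat_pos | exact: IH].
Qed.

Lemma wwgt_pos I : 0 < wwgt Phi I.
Proof. elim: I => [|i I IH] /=; [lra | apply: Rmult_lt_0_compat => //; exact: wgt_pos]. Qed.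

Lemma wwgt_wrat I : word Phi I -> wwgt Phi I = Rpower (wrat Phi I) (ex Phi).
Proof.
elim: I => [|i I IH] /=; first by rewrite /Rpower ln_1 Rmult_0_r exp_0.
by move=> /word_cons [H1 H2]; rewrite IH // /wgt Rpower_mult_distr //; [exact: rat_pos | exact: wrat_pos].
Qed.

Lemma rhi_pos : 0 < rhi Phi.
Proof.
case: (att_inh Phi) => x Hx; case: (proj1 (att_self Phi x) Hx) => i [Hi _].
have := mp_lo Phi i Hi; have := mp_hi Phi i Hi; have := rlo_pos Phi; lra.
Qed.

Lemma rlo_le_rhi : rlo Phi <= rhi Phi.
Proof.
case: (att_inh Phi) => x Hx; case: (proj1 (att_self Phi x) Hx) => i [Hi _].
have := mp_lo Phi i Hi; have := mp_hi Phi i Hi; lra.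
Qed.

Lemma wrat_le I : word Phi I -> wrat Phi I <= rhi Phi ^ length I.
Proof.
elim: I => [|i I IH] /=; first lra.
move=> /word_cons [H1 H2]; apply: Rmult_le_compat; [left; exact: rat_pos | left; exact: wrat_pos | exact: mp_hi | exact: IH].
Qed.

Lemma wrat_ge I : word Phi I -> rlo Phi ^ length I <= wrat Phi I.
Proof.
elim: I => [|i I IH] /=; first lra.
move=> /word_cons [H1 H2]; apply: Rmult_le_compat; [left; exact: rlo_pos | apply: pow_le; left; exact: rlo_pos | exact: mp_lo | exact: IH].
Qed.

Lemma wrat_le1 I : word Phi I -> wrat Phi I <= 1.
Proof.
move=> H; apply: Rle_trans (wrat_le _ H) _; rewrite -(pow1 (length I)).
apply: pow_incr; have := rhi_pos; have := rhi_lt1 Phi; lra.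
Qed.

Lemma rhi_pow_small e : 0 < e -> exists n, rhi Phi ^ n < e.
Proof.
have Hp := rhi_pos; move=> He; case: (pow_lt_1_zero (rhi Phi) _ e He) => [|N HN].
  by rewrite (Rabs_pos_eq _ (Rlt_le _ _ Hp)); apply: rhi_lt1.
exists N; have := HN N ltac:(lia); rewrite Rabs_pos_eq //; apply: pow_le; lra.
Qed.

Lemma orthogonal_norm O z : orthogonal O -> vnorm (mapp O z) = vnorm z.
Proof.
rewrite /orthogonal /mmul /mtr /mid /= => -[E1 E2 E3 E4].
apply: sq_eq; [exact: vnorm_ge0 | exact: vnorm_ge0 | rewrite !vnorm_sq /=].
transitivity ((m11 O * m11 O + m21 O * m21 O) * fst z ^ 2
  + (m11 O * m12 O + m21 O * m22 O) * (2 * fst z * snd z)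
  + (m12 O * m12 O + m22 O * m22 O) * snd z ^ 2); first ring.
rewrite E1 E2 E4; ring.
Qed.

Lemma mapp_mscal c A z : mapp (mscal c A) z = vscal c (mapp A z).
Proof. rewrite /mscal; plane; ring. Qed.

Lemma waff_norm I z : word Phi I -> vnorm (mapp (fst (waff Phi I)) z) = wrat Phi I * vnorm z.
Proof.
elim: I z => [|i I IH] z /=.
  move=> _; rewrite Rmult_1_l; f_equal; plane; ring.
move=> /word_cons [H1 H2]; rewrite mapp_mul mapp_mscal vnorm_scal (orthogonal_norm _ _ (mp_orth Phi i H1)) IH //.
rewrite /rat; ring.
Qed.

Lemma waff_dist I x y : word Phi I ->
  dist2 (ap (waff Phi I) x) (ap (waff Phi I) y) = wrat Phi I * dist2 x y.
Proof. by move=> H; rewrite !dist2_vnorm ap_sub waff_norm. Qed.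

Lemma waff_gram I : word Phi I ->
  mmul (mtr (fst (waff Phi I))) (fst (waff Phi I)) = mscal (wrat Phi I ^ 2) mid.
Proof.
elim: I => [|i I IH] /=.
  by move=> _; rewrite /mscal; plane; ring.
move=> /word_cons [H1 H2]; rewrite mtr_mul -mmul_assoc (mmul_assoc (mtr (mscal _ _))).
have -> : mmul (mtr (mscal (s_alpha (mp Phi i)) (s_orth (mp Phi i)))) (mscal (s_alpha (mp Phi i)) (s_orth (mp Phi i)))
   = mscal (rat Phi i ^ 2) mid.
  rewrite -(mp_orth Phi i H1) /rat pow2_abs /mscal; plane; ring.
have -> : mmul (mscal (rat Phi i ^ 2) mid) (fst (waff Phi I)) = mscal (rat Phi i ^ 2) (fst (waff Phi I)).
  rewrite /mscal; plane; ring.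
have -> : mmul (mtr (fst (waff Phi I))) (mscal (rat Phi i ^ 2) (fst (waff Phi I)))
  = mscal (rat Phi i ^ 2) (mmul (mtr (fst (waff Phi I))) (fst (waff Phi I))).
  rewrite /mscal; plane; ring.
rewrite IH // /mscal; plane; ring.
Qed.

Lemma waff_det I : word Phi I -> Rabs (adet (waff Phi I)) = wrat Phi I ^ 2.
Proof.
move=> H; apply: sq_eq; [exact: Rabs_pos | apply: pow2_ge_0 | rewrite pow2_abs].
have := waff_gram I H => E.
have : mdet (mmul (mtr (fst (waff Phi I))) (fst (waff Phi I))) = mdet (mscal (wrat Phi I ^ 2) mid) by rewrite E.
rewrite mdet_mul /adet /mdet /mtr /mscal /=; nra.
Qed.

Lemma waff_det_neq0 I : word Phi I -> adet (waff Phi I) <> 0.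
Proof.
move=> H E; have := waff_det I H; rewrite E Rabs_R0; have := wrat_pos I H; nra.
Qed.

Lemma waff_inj I x y : word Phi I -> ap (waff Phi I) x = ap (waff Phi I) y -> x = y.
Proof. by move=> H E; rewrite -(apVl _ x (waff_det_neq0 I H)) E apVl //; apply: waff_det_neq0. Qed.

Lemma waff_cons i I z : ap (waff Phi (i :: I)) z = ap (waff Phi [i]) (ap (waff Phi I) z).
Proof. by rewrite -ap_comp -waff_app. Qed.

Lemma word1 i : (i < nm Phi)%nat -> word Phi [i].
Proof. by move=> H; apply/word_cons; split=> //; apply: word_nil. Qed.

Lemma wrat1 i : wrat Phi [i] = rat Phi i.
Proof. rewrite /=; ring. Qed.

Lemma ap_waff1 i z : ap (waff Phi [i]) z = sim_app (mp Phi i) z.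
Proof. by rewrite /= acomp_1r ap_simaff. Qed.

Lemma att_cyl1 y : F y <-> exists i, (i < nm Phi)%nat /\ cyl Phi [i] y.
Proof.
split=> [/att_self [i [Hi [x [Hx E]]]] | [i [Hi [x [Hx E]]]]].
  by exists i; split=> //; exists x; rewrite ap_waff1.
by apply/att_self; exists i; split=> //; exists x; rewrite -ap_waff1.
Qed.

Lemma att_waff I x : word Phi I -> F x -> F (ap (waff Phi I) x).
Proof.
elim: I => [|i I IH]; first by rewrite ap_id.
move=> /word_cons [H1 H2] Hx; rewrite waff_cons; apply/att_cyl1.
by exists i; split=> //; exists (ap (waff Phi I) x); split=> //; apply: IH.
Qed.

Lemma cyl_att I y : word Phi I -> cyl Phi I y -> F y.
Proof. by move=> H [x [Hx <-]]; apply: att_waff. Qed.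

Lemma cyl_app I J y : cyl Phi (I ++ J) y <-> exists x, cyl Phi J x /\ ap (waff Phi I) x = y.
Proof.
split=> [[x [Hx E]] | [z [[x [Hx <-]] E]]].
  by exists (ap (waff Phi J) x); rewrite -ap_comp -waff_app; split=> //; exists x.
by exists x; rewrite waff_app ap_comp.
Qed.

Lemma cyl_prefix I J y : word Phi J -> cyl Phi (I ++ J) y -> cyl Phi I y.
Proof. by move=> HJ /cyl_app [x [Hx <-]]; exists x; split=> //; apply: cyl_att Hx. Qed.

Lemma att_level n y : F y -> exists I, word Phi I /\ length I = n /\ cyl Phi I y.
Proof.
elim: n y => [|n IH] y Hy.
  by exists []; split; [exact: word_nil | split=> //; exists y; rewrite ap_id].
case: (proj1 (att_cyl1 y) Hy) => i [Hi [x [Hx E]]].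
case: (IH x Hx) => I [HI [HL HC]]; exists (i :: I); split; first by apply/word_cons.
split; first by rewrite /= HL.
by apply/(cyl_app [i] I); exists x.
Qed.

(** A first letter different from that of [I] would put [y] at distance at least [gap] from [x]. If
    it is the same letter, both points are zoomed out by it, which rescales the distance and the
    bound alike. *)
Lemma cyl_gap I x y : word Phi I -> cyl Phi I x -> F y -> dist2 x y < gap Phi * wrat Phi I -> cyl Phi I y.
Proof.
elim: I x y => [|i I IH] x y; first by move=> _ _ Hy _; exists y; rewrite ap_id.
move=> /word_cons [Hi HI] /(cyl_app [i] I) [x' [Hx' Ex]] Hy Hd; have Hri := rat_pos i Hi.
case: (proj1 (att_cyl1 y) Hy) => j [Hj [y' [Hy' Ey]]].
have Fx' : F x' by apply: cyl_att Hx'.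
have Eij : i = j.
  apply: NNPP => Hne; have := att_gap Phi i j x' y' Hi Hj Hne Fx' Hy'.
  rewrite -!ap_waff1 Ex Ey.
  have := wrat_le1 (i :: I) ltac:(by apply/word_cons); have := gap_pos Phi; nra.
subst j; apply/(cyl_app [i] I); exists y'; split=> //; apply: (IH x') => //.
have := waff_dist [i] x' y' (word1 i Hi); rewrite Ex Ey wrat1 => E.
move: Hd; rewrite E /= => Hd; nra.
Qed.

Lemma cyl_diam I x y : word Phi I -> cyl Phi I x -> cyl Phi I y -> dist2 x y <= diam Phi * wrat Phi I.
Proof.
move=> H [x' [Hx <-]] [y' [Hy <-]]; rewrite waff_dist //.
have := wrat_pos I H; have := att_diam Phi x' y' Hx Hy; nra.
Qed.

Lemma cyl_disj I J y : word Phi I -> word Phi J -> length I = length J ->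
  cyl Phi I y -> cyl Phi J y -> I = J.
Proof.
elim: I J y => [|i I IH] [|j J] y //= HI HJ [EL].
move: HI HJ => /word_cons [Hi HI] /word_cons [Hj HJ].
move=> /(cyl_app [i] I) [x [Hx Ex]] /(cyl_app [j] J) [x' [Hx' Ex']].
have Fx : F x by apply: cyl_att Hx.
have Fx' : F x' by apply: cyl_att Hx'.
have Eij : i = j.
  apply: NNPP => Hne; have := att_gap Phi i j x x' Hi Hj Hne Fx Fx'.
  rewrite -!ap_waff1 Ex Ex' dist2_xx; have := gap_pos Phi; lra.
subst j; f_equal; apply: (IH J x) => //.
have -> : x = x' by apply: (waff_inj [i]); [exact: word1 | rewrite Ex Ex'].
by [].
Qed.

End Words.

(** * The self-similar measure *)

Section Measure.
Context (Phi : ifs).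
Local Notation F := (att Phi).
Implicit Types (E : R2 -> Prop) (I J : list nat).

(** The part of [E] in the cylinder [I], zoomed out to the size of [F]; its [mu] is the proportion
    of the cylinder that [E] fills. *)
Definition wpre I E : R2 -> Prop := fun z => E (ap (waff Phi I) z).

(* The total weight of the cylinders of level [n] that meet [E].  Its limit [mu E] is the
   self-similar measure of the closure of [E]; on arbitrary sets it is only subadditive. *)
Fixpoint cover (n : nat) E : R :=
  match n with
  | O => match excluded_middle_informative (exists z, F z /\ E z) with left _ => 1 | right _ => 0 end
  | S n' => bsum (nm Phi) (fun i => wgt Phi i * cover n' (wpre [i] E))
  end.

Lemma wgt_sum : bsum (nm Phi) (wgt Phi) = 1.
Proof. exact: ex_sum. Qed.

Lemma wgt_mul_le i a b : a <= b -> wgt Phi i * a <= wgt Phi i * b.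
Proof. move=> H; have := wgt_pos Phi i; nra. Qed.

Lemma wgt_sum_scal c : bsum (nm Phi) (fun i => wgt Phi i * c) = c.
Proof.
rewrite (bsum_ext _ _ (fun i => c * wgt Phi i)) => [i _|]; first ring.
by rewrite bsum_scal wgt_sum Rmult_1_r.
Qed.

Lemma cover0_in E : (exists z, F z /\ E z) -> cover 0 E = 1.
Proof. by move=> H /=; case: excluded_middle_informative. Qed.

Lemma cover0_out E : ~ (exists z, F z /\ E z) -> cover 0 E = 0.
Proof. by move=> H /=; case: excluded_middle_informative. Qed.

Lemma att_w1 i z : (i < nm Phi)%nat -> F z -> F (ap (waff Phi [i]) z).
Proof. by move=> Hi; apply: att_waff; apply: word1. Qed.

(** [cover n] only sees which cylinders of level [n] are met, so [E] and [E'] may be disjoint. In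
    [rigid] the images under two different maps are compared this way. *)
Lemma cover_mono n E E' :
  (forall I, word Phi I -> length I = n -> (exists y, cyl Phi I y /\ E y) -> exists y, cyl Phi I y /\ E' y) ->
  cover n E <= cover n E'.
Proof.
elim: n E E' => [|n IH] E E' H.
  case: (classic (exists z, F z /\ E z)) => H1; last first.
    rewrite (cover0_out _ H1) /=; case: excluded_middle_informative => _; lra.
  rewrite (cover0_in _ H1) (cover0_in E'); last lra.
  case: H1 => z [Fz Ez]; case: (H [] (word_nil Phi) eq_refl) => [|y [Cy Ey]].
    by exists z; split=> //; exists z; rewrite ap_id.
  by exists y; split=> //; apply: cyl_att Cy; apply: word_nil.
apply: bsum_le => i Hi; apply: wgt_mul_le; apply: IH => I HI HL [y [Cy Ey]].
case: (H (i :: I)) => [|||y' [Cy' Ey']]; first by apply/word_cons.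
- by rewrite /= HL.
- by exists (ap (waff Phi [i]) y); split=> //; apply/(cyl_app Phi [i] I); exists y.
- by case: (proj1 (cyl_app Phi [i] I y') Cy') => x [Cx Ex]; exists x; split=> //; rewrite /wpre Ex.
Qed.

Lemma cover_sub n E E' : (forall z, F z -> E z -> E' z) -> cover n E <= cover n E'.
Proof.
move=> H; apply: cover_mono => I HI _ [y [Cy Ey]]; exists y; split=> //; apply: H => //.
exact: cyl_att Cy.
Qed.

(** Superadditivity at a level that separates the two sets, as a substitute for additivity. *)
Lemma cover_disj n E E' :
  (forall I, word Phi I -> length I = n -> (exists y, cyl Phi I y /\ E y) ->
     (exists y, cyl Phi I y /\ E' y) -> False) ->
  cover n E + cover n E' <= cover n (fun z => E z \/ E' z).
Proof.
elim: n E E' => [|n IH] E E' H.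
  have H' : (exists z, F z /\ E z) -> (exists z, F z /\ E' z) -> False.
    move=> [z [Fz Ez]] [z' [Fz' Ez']]; apply: (H [] (word_nil Phi) eq_refl).
      by exists z; split=> //; exists z; rewrite ap_id.
    by exists z'; split=> //; exists z'; rewrite ap_id.
  case: (classic (exists z, F z /\ E z)) => H1.
    rewrite (cover0_in _ H1) (cover0_out E'); first by move=> H2; apply: H'.
    rewrite cover0_in; last lra; case: H1 => z [Fz Ez]; exists z; split=> //; by left.
  rewrite (cover0_out _ H1).
  case: (classic (exists z, F z /\ E' z)) => H2.
    rewrite (cover0_in _ H2) cover0_in; last lra.
    case: H2 => z [Fz Ez]; exists z; split=> //; by right.
  rewrite (cover0_out _ H2) cover0_out; last lra.
  by move=> [z [Fz [Ez|Ez]]]; [apply: H1; exists z | apply: H2; exists z].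
rewrite /= -bsum_add; apply: bsum_le => i Hi; rewrite -Rmult_plus_distr_l.
apply: wgt_mul_le; apply: IH => I HI HL [y [Cy Ey]] [y' [Cy' Ey']].
apply: (H (i :: I)); first by apply/word_cons.
- by rewrite /= HL.
- by exists (ap (waff Phi [i]) y); split=> //; apply/(cyl_app Phi [i] I); exists y.
- by exists (ap (waff Phi [i]) y'); split=> //; apply/(cyl_app Phi [i] I); exists y'.
Qed.

Lemma cover_ge0 n E : 0 <= cover n E.
Proof.
elim: n E => [|n IH] E /=; first by case: excluded_middle_informative => _; lra.
apply: bsum_ge0 => i Hi; have := IH (wpre [i] E); have := wgt_pos Phi i; nra.
Qed.

Lemma cover_full n E : (forall z, F z -> E z) -> cover n E = 1.
Proof.
elim: n E => [|n IH] E H.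
  by case: (att_inh Phi) => x Hx; apply: cover0_in; exists x; split; [|apply: H].
rewrite -[RHS]wgt_sum /=; apply: bsum_ext => i Hi; rewrite IH; last ring.
by move=> z Fz; apply: H; apply: att_w1.
Qed.

Lemma cover_empty n E : (forall z, F z -> ~ E z) -> cover n E = 0.
Proof.
elim: n E => [|n IH] E H; first by apply: cover0_out => -[z [Fz]]; apply: H.
rewrite /= (bsum_ext _ _ (fun i => wgt Phi i * 0)) ?wgt_sum_scal // => i Hi.
by rewrite IH // => z Fz; apply: H; apply: att_w1.
Qed.

Lemma cover_subadd n E E' : cover n (fun z => E z \/ E' z) <= cover n E + cover n E'.
Proof.
elim: n E E' => [|n IH] E E'.
  case: (classic (exists z, F z /\ E z)) => H1.
    have H2 := cover_ge0 0 E'.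
    rewrite (cover0_in _ H1) cover0_in; last lra.
    by case: H1 => z [Fz Ez]; exists z; split=> //; left.
  have H2 := cover_ge0 0 E.
  suff : cover 0 (fun z => E z \/ E' z) <= cover 0 E' by lra.
  by apply: cover_sub => z Fz [Ez|//]; case: H1; exists z.
rewrite /= -bsum_add; apply: bsum_le => i Hi; rewrite -Rmult_plus_distr_l.
by apply: wgt_mul_le; apply: IH.
Qed.

Lemma cover_decr n E : cover (S n) E <= cover n E.
Proof.
elim: n E => [|n IH] E; last by apply: bsum_le => i Hi; apply: wgt_mul_le; apply: IH.
case: (classic (exists z, F z /\ E z)) => H1; last first.
  by rewrite !cover_empty; try lra; move=> z Fz Ez; apply: H1; exists z.
rewrite (cover0_in _ H1) -[X in _ <= X]wgt_sum; apply: bsum_le => i Hi.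
rewrite -[X in _ <= X]Rmult_1_r; apply: wgt_mul_le => /=.
case: excluded_middle_informative => _; lra.
Qed.

Lemma cover_antitone m n E : (m <= n)%nat -> cover n E <= cover m E.
Proof. elim=> [|k Hk IH]; first lra; have := cover_decr k E; lra. Qed.

Lemma cover_cv E : {v | Un_cv (fun n => cover n E) v}.
Proof.
apply: decreasing_cv; first by move=> n; apply: cover_decr.
exists 0 => x [n ->]; rewrite /opp_seq; have := cover_ge0 n E; lra.
Qed.

Definition mu E : R := proj1_sig (cover_cv E).

Lemma mu_cv E : Un_cv (fun n => cover n E) (mu E).
Proof. exact: (proj2_sig (cover_cv E)). Qed.

Lemma mu_le_cover n E : mu E <= cover n E.
Proof.
apply: (decreasing_ineq (fun n => cover n E)); [move=> k; exact: cover_decr | exact: mu_cv].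
Qed.

Lemma cover_near_mu E e : 0 < e -> exists n, cover n E < mu E + e.
Proof.
move=> He; case: (mu_cv E e He) => n Hn; exists n.
have := Hn n ltac:(lia); rewrite /Rdist => /Rabs_def2; lra.
Qed.

Lemma mu_glb E c : (forall n, c <= cover n E) -> c <= mu E.
Proof.
move=> H; case: (Rle_lt_dec c (mu E)) => // Hlt.
case: (cover_near_mu E (c - mu E)) => [|n Hn]; [lra | have := H n; lra].
Qed.

Lemma mu_mono E E' : (forall z, F z -> E z -> E' z) -> mu E <= mu E'.
Proof. by move=> H; apply: mu_glb => n; apply: Rle_trans (mu_le_cover n E) _; apply: cover_sub. Qed.

Lemma mu_ext E E' : (forall z, F z -> (E z <-> E' z)) -> mu E = mu E'.
Proof. by move=> H; apply: Rle_antisym; apply: mu_mono => z Fz /H; apply. Qed.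

Lemma mu_ge0 E : 0 <= mu E.
Proof. by apply: mu_glb => n; apply: cover_ge0. Qed.

Lemma mu_full E : (forall z, F z -> E z) -> mu E = 1.
Proof.
move=> H; apply: Rle_antisym.
  by apply: Rle_trans (mu_le_cover 0 E) _; rewrite cover_full //; lra.
by apply: mu_glb => n; rewrite cover_full //; lra.
Qed.

Lemma mu_le1 E : mu E <= 1.
Proof. by rewrite -(mu_full (fun _ => True)) //; apply: mu_mono. Qed.

Lemma mu_empty E : (forall z, F z -> ~ E z) -> mu E = 0.
Proof.
move=> H; apply: Rle_antisym (mu_ge0 E).
by apply: Rle_trans (mu_le_cover 0 E) _; rewrite cover_empty //; lra.
Qed.

Lemma mu_pos_inh E : 0 < mu E -> exists z, F z /\ E z.
Proof.
move=> H; apply: NNPP => Hn; rewrite mu_empty in H; last lra.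
by move=> z Fz Ez; apply: Hn; exists z.
Qed.

Lemma mu_union E E' : mu (fun z => E z \/ E' z) <= mu E + mu E'.
Proof.
apply: le_epsilon => e He.
case: (mu_cv E (e / 2)) => [|n Hn]; first lra; case: (mu_cv E' (e / 2)) => [|m Hm]; first lra.
have := Hn (n + m)%nat ltac:(lia); have := Hm (n + m)%nat ltac:(lia).
rewrite /Rdist => /Rabs_def2 H1 /Rabs_def2 H2.
have := mu_le_cover (n + m) (fun z => E z \/ E' z); have := cover_subadd (n + m) E E'; lra.
Qed.

Lemma mu_union_fin n (E : nat -> R2 -> Prop) :
  mu (fun z => exists i, (i < n)%nat /\ E i z) <= bsum n (fun i => mu (E i)).
Proof.
elim: n => [|n IH] /=; first by rewrite mu_empty; [move=> z _ [i [Hi _]]; lia | lra].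
apply: Rle_trans (Rplus_le_compat_r _ _ _ IH).
apply: Rle_trans (mu_union _ _); apply: mu_mono => z Fz [i [Hi Hz]].
case: (Nat.eq_dec i n) => [<-|Hne]; first by right.
by left; exists i; split=> //; lia.
Qed.

Lemma bsum_cv n (u : nat -> nat -> R) v : (forall i, (i < n)%nat -> Un_cv (u i) (v i)) ->
  Un_cv (fun k => bsum n (fun i => u i k)) (bsum n v).
Proof.
elim: n => [|n IH] H /=.
  by move=> e He; exists 0%nat => k _; rewrite /Rdist Rminus_diag Rabs_R0.
apply: (CV_plus (fun k => bsum n (fun i => u i k))); last by apply: H; lia.
by apply: IH => i Hi; apply: H; lia.
Qed.

(** Shifting the index of a convergent sequence keeps its limit, so the recursion of [cover] becomes
    the self-similarity of [mu]. *)
Lemma mu_step E : mu E = bsum (nm Phi) (fun i => wgt Phi i * mu (wpre [i] E)).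
Proof.
apply: (UL_sequence (fun n => cover (S n) E)).
  by apply: (Un_cv_extract _ _ S) (mu_cv E) => n; lia.
apply: (bsum_cv _ (fun i n => wgt Phi i * cover n (wpre [i] E))) => i Hi.
apply: (CV_mult (fun _ => wgt Phi i)); last exact: mu_cv.
by move=> e He; exists 0%nat => k _; rewrite /Rdist Rminus_diag Rabs_R0.
Qed.

Lemma wpre_cons i I E z : wpre (i :: I) E z <-> wpre I (wpre [i] E) z.
Proof. by rewrite /wpre (waff_cons Phi i I). Qed.

Lemma wpre_app I J E z : wpre (I ++ J) E z <-> wpre J (wpre I E) z.
Proof. by rewrite /wpre waff_app ap_comp. Qed.

(** Everything outside the cylinder [I] is counted with its full weight. *)
Lemma mu_wpre_le E I : word Phi I -> mu E <= 1 - wwgt Phi I + wwgt Phi I * mu (wpre I E).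
Proof.
elim: I E => [|i I IH] E.
  move=> _ /=; rewrite (mu_ext (wpre [] E) E); last lra.
  by move=> z _; rewrite /wpre ap_id.
move=> /word_cons [Hi HI]; rewrite mu_step.
have H := bsum_le_but (nm Phi) (fun j => wgt Phi j * mu (wpre [j] E)) (wgt Phi) i _ Hi.
rewrite wgt_sum in H; apply: Rle_trans (H _) _.
  move=> j Hj; have := mu_le1 (wpre [j] E); have := wgt_pos Phi j; nra.
have := IH (wpre [i] E) HI; rewrite (mu_ext (wpre (i :: I) E) (wpre I (wpre [i] E))).
  by move=> z _; apply: wpre_cons.
have := wgt_pos Phi i => /=; nra.
Qed.

Lemma mu_in_cyl E I : word Phi I -> (forall z, F z -> E z -> cyl Phi I z) ->
  mu E = wwgt Phi I * mu (wpre I E).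
Proof.
elim: I E => [|i I IH] E.
  move=> _ _ /=; rewrite (mu_ext (wpre [] E) E); last lra.
  by move=> z _; rewrite /wpre ap_id.
move=> HiI HE; have /word_cons [Hi HI] := HiI; rewrite mu_step.
have Eq : mu (wpre (i :: I) E) = mu (wpre I (wpre [i] E)).
  by apply: mu_ext => z _; apply: wpre_cons.
have Ei : mu (wpre [i] E) = wwgt Phi I * mu (wpre (i :: I) E).
  rewrite Eq; apply: IH => // z Fz Ez.
  case: (proj1 (cyl_app Phi [i] I _) (HE _ (att_w1 i z Hi Fz) Ez)) => x [Cx Ex].
  by rewrite (waff_inj Phi [i] z x) //; apply: word1.
have Ej j : (j < nm Phi)%nat -> j <> i -> mu (wpre [j] E) = 0.
  move=> Hj Hne; apply: mu_empty => z Fz Ez; apply: Hne.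
  have Cj : cyl Phi [j] (ap (waff Phi [j]) z) by exists z.
  have Ci := cyl_prefix Phi [i] I _ HI (HE _ (att_w1 j z Hj Fz) Ez).
  by case: (cyl_disj Phi [j] [i] _ (word1 Phi j Hj) (word1 Phi i Hi) eq_refl Cj Ci).
rewrite /= Rmult_assoc -Ei; apply: Rle_antisym.
  (* For the upper bound, the sum is compared with the sequence concentrated at [i], since all other
     terms vanish by [Ej]. *)
  have := bsum_le_but (nm Phi) (fun j => wgt Phi j * mu (wpre [j] E))
    (fun j => match Nat.eq_dec j i with left _ => wgt Phi i * mu (wpre [i] E) | right _ => 0 end) i _ Hi.
  suff -> : bsum (nm Phi) (fun j => match Nat.eq_dec j i with left _ => wgt Phi i * mu (wpre [i] E) | right _ => 0 end)
    = wgt Phi i * mu (wpre [i] E).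
    case: Nat.eq_dec => // _ H; apply: Rle_trans (H _) _; last lra.
    move=> j Hj; case: Nat.eq_dec => [->|Hne]; [lra | rewrite Ej //; lra].
  move: (wgt Phi i * _) => c; elim: (nm Phi) Hi => [|n IHn] Hn /=; first lia.
  case: (Nat.eq_dec n i) => [<-|Hne].
    suff -> : bsum n (fun j => match Nat.eq_dec j n with left _ => c | right _ => 0 end) = 0 by lra.
    rewrite (bsum_ext _ _ (fun _ => 0 * 0)) ?bsum_scal; last lra.
    move=> j Hj; case: Nat.eq_dec => [E'|_]; [lia | lra].
  rewrite IHn; [lia | lra].
apply: (bsum_ge_term (nm Phi) (fun j => wgt Phi j * mu (wpre [j] E))) => // j Hj.
have := mu_ge0 (wpre [j] E); have := wgt_pos Phi j; nra.
Qed.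

Lemma mu_miss E I : word Phi I -> (forall z, cyl Phi I z -> ~ E z) -> mu E <= 1 - wwgt Phi I.
Proof.
move=> HI HE; apply: Rle_trans (mu_wpre_le E I HI) _; rewrite mu_empty; last lra.
by move=> z Fz Ez; apply: (HE (ap (waff Phi I) z)) => //; exists z.
Qed.

Lemma wlo_pos : 0 < Rpower (rlo Phi) (ex Phi).
Proof. exact: exp_pos. Qed.

Lemma wwgt_ge I : word Phi I -> Rpower (rlo Phi) (ex Phi) ^ length I <= wwgt Phi I.
Proof.
elim: I => [|i I IH] /=; first lra.
move=> /word_cons [Hi HI]; have H := wlo_pos.
apply: Rmult_le_compat; [lra | apply: pow_le; lra | | exact: IH].
apply: Rle_Rpower_l; [exact: ex_ge0 | split; [exact: rlo_pos | exact: mp_lo]].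
Qed.

Lemma wwgt_le1 I : word Phi I -> wwgt Phi I <= 1.
Proof.
elim: I => [|i I IH] /=; first lra.
move=> /word_cons [Hi HI]; have Hp := wwgt_pos Phi I; have := IH HI; have := wgt_pos Phi i.
have : wgt Phi i <= 1.
  rewrite -wgt_sum; apply: bsum_ge_term => // j _; left; exact: wgt_pos.
nra.
Qed.

End Measure.

(** * Densities of affine images *)

Section Density.
Context (Phi : ifs).
Local Notation F := (att Phi).
Local Notation mu := (mu Phi).
Implicit Types (E : R2 -> Prop) (I J : list nat).

(** A set of diameter [d] sits in a cylinder of ratio comparable to [d / gap], whose weight is of
    this order; see [mu_diam]. *)
Definition dbound (d : R) : R := Rpower (d / gap Phi) (ex Phi).

Lemma dbound_pos d : 0 < dbound d.
Proof. exact: exp_pos. Qed.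

Lemma dbound_scal i d : (i < nm Phi)%nat -> 0 < d ->
  wgt Phi i * dbound (d / rat Phi i) = dbound d.
Proof.
move=> Hi Hd; have Hr := rat_pos Phi i Hi; have Hg := gap_pos Phi.
rewrite /wgt /dbound Rpower_mult_distr //; first by apply: Rdiv_lt_0_compat => //; apply: Rdiv_lt_0_compat.
f_equal; field; lra.
Qed.

Lemma dbound_ge1 d : gap Phi <= d -> 1 <= dbound d.
Proof.
move=> H; have Hg := gap_pos Phi; rewrite /dbound -(Rpower_O (d / gap Phi)).
  by apply: Rdiv_lt_0_compat; lra.
apply: Rle_Rpower; last exact: ex_ge0.
by apply: (Rmult_le_reg_r (gap Phi)) => //; rewrite Rdiv_def Rmult_assoc Rinv_l; lra.
Qed.

(** Upper regularity of [mu]. A set of diameter below [gap] lies in one first-level cylinder;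
    zooming out changes measure and bound by the same factor ([dbound_scal]). After at most [n]
    zooms [d] exceeds [gap], and the bound is at least 1. *)
Lemma mu_diam E d : 0 < d ->
  (forall x y, F x -> E x -> F y -> E y -> dist2 x y <= d) -> mu E <= dbound d.
Proof.
move=> Hd0; have [n Hn] : exists n, gap Phi * rhi Phi ^ n <= d.
  case: (rhi_pow_small Phi (d / gap Phi)) => [|n Hn].
    by apply: Rdiv_lt_0_compat => //; apply: gap_pos.
  have Hg := gap_pos Phi; exists n; left.
  have -> : d = gap Phi * (d / gap Phi) by field; lra.
  exact: Rmult_lt_compat_l.
elim: n d Hd0 Hn E => [|n IH] d Hd0 Hn E HE.
  by apply: Rle_trans (mu_le1 Phi E) _; apply: dbound_ge1; rewrite /= in Hn; lra.
case: (Rle_lt_dec (gap Phi) d) => Hd.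
  by apply: Rle_trans (mu_le1 Phi E) _; apply: dbound_ge1.
case: (classic (exists z, F z /\ E z)) => [[z [Fz Ez]] | Hno]; last first.
  rewrite mu_empty; last by left; apply: dbound_pos.
  by move=> z Fz Ez; apply: Hno; exists z.
case: (proj1 (att_cyl1 Phi z) Fz) => i [Hi Cz].
have Hr := rat_pos Phi i Hi; have Hr1 := mp_hi Phi i Hi.
rewrite (mu_in_cyl Phi E [i]); first exact: word1.
  move=> y Fy Ey; case: (proj1 (att_cyl1 Phi y) Fy) => j [Hj Cy].
  case: (Nat.eq_dec i j) => [-> //|Hne].
  case: Cz Cy => [z' [Fz' Ez']] [y' [Fy' Ey']].
  have := att_gap Phi i j z' y' Hi Hj Hne Fz' Fy'.
  rewrite -!ap_waff1 Ez' Ey'; have := HE z y Fz Ez Fy Ey; lra.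
rewrite /= Rmult_1_r -(dbound_scal i d) //; apply: wgt_mul_le; apply: IH.
- exact: Rdiv_lt_0_compat.
- apply: (Rmult_le_reg_r (rat Phi i)) => //.
  have -> : d / rat Phi i * rat Phi i = d by field; lra.
  apply: Rle_trans Hn => /=.
  have := pow_le (rhi Phi) n (Rlt_le _ _ (rhi_pos Phi)); have := gap_pos Phi.
  rewrite -/(rat Phi i) in Hr1 => H1 H2; have := Rmult_le_pos _ _ (Rlt_le _ _ H1) H2; nra.
- move=> x y Fx Ex Fy Ey; apply: (Rmult_le_reg_r (rat Phi i)) => //.
  have -> : d / rat Phi i * rat Phi i = d by field; lra.
  have := HE _ _ (att_w1 Phi i x Hi Fx) Ex (att_w1 Phi i y Hi Fy) Ey.
  rewrite waff_dist ?wrat1; first exact: word1.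
  lra.
Qed.

(** As [f] contracts by [k] at worst, the preimage of a cylinder of ratio [r] has diameter at most
    [diam * r / k], hence measure at most a constant times the weight of the cylinder. The induction
    zooms in on the target side, replacing [f] by [phi_i^{-1} f]. *)
Lemma mu_preimage n (k : R) (f : R2 -> R2) E : 0 < k ->
  (forall x y, k * dist2 x y <= dist2 (f x) (f y)) ->
  mu (fun x => F (f x) /\ E (f x)) <= dbound (diam Phi / k) * cover Phi n E.
Proof.
have Hd := diam_pos Phi; elim: n k f E => [|n IH] k f E Hk Hf.
  have Hdk : 0 < diam Phi / k by apply: Rdiv_lt_0_compat.
  case: (classic (exists z, F z /\ E z)) => H1.
    rewrite (cover0_in _ _ H1) Rmult_1_r; apply: mu_diam => // x y _ [Fx _] _ [Fy _].
    apply: (Rmult_le_reg_l k) => //; apply: Rle_trans (Hf x y) _.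
    have -> : k * (diam Phi / k) = diam Phi by field; lra.
    exact: att_diam.
  rewrite (cover0_out _ _ H1) mu_empty; last lra.
  by move=> z Fz [Fx Ex]; apply: H1; exists (f z).
apply: Rle_trans (mu_mono Phi _ (fun x => exists i, (i < nm Phi)%nat /\
   (cyl Phi [i] (f x) /\ E (f x))) _) _.
  by move=> z Fz [Fx Ex]; case: (proj1 (att_cyl1 Phi _) Fx) => i [Hi Ci]; exists i.
apply: Rle_trans (mu_union_fin Phi _ _) _; rewrite /= -bsum_scal.
apply: bsum_le => i Hi; have Hr := rat_pos Phi i Hi.
pose f' x := ap (ainv (waff Phi [i])) (f x).
have Hdet := waff_det_neq0 Phi [i] (word1 Phi i Hi).
have Hff x : f x = ap (waff Phi [i]) (f' x) by rewrite /f' apVr.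
have H := IH (k / rat Phi i) f' (wpre Phi [i] E) (Rdiv_lt_0_compat _ _ Hk Hr).
have Eq : dbound (diam Phi / k) * (wgt Phi i * cover Phi n (wpre Phi [i] E))
   = wgt Phi i * dbound (diam Phi / k) * cover Phi n (wpre Phi [i] E) by ring.
rewrite Eq.
have -> : wgt Phi i * dbound (diam Phi / k) = dbound (diam Phi / (k / rat Phi i)).
  rewrite -(dbound_scal i (diam Phi / (k / rat Phi i))) //.
    by apply: Rdiv_lt_0_compat => //; apply: Rdiv_lt_0_compat.
  do 2 f_equal; field; lra.
apply: Rle_trans (H _); last first.
  move=> x y; have := Hf x y; rewrite !Hff waff_dist ?wrat1; first exact: word1.
  move=> H1; apply: (Rmult_le_reg_l (rat Phi i)) => //.
  have -> : rat Phi i * (k / rat Phi i * dist2 x y) = k * dist2 x y by field; lra.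
  done.
apply: mu_mono => x Fx [[w [Fw Ew]] Ex]; split; last by rewrite /wpre -Hff.
by rewrite /f' -Ew apVl.
Qed.

Definition imF (f : aff) : R2 -> Prop := fun y => exists x, F x /\ ap f x = y.

(** [c] bounds the density of the pullback of [mu] under [f]. Testing on cylinders is enough, as
    [mu_image] extends the bound to all sets. *)
Definition dominated (f : aff) (c : R) : Prop :=
  forall I, word Phi I -> mu (imF (acomp f (waff Phi I))) <= c * wwgt Phi I.

Lemma dominated_ge0 f c : dominated f c -> 0 <= c.
Proof.
move=> H; have := H [] (word_nil Phi); have := mu_ge0 Phi (imF (acomp f (waff Phi []))).
rewrite /=; lra.
Qed.

Lemma dominated_sub f c I : word Phi I -> dominated f c ->
  dominated (acomp f (waff Phi I)) (c * wwgt Phi I).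
Proof.
move=> HI H J HJ; rewrite -acomp_assoc -waff_app Rmult_assoc -wwgt_app.
by apply: H; apply: word_app.
Qed.

Lemma mu_image f c E : dominated f c ->
  mu (fun y => exists x, F x /\ E x /\ ap f x = y) <= c * mu E.
Proof.
move=> Hf; have Hc := dominated_ge0 _ _ Hf.
have Hn n : mu (fun y => exists x, F x /\ E x /\ ap f x = y) <= c * cover Phi n E.
  elim: n f c E Hf Hc => [|n IH] f c E Hf Hc.
    case: (classic (exists z, F z /\ E z)) => H1.
      rewrite (cover0_in _ _ H1); have := Hf [] (word_nil Phi).
      rewrite /= acomp_1r => H; apply: Rle_trans H; apply: mu_mono.
      by move=> y _ [x [Fx [_ Ex]]]; exists x.
    rewrite (cover0_out _ _ H1) mu_empty; last lra.
    by move=> z Fz [x [Fx [Ex _]]]; apply: H1; exists x.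
  apply: Rle_trans (mu_mono Phi _ (fun y => exists i, (i < nm Phi)%nat /\
     (exists x, F x /\ wpre Phi [i] E x /\ ap (acomp f (waff Phi [i])) x = y)) _) _.
    move=> y _ [x [Fx [Ex Ey]]]; case: (proj1 (att_cyl1 Phi x) Fx) => i [Hi [z [Fz Ez]]].
    by exists i; split=> //; exists z; rewrite /wpre ap_comp Ez.
  apply: Rle_trans (mu_union_fin Phi _ _) _; rewrite /= -bsum_scal.
  apply: bsum_le => i Hi; have H1 := dominated_sub f c [i] (word1 Phi i Hi) Hf.
  apply: Rle_trans (IH _ _ _ H1 (dominated_ge0 _ _ H1)) _; rewrite /=; lra.
case: Hc => [Hc|Hc]; last by have := Hn 0%nat; rewrite -Hc !Rmult_0_l.
apply: le_epsilon => e He; case: (cover_near_mu Phi E (e / c)) => [|n H].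
  exact: Rdiv_lt_0_compat.
have := Hn n; have : c * cover Phi n E <= c * (mu E + e / c) by nra.
have -> : c * (mu E + e / c) = c * mu E + e by field; lra.
lra.
Qed.

Lemma dominated_exists f : adet f <> 0 -> exists c, dominated f c.
Proof.
move=> Hf; have Hp := frob_pos _ Hf; have Hd := diam_pos Phi.
exists (dbound (frob (fst f) * diam Phi)) => I HI; have Hr := wrat_pos Phi I HI.
apply: Rle_trans (mu_diam _ (frob (fst f) * diam Phi * wrat Phi I) _ _) _.
- by do 2 apply: Rmult_lt_0_compat => //.
- move=> _ _ _ [x [Fx <-]] _ [y [Fy <-]]; rewrite !ap_comp.
  apply: Rle_trans (ap_lip _ _ _) _; rewrite waff_dist // Rmult_assoc.
  have := att_diam Phi x y Fx Fy => H; apply: Rmult_le_compat_l; [lra | nra].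
- rewrite /dbound wwgt_wrat // Rpower_mult_distr //.
    by apply: Rdiv_lt_0_compat; [apply: Rmult_lt_0_compat | apply: gap_pos].
  by right; f_equal; field; have := gap_pos Phi; lra.
Qed.

Definition emb (f : aff) : Prop := adet f <> 0 /\ forall z, F z -> F (ap f z).

Lemma emb_comp f g : emb f -> emb g -> emb (acomp f g).
Proof.
move=> [H1 H2] [H3 H4]; split; first exact: adet_comp_neq0.
by move=> z Fz; rewrite ap_comp; apply: H2; apply: H4.
Qed.

Lemma emb_waff I : word Phi I -> emb (waff Phi I).
Proof. by move=> H; split; [apply: waff_det_neq0 | move=> z; apply: att_waff]. Qed.

(** Cramer's rule: a linear form is recovered from its values on two independent vectors. *)
Lemma linear_from_two p q u v : cross u v <> 0 ->
  p = ((p * fst u + q * snd u) * snd v - (p * fst v + q * snd v) * snd u) / cross u v /\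
  q = ((p * fst v + q * snd v) * fst u - (p * fst u + q * snd u) * fst v) / cross u v.
Proof. by rewrite /cross => H; split; field. Qed.

Lemma coef_bound (a b c d P Q w : R) : w <> 0 -> Rabs a <= P -> Rabs b <= Q -> Rabs c <= P -> Rabs d <= Q ->
  Rabs ((a * b - c * d) / w) <= 2 * P * Q / Rabs w.
Proof.
move=> Hw Ha Hb Hc Hd; have Hp := Rabs_pos_lt _ Hw.
rewrite Rdiv_def Rabs_mult Rabs_inv Rdiv_def; apply: Rmult_le_compat_r.
  by left; apply: Rinv_0_lt_compat.
apply: Rle_trans (Rabs_triang _ _) _; rewrite Rabs_Ropp !Rabs_mult.
have := Rabs_pos a; have := Rabs_pos b; have := Rabs_pos c; have := Rabs_pos d; nra.
Qed.

(** A fixed triangle of [F] is sent into [F], so the edge images have length at most [diam], and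
    Cramer's rule bounds the linear part. The image of one vertex then bounds the translation. *)
Lemma self_map_bounded : exists C, 0 < C /\ forall f : aff, (forall z, F z -> F (ap f z)) ->
  frob (fst f) <= C /\ vnorm (snd f) <= C.
Proof.
case: (att_tri Phi) => a [b [c [Fa [Fb [Fc Hx]]]]].
have Hw := Rabs_pos_lt _ Hx; have Hd := diam_pos Phi; have Na := vnorm_ge0 a.
(* Four entries, each at most twice [diam ^ 2] over the cross product. *)
pose C1 := 8 * (diam Phi * diam Phi) / Rabs (cross (vsub b a) (vsub c a)).
have C1p : 0 < C1 by apply: Rdiv_lt_0_compat => //; nra.
have Hsolve f : (forall z, F z -> F (ap f z)) -> frob (fst f) <= C1.
  move=> Hf.
  have H1 := att_diam Phi _ _ (Hf b Fb) (Hf a Fa); have H2 := att_diam Phi _ _ (Hf c Fc) (Hf a Fa).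
  have H3 := att_diam Phi b a Fb Fa; have H4 := att_diam Phi c a Fc Fa.
  rewrite dist2_vnorm ap_sub in H1; rewrite dist2_vnorm ap_sub in H2; rewrite !dist2_vnorm in H3 H4.
  have [u1 u2] := (Rle_trans _ _ _ (fst_le_vnorm _) H3, Rle_trans _ _ _ (snd_le_vnorm _) H3).
  have [v1 v2] := (Rle_trans _ _ _ (fst_le_vnorm _) H4, Rle_trans _ _ _ (snd_le_vnorm _) H4).
  have [p1 p2] := (Rle_trans _ _ _ (fst_le_vnorm _) H1, Rle_trans _ _ _ (snd_le_vnorm _) H1).
  have [q1 q2] := (Rle_trans _ _ _ (fst_le_vnorm _) H2, Rle_trans _ _ _ (snd_le_vnorm _) H2).
  rewrite /= in p1 p2 q1 q2.
  have [E1 E2] := linear_from_two (m11 (fst f)) (m12 (fst f)) _ _ Hx.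
  have [E3 E4] := linear_from_two (m21 (fst f)) (m22 (fst f)) _ _ Hx.
  apply: Rle_trans (frob_le_abs _) _.
  have B1 : Rabs (m11 (fst f)) <= 2 * diam Phi * diam Phi / Rabs (cross (vsub b a) (vsub c a)).
    by rewrite E1; apply: coef_bound.
  have B2 : Rabs (m12 (fst f)) <= 2 * diam Phi * diam Phi / Rabs (cross (vsub b a) (vsub c a)).
    by rewrite E2; apply: coef_bound.
  have B3 : Rabs (m21 (fst f)) <= 2 * diam Phi * diam Phi / Rabs (cross (vsub b a) (vsub c a)).
    by rewrite E3; apply: coef_bound.
  have B4 : Rabs (m22 (fst f)) <= 2 * diam Phi * diam Phi / Rabs (cross (vsub b a) (vsub c a)).
    by rewrite E4; apply: coef_bound.
  rewrite /C1; lra.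
exists (C1 + (diam Phi + vnorm a + C1 * vnorm a)); split; first by nra.
move=> f Hf; have Hfr := Hsolve f Hf; split; first by nra.
have -> : snd f = vadd (vsub (ap f a) a) (vadd a (vscal (-1) (mapp (fst f) a))).
  rewrite /ap; plane; ring.
have := vnorm_triang (vsub (ap f a) a) (vadd a (vscal (-1) (mapp (fst f) a))).
have := vnorm_triang a (vscal (-1) (mapp (fst f) a)).
have := att_diam Phi _ _ (Hf a Fa) Fa; rewrite dist2_vnorm.
rewrite vnorm_scal Rabs_left; first lra.
have := frob_bound (fst f) a; have : frob (fst f) * vnorm a <= C1 * vnorm a by nra.
lra.
Qed.

(** The preimage of [imF f] is all of [F], so [mu_preimage] bounds 1 by a constant times any
    [cover n (imF f)]. The constant only involves the expansion bound [d0 / C], valid for all these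
    embeddings. *)
Lemma mu_emb_lower d0 : 0 < d0 -> exists m, 0 < m /\ forall f, emb f -> d0 <= Rabs (adet f) ->
  m <= mu (imF f).
Proof.
move=> Hd0; case: self_map_bounded => C [HC HCf]; have Hd := diam_pos Phi.
have Hk : 0 < d0 / C by apply: Rdiv_lt_0_compat.
have Hb := dbound_pos (diam Phi / (d0 / C)).
exists (/ dbound (diam Phi / (d0 / C))); split; first exact: Rinv_0_lt_compat.
move=> f [Hdet Hf] Hdf; have [Hfr _] := HCf f Hf; have Hp := frob_pos _ Hdet.
apply: mu_glb => n.
have := mu_preimage n (d0 / C) (ap f) (imF f) Hk _.
rewrite (mu_full Phi (fun x => F (ap f x) /\ imF f (ap f x))).
  by move=> z Fz; split; [apply: Hf | exists z].
move=> H; apply: (Rmult_le_reg_l (dbound (diam Phi / (d0 / C)))) => //.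
rewrite Rinv_r; last apply: H; first lra.
move=> x y; apply: Rle_trans (ap_expand _ _ _ Hdet); apply: Rmult_le_compat_r; first exact: dist2_ge0.
rewrite !Rdiv_def; apply: Rmult_le_compat => //; [lra | left; exact: Rinv_0_lt_compat | exact: Rinv_le_contravar].
Qed.

End Density.

(** * Stability near the identity *)

Section Stability.
Context (Phi : ifs).
Local Notation F := (att Phi).
Local Notation mu := (mu Phi).
Implicit Types (E : R2 -> Prop) (I J : list nat) (h : aff).

Definition disp h (z : R2) : R2 := vsub (ap h z) z.
Definition near (tau : R) h : R2 -> Prop := fun x => exists y, F y /\ dist2 (ap h x) y <= tau.
Definition zoom h I : aff := acomp (ainv (waff Phi I)) (acomp h (waff Phi I)).
(** A bound on the linear part of [h - id], written with differences so that conjugation by a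
    similarity visibly preserves it. *)
Definition disp_lip (theta : R) h : Prop :=
  forall x y, vnorm (vsub (disp h x) (disp h y)) <= theta * dist2 x y.

Lemma ap_zoom h I x : word Phi I -> ap (waff Phi I) (ap (zoom h I) x) = ap h (ap (waff Phi I) x).
Proof. by move=> HI; rewrite /zoom !ap_comp apVr //; apply: waff_det_neq0. Qed.

Lemma disp_zoom h I z : word Phi I ->
  disp h (ap (waff Phi I) z) = mapp (fst (waff Phi I)) (disp (zoom h I) z).
Proof. by move=> HI; rewrite /disp -ap_zoom // ap_sub. Qed.

Lemma disp_lip_zoom theta h I : word Phi I -> disp_lip theta h -> disp_lip theta (zoom h I).
Proof.
move=> HI Hh x y; have Hr := wrat_pos Phi I HI.
have := Hh (ap (waff Phi I) x) (ap (waff Phi I) y).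
rewrite !disp_zoom // -mapp_sub waff_norm // waff_dist // => H.
apply: (Rmult_le_reg_l (wrat Phi I)) => //; lra.
Qed.

Lemma near_mono tau tau' h x : tau <= tau' -> near tau h x -> near tau' h x.
Proof. by move=> Ht [y [Fy Hy]]; exists y; split=> //; lra. Qed.

Lemma near_max (g : R2 -> R) B e : 0 < e -> (forall x, F x -> g x <= B) ->
  exists x, F x /\ forall y, F y -> g y <= g x + e.
Proof.
move=> He HB; case: (att_inh Phi) => x0 Fx0.
case: (completeness (fun v => exists x, F x /\ v = g x)) => [||s [Hub Hlub]].
  by exists B => v [x [Fx ->]]; apply: HB.
  by exists (g x0), x0.
apply: NNPP => Hno; suff : s <= s - e by lra.
apply: Hlub => v [x [Fx ->]]; case: (Rle_lt_dec (g x) (s - e)) => // Hlt; case: Hno.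
by exists x; split=> // y Fy; have := Hub (g y) ltac:(by exists y); lra.
Qed.

(** The displacement is almost the constant vector [u]. A level-[k] cylinder around a point of [F]
    that is nearly extreme in the direction [u] is therefore pushed beyond all of [F]. *)
Lemma stab_far e k theta h z0 : 0 < e -> diam Phi * rhi Phi ^ k <= e / 8 ->
  theta * diam Phi <= e / 8 -> 0 <= theta -> disp_lip theta h -> F z0 -> e <= vnorm (disp h z0) ->
  mu (near (e / 2) h) <= 1 - Rpower (rlo Phi) (ex Phi) ^ k.
Proof.
move=> He Hk Hth Ht0 Hl F0 Hz0; set u := disp h z0 in Hz0.
have Hu : 0 < vnorm u by lra.
case: (near_max (fun x => dot (vsub x z0) u) (diam Phi * vnorm u) (vnorm u * (e / 8))) => [||xs [Fxs Hxs]].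
  by apply: Rmult_lt_0_compat; lra.
  move=> x Fx; apply: Rle_trans (dot_le _ _) _; apply: Rmult_le_compat_r; [lra | exact: att_diam].
case: (att_level Phi k xs Fxs) => I [HI [HL CI]].
apply: Rle_trans (mu_miss Phi _ I HI _) _; last by have := wwgt_ge Phi I HI; rewrite HL; lra.
move=> z Cz [y [Fy Hy]]; have Fz : F z by apply: cyl_att Cz.
have H1 : dist2 z xs <= e / 8.
  apply: Rle_trans (cyl_diam Phi I z xs HI Cz CI) _; apply: Rle_trans Hk; apply: Rmult_le_compat_l.
    by left; apply: diam_pos.
  by rewrite -HL; apply: wrat_le.
have H2 : vnorm (vsub (disp h z) u) <= e / 8.
  apply: Rle_trans (Hl z z0) _; apply: Rle_trans Hth; apply: Rmult_le_compat_l => //; exact: att_diam.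
(* The three error terms cost at most [e / 8] each, relative to [vnorm u >= e]; what remains is at
   least [5 * e / 8], more than the tolerance [e / 2]. *)
have Edec : dot (vsub (ap h z) y) u = dot u u + (dot (vsub xs z0) u - dot (vsub y z0) u)
   - dot (vsub xs z) u - dot (vsub u (disp h z)) u.
  rewrite /disp; plane; ring.
have D1 := dot_le (vsub (ap h z) y) u; have D2 := dot_le (vsub xs z) u.
have D3 := dot_le (vsub u (disp h z)) u; have D4 := Hxs y Fy.
have D5 : dot u u = vnorm u ^ 2 by rewrite vnorm_sq /dot /=; ring.
rewrite -dist2_vnorm in D1; rewrite -dist2_vnorm dist2_sym in D2; rewrite vnorm_sym in D3.
have : vnorm u * (e / 2) >= vnorm u * (vnorm u - 3 * (e / 8)) by nra.
nra.
Qed.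

(** The displacement at which zooming stops. Below it, displacement and tolerance [estop / 2] add up
    to less than [gap * rlo], so the point of [F] that [near] provides lies in the same first-level
    cylinder ([near_step]). *)
Definition estop : R := gap Phi * rlo Phi / 2.

Lemma estop_pos : 0 < estop.
Proof. have := gap_pos Phi; have := rlo_pos Phi; rewrite /estop; nra. Qed.

Lemma near_step tau h i x : (forall z, F z -> vnorm (disp h z) < estop) -> tau <= estop / 2 ->
  (i < nm Phi)%nat -> F x -> wpre Phi [i] (near tau h) x -> near (tau / rat Phi i) (zoom h [i]) x.
Proof.
move=> Hh Htau Hi Fx [y [Fy Hy]]; have Hr := rat_pos Phi i Hi.
have Fix := att_w1 Phi i x Hi Fx; have He := estop_pos.
have Cy : cyl Phi [i] y.
  apply: (cyl_gap Phi [i] (ap (waff Phi [i]) x) y (word1 Phi i Hi)) => //; first by exists x.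
  have := dist2_triang (ap (waff Phi [i]) x) (ap h (ap (waff Phi [i]) x)) y.
  have := Hh _ Fix; rewrite /disp -dist2_vnorm dist2_sym wrat1.
  have := mp_lo Phi i Hi; rewrite -/(rat Phi i); have := gap_pos Phi.
  move: Htau He; rewrite /estop; nra.
case: Cy => y' [Fy' Ey]; exists y'; split=> //.
move: Hy; rewrite -Ey -ap_zoom; first exact: word1.
rewrite waff_dist ?wrat1; first exact: word1.
move=> H; apply: (Rmult_le_reg_l (rat Phi i)) => //.
by have -> : rat Phi i * (tau / rat Phi i) = tau by field; lra.
Qed.

(** Each zoom enlarges the lower bound [t] on the displacement by at least [/ rhi], so [n] zooms
    bring it to [estop]; the tolerance is paid for by a factor [rlo] each time. The bound holds in
    every first-level cylinder at once, so the average over them loses nothing of [c0]. *)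
Lemma stab_zoom theta c0 :
  (forall h z0, disp_lip theta h -> F z0 -> estop <= vnorm (disp h z0) -> mu (near (estop / 2) h) <= 1 - c0) ->
  forall n t h, disp_lip theta h -> (forall z, F z -> t <= vnorm (disp h z)) -> estop * rhi Phi ^ n <= t ->
  mu (near (estop / 2 * rlo Phi ^ n) h) <= 1 - c0.
Proof.
move=> Hfar; have He := estop_pos; have Hlo := rlo_pos Phi; have Hlo1 : rlo Phi <= 1.
  by have := rlo_le_rhi Phi; have := rhi_lt1 Phi; lra.
elim=> [|n IH] t h Hl Ht Hn.
  case: (att_inh Phi) => x Fx; rewrite /= Rmult_1_r; apply: (Hfar h x) => //.
  by have := Ht x Fx; rewrite /= in Hn; lra.
have Hpn := pow_lt _ n Hlo; have Hpn1 : rlo Phi ^ n <= 1 by rewrite -(pow1 n); apply: pow_incr; lra.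
have Hs : estop / 2 * rlo Phi ^ S n <= estop / 2.
  have : rlo Phi ^ S n <= 1 by rewrite /=; nra.
  nra.
case: (classic (exists z, F z /\ estop <= vnorm (disp h z))) => [[z [Fz Hz]] | Hno].
  apply: Rle_trans (Hfar h z Hl Fz Hz); apply: mu_mono => x _; exact: near_mono.
have Hsm z : F z -> vnorm (disp h z) < estop.
  by move=> Fz; case: (Rlt_le_dec (vnorm (disp h z)) estop) => // Hz; case: Hno; exists z.
rewrite mu_step -(wgt_sum_scal Phi (1 - c0)); apply: bsum_le => i Hi; apply: wgt_mul_le.
have Hr := rat_pos Phi i Hi.
apply: Rle_trans (IH (t / rat Phi i) (zoom h [i]) _ _ _).
- apply: mu_mono => x Fx Hx; apply: near_mono (near_step _ _ _ _ Hsm Hs Hi Fx Hx).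
  apply: (Rmult_le_reg_r (rat Phi i)) => //.
  have -> : estop / 2 * rlo Phi ^ S n / rat Phi i * rat Phi i = estop / 2 * rlo Phi ^ S n by field; lra.
  have := mp_lo Phi i Hi; rewrite -/(rat Phi i) /= => H.
  have : 0 < estop / 2 * rlo Phi ^ n by nra.
  nra.
- by apply: disp_lip_zoom => //; apply: word1.
- move=> z Fz; apply: (Rmult_le_reg_l (rat Phi i)) => //.
  have := Ht _ (att_w1 Phi i z Hi Fz); rewrite disp_zoom; first exact: word1.
  rewrite waff_norm ?wrat1; first exact: word1.
  by have -> : rat Phi i * (t / rat Phi i) = t by field; lra.
- apply: (Rmult_le_reg_r (rat Phi i)) => //.
  have -> : t / rat Phi i * rat Phi i = t by field; lra.
  have := mp_hi Phi i Hi; rewrite -/(rat Phi i) => H; apply: Rle_trans Hn => /=.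
  have : 0 < estop * rhi Phi ^ n by apply: Rmult_lt_0_compat => //; apply: pow_lt; apply: rhi_pos.
  nra.
Qed.

(** Here a lower bound on the displacement is known on the cylinder [I] only. Everything outside is
    counted in full, which is why [c0] gets the factor [wwgt I]. *)
Lemma stab_word theta c0 : 0 <= c0 ->
  (forall h z0, disp_lip theta h -> F z0 -> estop <= vnorm (disp h z0) -> mu (near (estop / 2) h) <= 1 - c0) ->
  forall I t h, word Phi I -> 0 < t -> disp_lip theta h ->
  (forall z, F z -> t <= vnorm (disp h (ap (waff Phi I) z))) ->
  exists tau, 0 < tau /\ tau <= estop / 2 /\ mu (near tau h) <= 1 - c0 * wwgt Phi I.
Proof.
move=> Hc0 Hfar; have He := estop_pos; elim=> [|i I IH] t h HI Ht Hl Hth.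
  case: (rhi_pow_small Phi (t / estop)) => [|n Hn]; first exact: Rdiv_lt_0_compat.
  have Hlo := pow_lt _ n (rlo_pos Phi); have Hlo1 : rlo Phi ^ n <= 1.
    rewrite -(pow1 n); apply: pow_incr; have := rlo_pos Phi; have := rlo_le_rhi Phi; have := rhi_lt1 Phi; lra.
  exists (estop / 2 * rlo Phi ^ n); split; first by nra.
  split; first by nra.
  rewrite /= Rmult_1_r; apply: (stab_zoom theta c0 Hfar n t) => //.
    by move=> z Fz; have := Hth z Fz; rewrite ap_id.
  have -> : t = estop * (t / estop) by field; lra.
  by left; apply: Rmult_lt_compat_l.
case: (proj1 (word_cons Phi i I) HI) => Hi HI'; have Hr := rat_pos Phi i Hi.
have W1 := wwgt_le1 Phi _ HI; have W0 := wwgt_pos Phi (i :: I).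
case: (classic (exists z, F z /\ estop <= vnorm (disp h z))) => [[z [Fz Hz]] | Hno].
  exists (estop / 2); split; first lra; split; first lra.
  apply: Rle_trans (Hfar h z Hl Fz Hz) _; nra.
have Hsm z : F z -> vnorm (disp h z) < estop.
  by move=> Fz; case: (Rlt_le_dec (vnorm (disp h z)) estop) => // Hz; case: Hno; exists z.
case: (IH (t / rat Phi i) (zoom h [i])) => [||||tau [T0 [T1 T2]]] //.
  exact: Rdiv_lt_0_compat.
  by apply: disp_lip_zoom => //; apply: word1.
  move=> z Fz; apply: (Rmult_le_reg_l (rat Phi i)) => //.
  have := Hth z Fz; rewrite (waff_cons Phi i I) disp_zoom; first exact: word1.
  rewrite waff_norm ?wrat1; first exact: word1.
  by have -> : rat Phi i * (t / rat Phi i) = t by field; lra.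
have Hr1 : rat Phi i <= 1 by have := mp_hi Phi i Hi; have := rhi_lt1 Phi; rewrite /rat; lra.
exists (tau * rat Phi i); split; first exact: Rmult_lt_0_compat.
have Hs : tau * rat Phi i <= estop / 2 by nra.
split=> //; apply: Rle_trans (mu_wpre_le Phi _ [i] (word1 Phi i Hi)) _.
have : mu (wpre Phi [i] (near (tau * rat Phi i) h)) <= mu (near tau (zoom h [i])).
  apply: mu_mono => x Fx Hx; have := near_step _ _ _ _ Hsm Hs Hi Fx Hx.
  by have -> : tau * rat Phi i / rat Phi i = tau by field; lra.
move=> H; have := wgt_pos Phi i => /= Hw.
have : wgt Phi i * mu (wpre Phi [i] (near (tau * rat Phi i) h)) <= wgt Phi i * (1 - c0 * wwgt Phi I) by nra.
nra.
Qed.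

(** Bilinear expansion. The edges change by at most [2 * w], so the two linear terms give [2 + 2]
    and the quadratic one gives [4], as [w <= diam]. *)
Lemma cross_perturb a b c a' b' c' w : 0 <= w -> w <= diam Phi -> F a -> F b -> F c ->
  dist2 a' a <= w -> dist2 b' b <= w -> dist2 c' c <= w ->
  Rabs (cross (vsub b' a') (vsub c' a') - cross (vsub b a) (vsub c a)) <= 8 * w * diam Phi.
Proof.
move=> Hw Hwd Fa Fb Fc Ha Hb Hc; have Hd := diam_pos Phi.
have -> : cross (vsub b' a') (vsub c' a') - cross (vsub b a) (vsub c a) =
  cross (vsub b a) (vsub (vsub c' c) (vsub a' a)) + cross (vsub (vsub b' b) (vsub a' a)) (vsub c a)
  + cross (vsub (vsub b' b) (vsub a' a)) (vsub (vsub c' c) (vsub a' a)) by plane; ring.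
have Hsub x y : vnorm x <= w -> vnorm y <= w -> vnorm (vsub x y) <= 2 * w.
  move=> Hx Hy; have -> : vsub x y = vadd x (vscal (-1) y) by plane; ring.
  apply: Rle_trans (vnorm_triang _ _) _; rewrite vnorm_scal Rabs_left; lra.
rewrite !dist2_vnorm in Ha Hb Hc.
have N1 := Hsub _ _ Hc Ha; have N2 := Hsub _ _ Hb Ha.
have N3 := att_diam Phi b a Fb Fa; have N4 := att_diam Phi c a Fc Fa; rewrite !dist2_vnorm in N3 N4.
apply: Rle_trans (Rabs_triang _ _) _; apply: Rle_trans (Rplus_le_compat_r _ _ _ (Rabs_triang _ _)) _.
have C1 := cross_le (vsub b a) (vsub (vsub c' c) (vsub a' a)).
have C2 := cross_le (vsub (vsub b' b) (vsub a' a)) (vsub c a).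
have C3 := cross_le (vsub (vsub b' b) (vsub a' a)) (vsub (vsub c' c) (vsub a' a)).
have P1 := vnorm_ge0 (vsub b a); have P2 := vnorm_ge0 (vsub c a).
have P3 := vnorm_ge0 (vsub (vsub b' b) (vsub a' a)); have P4 := vnorm_ge0 (vsub (vsub c' c) (vsub a' a)).
have Q1 := Rmult_le_compat _ _ _ _ P1 P4 N3 N1; have Q2 := Rmult_le_compat _ _ _ _ P3 P2 N2 N4.
have Q3 := Rmult_le_compat _ _ _ _ P3 P4 N2 N1; nra.
Qed.

Lemma zero_of_le_all x K : 0 <= K -> (forall t, 0 < t -> Rabs x <= K * t) -> x = 0.
Proof.
move=> HK H; apply: NNPP => Hx; have Hp := Rabs_pos_lt _ Hx.
have := H (Rabs x / (2 * (K + 1))) ltac:(apply: Rdiv_lt_0_compat; lra).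
have -> : K * (Rabs x / (2 * (K + 1))) = Rabs x / 2 * (K / (K + 1)) by field; lra.
have : K / (K + 1) <= 1.
  apply: (Rmult_le_reg_r (K + 1)); first lra.
  have -> : K / (K + 1) * (K + 1) = K by field; lra.
  lra.
nra.
Qed.

(** The level [k] depends on [F] alone. If each cylinder of that level contained points moved
    arbitrarily little, such points near the vertices of a fixed triangle would force [h] to be the
    identity. *)
Lemma moving_cylinder : exists k, forall h, h <> aid -> exists I t, word Phi I /\ length I = k /\ 0 < t /\
  forall z, F z -> t <= vnorm (disp h (ap (waff Phi I) z)).
Proof.
case: (att_tri Phi) => a [b [c [Fa [Fb [Fc Hx]]]]].
have Hw := Rabs_pos_lt _ Hx; have Hd := diam_pos Phi.
set D := cross (vsub b a) (vsub c a) in Hx Hw.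
(* Moving the vertices by [w] keeps at least half of the cross product [D]. *)
pose w := Rmin (diam Phi) (Rabs D / (16 * diam Phi)).
have Hq : 0 < Rabs D / (16 * diam Phi) by apply: Rdiv_lt_0_compat; lra.
have w0 : 0 < w by apply: Rmin_glb_lt.
have w1 : w <= diam Phi by apply: Rmin_l.
have w2 : 8 * w * diam Phi <= Rabs D / 2.
  have H := Rmin_r (diam Phi) (Rabs D / (16 * diam Phi)); rewrite -/w in H.
  have -> : Rabs D / 2 = 8 * (Rabs D / (16 * diam Phi)) * diam Phi by field; lra.
  nra.
case: (rhi_pow_small Phi (w / diam Phi)) => [|k Hk]; first exact: Rdiv_lt_0_compat.
have Hcl I x y : word Phi I -> length I = k -> cyl Phi I x -> cyl Phi I y -> dist2 x y <= w.
  move=> HI HL Cx Cy; apply: Rle_trans (cyl_diam Phi I x y HI Cx Cy) _.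
  have -> : w = diam Phi * (w / diam Phi) by field; lra.
  apply: Rmult_le_compat_l; first lra; have := wrat_le Phi I HI; rewrite HL; lra.
exists k => h Hh; apply: NNPP => Hno.
have Hz x : F x -> forall t, 0 < t -> exists x', F x' /\ dist2 x' x <= w /\ vnorm (disp h x') < t.
  move=> Fx t Ht; case: (att_level Phi k x Fx) => I [HI [HL Cx]].
  apply: NNPP => Hn; apply: Hno; exists I, t; split=> //; split=> //; split=> // z Fz.
  case: (Rle_lt_dec t (vnorm (disp h (ap (waff Phi I) z)))) => // Hlt; case: Hn.
  exists (ap (waff Phi I) z); split; first exact: att_waff.
  by split=> //; apply: (Hcl I) => //; exists z.
apply: Hh.
have Hpts t : 0 < t -> exists a' b' c', F a' /\ F b' /\ F c' /\ vnorm (disp h a') < t /\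
   vnorm (disp h b') < t /\ vnorm (disp h c') < t /\ Rabs D / 2 <= Rabs (cross (vsub b' a') (vsub c' a')).
  move=> Ht; case: (Hz a Fa t Ht) => a' [Fa' [Da Na]]; case: (Hz b Fb t Ht) => b' [Fb' [Db Nb]].
  case: (Hz c Fc t Ht) => c' [Fc' [Dc Nc]]; exists a', b', c'; do 6 split=> //.
  have := cross_perturb a b c a' b' c' w ltac:(lra) w1 Fa Fb Fc Da Db Dc.
  rewrite -/D => H; have := Rabs_triang_inv D (D - cross (vsub b' a') (vsub c' a')).
  have -> : D - (D - cross (vsub b' a') (vsub c' a')) = cross (vsub b' a') (vsub c' a') by ring.
  rewrite (Rabs_minus_sym D); lra.
pose K := 8 * diam Phi / Rabs D.
have K0 : 0 <= K by left; apply: Rdiv_lt_0_compat; lra.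
(* To be applied to the two coordinates of [disp h], whose linear coefficients are the entries of
   [fst h - id]. *)
have Hlin p q (g : R2 -> R) : (forall x y, g x - g y = p * fst (vsub x y) + q * snd (vsub x y)) ->
   (forall x, Rabs (g x) <= vnorm (disp h x)) -> p = 0 /\ q = 0.
  move=> Hg Hgn; suff Hb t : 0 < t -> Rabs p <= K * t /\ Rabs q <= K * t.
    by split; apply: (zero_of_le_all _ K) => // t Ht; case: (Hb t Ht).
  move=> Ht; case: (Hpts t Ht) => a' [b' [c' [Fa' [Fb' [Fc' [Na [Nb [Nc HD]]]]]]]].
  have Hx' : cross (vsub b' a') (vsub c' a') <> 0 by move=> E; rewrite E Rabs_R0 in HD; lra.
  have [E1 E2] := linear_from_two p q _ _ Hx'; rewrite -!Hg in E1 E2.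
  have G x y : vnorm (disp h x) < t -> vnorm (disp h y) < t -> Rabs (g x - g y) <= 2 * t.
    move=> X Y; apply: Rle_trans (Rabs_triang _ _) _; rewrite Rabs_Ropp.
    have := Hgn x; have := Hgn y; lra.
  have N3 := att_diam Phi b' a' Fb' Fa'; have N4 := att_diam Phi c' a' Fc' Fa'; rewrite !dist2_vnorm in N3 N4.
  have [u1 u2] := (Rle_trans _ _ _ (fst_le_vnorm _) N3, Rle_trans _ _ _ (snd_le_vnorm _) N3).
  have [v1 v2] := (Rle_trans _ _ _ (fst_le_vnorm _) N4, Rle_trans _ _ _ (snd_le_vnorm _) N4).
  have HK : 2 * (2 * t) * diam Phi / Rabs (cross (vsub b' a') (vsub c' a')) <= K * t.
    have -> : K * t = 2 * (2 * t) * diam Phi / (Rabs D / 2) by rewrite /K; field; lra.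
    rewrite !Rdiv_def; apply: Rmult_le_compat_l; first by nra.
    by apply: Rinv_le_contravar => //; lra.
  split; apply: Rle_trans HK; [rewrite E1 | rewrite E2]; apply: coef_bound => //; exact: G.
have [p1 p2] : m11 (fst h) - 1 = 0 /\ m12 (fst h) = 0.
  apply: (Hlin _ _ (fun x => fst (disp h x))) => [x y|x]; last exact: fst_le_vnorm.
  rewrite /disp /ap; plane; ring.
have [p3 p4] : m21 (fst h) = 0 /\ m22 (fst h) - 1 = 0.
  apply: (Hlin _ _ (fun x => snd (disp h x))) => [x y|x]; last exact: snd_le_vnorm.
  rewrite /disp /ap; plane; ring.
have Ht0 : snd h = (0, 0).
  apply: vnorm_eq0; apply: (zero_of_le_all _ 1); first lra.
  move=> t Ht; case: (Hz a Fa t Ht) => x [_ [_ Hx']].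
  have -> : vnorm (snd h) = vnorm (disp h x).
    f_equal; rewrite /disp /ap; plane; nra.
  rewrite Rabs_pos_eq; [exact: vnorm_ge0 | lra].
case: h Ht0 p1 p2 p3 p4 {Hno Hz Hpts Hlin} => A s /= -> p1 p2 p3 p4.
rewrite /aid; f_equal; plane; lra.
Qed.

(* Zooming in magnifies the displacement of [h] but not its linear part, until
   some cylinder is moved almost rigidly by a definite amount, off the set. *)
Lemma stability : exists theta eta, 0 < theta /\ 0 < eta /\
  forall h, disp_lip theta h -> h <> aid -> exists tau, 0 < tau /\ mu (near tau h) <= 1 - eta.
Proof.
have He := estop_pos; have Hd := diam_pos Phi.
case: (rhi_pow_small Phi (estop / 8 / diam Phi)) => [|k1 Hk1].
  by apply: Rdiv_lt_0_compat => //; lra.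
case: moving_cylinder => k2 Hk2.
pose wl := Rpower (rlo Phi) (ex Phi); have Hwl : 0 < wl := wlo_pos Phi.
exists (estop / 8 / diam Phi), (wl ^ k1 * wl ^ k2); split.
  by apply: Rdiv_lt_0_compat => //; lra.
split; first by apply: Rmult_lt_0_compat; apply: pow_lt.
move=> h Hl Hh; case: (Hk2 h Hh) => I [t [HI [HL [Ht Hz]]]].
case: (stab_word (estop / 8 / diam Phi) (wl ^ k1) _ _ I t h HI Ht Hl Hz) => [||tau [T0 [_ T]]].
  by left; apply: pow_lt.
  move=> h' z0 Hl' F0 Hz0; apply: (stab_far estop k1 (estop / 8 / diam Phi) h' z0) => //.
    have -> : estop / 8 = diam Phi * (estop / 8 / diam Phi) by field; lra.
    by left; apply: Rmult_lt_compat_l.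
    right; field; lra.
  by left; apply: Rdiv_lt_0_compat => //; lra.
exists tau; split=> //; apply: Rle_trans T _.
have := wwgt_ge Phi I HI; rewrite HL -/wl; have := pow_lt _ k1 Hwl; nra.
Qed.

End Stability.

(** * Rigidity of embeddings of constant density *)

Section Rigidity.
Context (Phi : ifs).
Local Notation F := (att Phi).
Local Notation mu := (mu Phi).
Local Notation imF := (imF Phi).
Local Notation dominated := (dominated Phi).
Local Notation emb := (emb Phi).
Implicit Types (E : R2 -> Prop) (I J : list nat) (f g h : aff).

Lemma att_bounded : exists b, 0 <= b /\ forall z, F z -> vnorm z <= b.
Proof.
case: (att_inh Phi) => a Fa; exists (diam Phi + vnorm a); split.
  have := diam_pos Phi; have := vnorm_ge0 a; lra.
move=> z Fz; have -> : z = vadd (vsub z a) a by plane; ring.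
have := vnorm_triang (vsub z a) a; have := att_diam Phi z a Fz Fa; rewrite dist2_vnorm; lra.
Qed.

(** If [f' <> f], then [h = f^{-1} f'] moves a proportion [eta] of [F] off [F]. The corresponding
    part of [f'(F)] avoids the fine cylinders that meet [f(F)], but stays in the coarse ones, where
    almost no weight is left. So [f'(F)] would have too little measure for its density bound [c]. *)
Lemma rigid f m : emb f -> 0 < m -> exists rho e, 0 < rho /\ 0 < e /\
  forall f' c, emb f' -> adist f' f < rho -> dominated f' c -> (1 - e) * c <= mu (imF f') -> m <= c ->
  f' = f.
Proof.
move=> [Hdf Hf] Hm; case: (stability Phi) => theta [eta [Hth [Heta Hst]]].
case: att_bounded => b [Hb HbF].
(* The coarse level [k]: its cylinders that meet [f(F)] have excess weight below [m * eta / 4], half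
   of the loss [c * eta / 2] to be contradicted. *)
case: (cover_near_mu Phi (imF f) (m * eta / 4)) => [|k Hk].
  by apply: Rdiv_lt_0_compat; [apply: Rmult_lt_0_compat | lra].
have Hfi := frob_pos _ (adet_inv_neq0 _ Hdf); set fi := frob _ in Hfi.
have Hgk : 0 < gap Phi * rlo Phi ^ k.
  by apply: Rmult_lt_0_compat; [apply: gap_pos | apply: pow_lt; apply: rlo_pos].
(* The first bound makes [h] close enough to the identity for [stability]; the second keeps [f' x]
   in the level-[k] cylinder of [f x]. *)
exists (Rmin (theta / fi) (gap Phi * rlo Phi ^ k / (1 + b))), (eta / 2); split.
  by apply: Rmin_glb_lt; apply: Rdiv_lt_0_compat; lra.
split; first lra.
move=> f' c [Hdf' Hf'] Hd Hdom Hmu Hmc; apply: NNPP => Hne.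
have H1 : fi * adist f' f <= theta.
  have := Rlt_le_trans _ _ _ Hd (Rmin_l _ _) => H.
  have -> : theta = fi * (theta / fi) by field; lra.
  by left; apply: Rmult_lt_compat_l.
have H2 : adist f' f * (1 + b) < gap Phi * rlo Phi ^ k.
  have := Rlt_le_trans _ _ _ Hd (Rmin_r _ _) => H.
  have -> : gap Phi * rlo Phi ^ k = gap Phi * rlo Phi ^ k / (1 + b) * (1 + b) by field; lra.
  by apply: Rmult_lt_compat_r; lra.
pose h := acomp (ainv f) f'.
have Hh : h <> aid.
  by move=> E; apply: Hne; rewrite -[f']acomp_1l -(acompVr f) // -acomp_assoc -/h E acomp_1r.
have Hl : disp_lip theta h.
  move=> x y; have -> : vsub (disp h x) (disp h y) =
     mapp (fst (ainv f)) (mapp (msub (fst f') (fst f)) (vsub x y)).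
    rewrite -mapp_mul; have -> : mmul (fst (ainv f)) (msub (fst f') (fst f)) = msub (fst h) mid.
      rewrite /h -(minvl _ Hdf) /=; rewrite /msub; plane; ring.
    rewrite /disp /ap /msub; plane; ring.
  apply: Rle_trans (frob_bound _ _) _; rewrite -/fi; apply: Rle_trans (Rmult_le_compat_r _ _ _ (dist2_ge0 x y) H1).
  rewrite Rmult_assoc; apply: Rmult_le_compat_l; first lra.
  apply: Rle_trans (frob_bound _ _) _; apply: Rmult_le_compat_r; [exact: vnorm_ge0 | exact: adist_frob].
case: (Hst h Hl Hh) => tau [Ht0 Htau].
case: (rhi_pow_small Phi (tau / (fi * diam Phi))) => [|j0 Hj0].
  by apply: Rdiv_lt_0_compat => //; apply: Rmult_lt_0_compat => //; apply: diam_pos.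
(* The fine level: points of a common level-[j] cylinder are pulled back by [f] to points within
   [tau]. *)
pose j := (k + j0)%nat.
have Hj : fi * (diam Phi * rhi Phi ^ j) <= tau.
  have Hp := rhi_pos Phi; have Hd0 := diam_pos Phi.
  have Hk1 : rhi Phi ^ k <= 1 by rewrite -(pow1 k); apply: pow_incr; have := rhi_lt1 Phi; lra.
  have Hk0 := pow_lt _ k Hp; have Hj0' := pow_lt _ j0 Hp.
  have -> : tau = fi * diam Phi * (tau / (fi * diam Phi)) by field; lra.
  rewrite -Rmult_assoc /j pow_add; apply: Rmult_le_compat_l; nra.
pose W y := exists J, word Phi J /\ length J = j /\ cyl Phi J y /\ exists y', cyl Phi J y' /\ imF f y'.
have Hclose x : F x -> dist2 (ap f' x) (ap f x) < gap Phi * rlo Phi ^ k.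
  move=> Fx; apply: Rle_lt_trans H2; apply: Rle_trans (adist_ap _ _ _) _.
  apply: Rmult_le_compat_l; last by have := HbF x Fx; lra.
  by apply: Rle_trans (adist_frob _ _); apply: frob_ge0.
have HA : mu (imF f') <= mu (fun y => exists x, F x /\ near Phi tau h x /\ ap f' x = y)
    + mu (fun y => imF f' y /\ ~ W y).
  apply: Rle_trans (mu_union Phi _ _); apply: mu_mono => y Fy Hy.
  case: (classic (W y)) => HW; [left | by right].
  case: Hy => x [Fx Ex]; exists x; split=> //; split=> //.
  case: HW => J [HJ [HL [Cy [y' [Cy' [w [Fw Ew]]]]]]]; exists w; split=> //.
  rewrite /h ap_comp Ex -[w](apVl f) // Ew.
  apply: Rle_trans (ap_lip _ _ _) _; apply: Rle_trans Hj; apply: Rmult_le_compat_l; first by left.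
  apply: Rle_trans (cyl_diam Phi J _ _ HJ Cy Cy') _; rewrite -HL; apply: Rmult_le_compat_l.
    by left; apply: diam_pos.
  exact: wrat_le.
have HB := mu_image Phi f' c (near Phi tau h) Hdom.
(* These points lie in level-[k] cylinders that meet [f(F)], but in level-[j] cylinders that do
   not. *)
have HC : mu (fun y => imF f' y /\ ~ W y) <= cover Phi k (imF f) - cover Phi j (imF f).
  apply: Rle_trans (mu_le_cover Phi j _) _.
  have := cover_disj Phi j (fun y => imF f' y /\ ~ W y) (imF f) _.
  have := cover_antitone Phi k j (fun y => (imF f' y /\ ~ W y) \/ imF f y) ltac:(rewrite /j; lia).
  have : cover Phi k (fun y => (imF f' y /\ ~ W y) \/ imF f y) <= cover Phi k (imF f).
    apply: cover_mono => J HJ HL [y [Cy [[[x [Fx Ex]] _]|Hy]]]; last by exists y.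
    exists (ap f x); split; last by exists x.
    apply: (cyl_gap Phi J y) => //; first exact: Hf.
    rewrite -Ex; apply: Rlt_le_trans (Hclose x Fx) _; apply: Rmult_le_compat_l.
      by left; apply: gap_pos.
    by rewrite -HL; apply: wrat_ge.
  move=> A1 A2 A3; suff : cover Phi j (fun y => imF f' y /\ ~ W y) + cover Phi j (imF f)
     <= cover Phi j (fun y => (imF f' y /\ ~ W y) \/ imF f y) by lra.
  apply: A3 => J HJ HL [y [Cy [_ HW]]] [y' [Cy' Hy']]; apply: HW.
  by exists J; split=> //; split=> //; split=> //; exists y'.
have HD := mu_le_cover Phi j (imF f).
have : c * mu (near Phi tau h) <= c * (1 - eta) by nra.
nra.
Qed.

Lemma det_close A C : Rabs (mdet A - mdet C) <= (frob A + frob C) * frob (msub A C).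
Proof.
have -> : mdet A - mdet C = (m11 (msub A C) * m22 A + m11 C * m22 (msub A C))
   - (m12 (msub A C) * m21 A + m12 C * m21 (msub A C)) by rewrite /mdet /msub /=; ring.
have H a B : a ^ 2 <= frob B ^ 2 -> Rabs a <= frob B.
  by move=> H; apply: sq_le; [exact: frob_ge0 | rewrite pow2_abs].
set B := msub A C.
have cs x1 x2 y1 y2 X Y : 0 <= X -> 0 <= Y -> x1 ^ 2 + x2 ^ 2 <= X ^ 2 -> y1 ^ 2 + y2 ^ 2 <= Y ^ 2 ->
   Rabs (x1 * y1 - x2 * y2) <= X * Y.
  move=> HX HY H1 H2; apply: sq_le; first by apply: Rmult_le_pos.
  rewrite pow2_abs; have := pow2_ge_0 (x1 * y2 + x2 * y1) => H3.
  apply: Rle_trans (_ : (x1 ^ 2 + x2 ^ 2) * (y1 ^ 2 + y2 ^ 2) <= _); first by nra.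
  rewrite Rpow_mult_distr; apply: Rmult_le_compat => //; nra.
have E1 := frob_sq A; have E2 := frob_sq C; have E3 := frob_sq B.
have -> : m11 B * m22 A + m11 C * m22 B - (m12 B * m21 A + m12 C * m21 B) =
  (m11 B * m22 A - m12 B * m21 A) + (m11 C * m22 B - m12 C * m21 B) by ring.
apply: Rle_trans (Rabs_triang _ _) _.
have K1 := cs (m11 B) (m12 B) (m22 A) (m21 A) (frob B) (frob A) (frob_ge0 _) (frob_ge0 _) ltac:(nra) ltac:(nra).
have K2 := cs (m11 C) (m12 C) (m22 B) (m21 B) (frob C) (frob B) (frob_ge0 _) (frob_ge0 _) ltac:(nra) ltac:(nra).
lra.
Qed.

Lemma emb_compact d (u : nat -> aff) : 0 < d -> (forall n, emb (u n) /\ d <= Rabs (adet (u n))) ->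
  exists sg f, extraction sg /\ emb f /\ d <= Rabs (adet f) /\
  forall e, 0 < e -> exists N, forall n, (N <= n)%nat -> adist (u (sg n)) f < e.
Proof.
move=> Hd Hu; case: (self_map_bounded Phi) => C [HC HCf].
case: (bolzano_aff u C) => [n|n|sg [Hs [f Hf]]]; try exact: (proj1 (HCf _ (proj2 (proj1 (Hu n))))).
  exact: (proj2 (HCf _ (proj2 (proj1 (Hu n))))).
have Hlim e : 0 < e -> exists g, emb g /\ d <= Rabs (adet g) /\ adist g f < e.
  move=> He; case: (Hf e He) => N HN; exists (u (sg N)); case: (Hu (sg N)) => H1 H2.
  by split=> //; split=> //; apply: HN.
have HF z : F z -> F (ap f z).
  move=> Fz; apply: att_closed => e He; have Nz := vnorm_ge0 z.
  case: (Hlim (e / (1 + vnorm z))) => [|g [[_ Hg] [_ Hgd]]]; first by apply: Rdiv_lt_0_compat; lra.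
  exists (ap g z); split; first exact: Hg.
  rewrite dist2_sym; apply: Rle_lt_trans (adist_ap _ _ _) _.
  have -> : e = e / (1 + vnorm z) * (1 + vnorm z) by field; lra.
  apply: Rmult_lt_compat_r => //; lra.
have Hdet : d <= Rabs (adet f).
  apply: le_epsilon => e He; case: (Hlim (e / (2 * C))) => [|g [[_ Hg] [Hgd Hgf]]].
    by apply: Rdiv_lt_0_compat; lra.
  have H1 := det_close (fst g) (fst f); have [C1 _] := HCf f HF; have [C2 _] := HCf g Hg.
  have H2 := adist_frob g f; have H3 := frob_ge0 (msub (fst g) (fst f)).
  have H4 : (frob (fst g) + frob (fst f)) * frob (msub (fst g) (fst f)) <= 2 * C * (e / (2 * C)).
    have := frob_ge0 (fst g); have := frob_ge0 (fst f) => P1 P2.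
    by apply: Rmult_le_compat; lra.
  have E : 2 * C * (e / (2 * C)) = e by field; lra.
  rewrite /adet in Hgd *; have := Rabs_triang_inv (mdet (fst g)) (mdet (fst f)); lra.
exists sg, f; split=> //; split=> //; split=> // E0; rewrite E0 Rabs_R0 in Hdet; lra.
Qed.

(* [f] multiplies the measure by a constant: the reverse inequality is [exact_val]. *)
Definition exact_emb f : Prop := emb f /\ dominated f (mu (imF f)).

Lemma imF_split f : mu (imF f) <= bsum (nm Phi) (fun i => mu (imF (acomp f (waff Phi [i])))).
Proof.
apply: Rle_trans (mu_union_fin Phi _ _); apply: mu_mono => y _ [x [Fx Ex]].
case: (proj1 (att_cyl1 Phi x) Fx) => i [Hi [z [Fz Ez]]]; exists i; split=> //.
by exists z; rewrite ap_comp Ez.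
Qed.

(** The upper bounds over the first-level cylinders add up to the measure of the whole image, so
    none of them can be strict. *)
Lemma exact_val f I : exact_emb f -> word Phi I ->
  mu (imF (acomp f (waff Phi I))) = mu (imF f) * wwgt Phi I.
Proof.
move=> [He Hd] HI; apply: Rle_antisym; first exact: Hd.
(* The generalized hypothesis [c <= mu (imF f')] passes to the piece of [f'] on each first-level
   cylinder. *)
suff : forall c f', dominated f' c -> c <= mu (imF f') -> forall I, word Phi I ->
    c * wwgt Phi I <= mu (imF (acomp f' (waff Phi I))) by move=> H; apply: H => //; lra.
move=> {f I He Hd HI} c f Hd Hc I; elim: I f c Hd Hc => [|i I IH] f c Hd Hc.
  by move=> _ /=; rewrite acomp_1r; lra.
move=> /word_cons [Hi HI].
have H1 := dominated_sub Phi f c [i] (word1 Phi i Hi) Hd.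
have H2 : c * wwgt Phi [i] <= mu (imF (acomp f (waff Phi [i]))).
  have := bsum_le_but (nm Phi) (fun j => mu (imF (acomp f (waff Phi [j])))) (fun j => c * wgt Phi j) i _ Hi.
  rewrite bsum_scal wgt_sum => H; have := imF_split f; rewrite /= Rmult_1_r.
  suff : bsum (nm Phi) (fun j => mu (imF (acomp f (waff Phi [j])))) <=
     c * 1 - c * wgt Phi i + mu (imF (acomp f (waff Phi [i]))) by rewrite /=; lra.
  by apply: H => j Hj; have := Hd [j] (word1 Phi j Hj); rewrite /= Rmult_1_r.
have := IH _ _ H1 H2 HI; rewrite -acomp_assoc -waff_app /= Rmult_1_r; lra.
Qed.

Lemma exact_sub f I : exact_emb f -> word Phi I -> exact_emb (acomp f (waff Phi I)).
Proof.
move=> Hf HI; split; first by apply: emb_comp; [case: Hf | exact: emb_waff].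
by rewrite exact_val //; apply: dominated_sub => //; case: Hf.
Qed.

Lemma mu_imF_waff J f : word Phi J -> (forall z, F z -> F (ap f z)) ->
  mu (imF (acomp (waff Phi J) f)) = wwgt Phi J * mu (imF f).
Proof.
move=> HJ Hf; rewrite (mu_in_cyl Phi _ J HJ).
  by move=> z _ [x [Fx <-]]; rewrite ap_comp; exists (ap f x); split=> //; apply: Hf.
f_equal; apply: mu_ext => z Fz; split=> [[x [Fx Ex]] | [x [Fx Ex]]]; exists x; split=> //.
  by apply: (waff_inj Phi J) => //; rewrite -ap_comp.
by rewrite ap_comp Ex.
Qed.

Lemma exact_post J f : word Phi J -> emb f -> (exact_emb (acomp (waff Phi J) f) <-> exact_emb f).
Proof.
move=> HJ Hf; have Hw := wwgt_pos Phi J; have He : emb (acomp (waff Phi J) f).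
  by apply: emb_comp => //; apply: emb_waff.
have E I : word Phi I -> mu (imF (acomp (acomp (waff Phi J) f) (waff Phi I)))
   = wwgt Phi J * mu (imF (acomp f (waff Phi I))).
  move=> HI; rewrite -acomp_assoc mu_imF_waff //.
  by have [_] := emb_comp Phi _ _ Hf (emb_waff Phi I HI).
have E0 : mu (imF (acomp (waff Phi J) f)) = wwgt Phi J * mu (imF f).
  by rewrite mu_imF_waff //; case: Hf.
split=> [[_ H] | [_ H]]; split=> // I HI; have := H I HI; rewrite E // E0; last by nra.
by rewrite Rmult_assoc => H1; apply: (Rmult_le_reg_l (wwgt Phi J)).
Qed.

(** Otherwise fresh elements could be chosen forever. The premise has the form that a convergent,
    eventually constant subsequence delivers. *)
Lemma finite_of_no_injection {X : Type} (P : X -> Prop) :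
  (forall u : nat -> X, (forall n, P (u n)) -> exists m n, (m < n)%nat /\ u m = u n) ->
  exists L : list X, forall x, P x -> In x L.
Proof.
move=> Hinj; apply: NNPP => Hno.
have Hnext : forall L : list X, exists x, P x /\ ~ In x L.
  move=> L; apply: NNPP => Hn; apply: Hno; exists L => x Px.
  by apply: NNPP => HL; apply: Hn; exists x.
case: (choice_fun _ Hnext) => nx Hnx.
pose acc := fix acc n := match n with O => [] | S n' => nx (acc n') :: acc n' end.
case: (Hinj (fun n => nx (acc n))) => [n|m [n [Hmn E]]]; first by case: (Hnx (acc n)).
have Hin : forall n, (m < n)%nat -> In (nx (acc m)) (acc n).
  elim=> [|n' IH] Hn; first lia.
  case: (Nat.eq_dec m n') => [<-|Hne]; first by left.
  by right; apply: IH; lia.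
by case: (Hnx (acc n)) => _; apply; rewrite -E; apply: Hin.
Qed.

Lemma exact_finite d : 0 < d ->
  exists L : list aff, forall f, exact_emb f /\ d <= Rabs (adet f) -> In f L.
Proof.
move=> Hd; apply: finite_of_no_injection => u Hu.
case: (emb_compact d u Hd) => [n|sg [f [Hs [Hf [Hdf Hcv]]]]].
  by case: (Hu n) => -[].
case: (mu_emb_lower Phi d Hd) => m [Hm Hml].
case: (rigid f m Hf Hm) => rho [e [Hr [He Hrig]]].
case: (Hcv rho Hr) => N HN.
have E n : (N <= n)%nat -> u (sg n) = f.
  move=> Hn; case: (Hu (sg n)) => -[He1 Hd1] Hd2.
  apply: (Hrig _ (mu (imF (u (sg n))))) => //; first exact: HN.
    by have := mu_ge0 Phi (imF (u (sg n))); nra.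
  exact: Hml.
exists (sg N), (sg (S N)); split; first exact: Hs.
by rewrite !E //; lia.
Qed.

(** If no two image points are [gap] apart, the image lies in one first-level cylinder, which is
    stripped off. Every strip enlarges the distance of the images of [x] and [y], which cannot
    exceed [diam]; [n] bounds the number of strips. *)
Lemma normalize f : emb f -> exists J, word Phi J /\ (forall z, F z -> cyl Phi J (ap f z)) /\
  exists x y, F x /\ F y /\ gap Phi * wrat Phi J <= dist2 (ap f x) (ap f y).
Proof.
move=> Hf; have [x [y [Fx [Fy Hxy]]]] : exists x y, F x /\ F y /\ 0 < dist2 (ap f x) (ap f y).
  case: (att_tri Phi) => a [b [e [Fa [Fb [_ Hx]]]]]; exists b, a; split=> //; split=> //.
  case: (dist2_ge0 (ap f b) (ap f a)) => // E; case: Hx.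
  have E' : b = a by rewrite -(apVl f b) ?(dist2_eq0 _ _ (eq_sym E)) ?apVl //; case: Hf.
  rewrite E'; plane; ring.
have [n Hn] : exists n, diam Phi * rhi Phi ^ n < dist2 (ap f x) (ap f y).
  have Hd := diam_pos Phi; case: (rhi_pow_small Phi (dist2 (ap f x) (ap f y) / diam Phi)) => [|n Hn].
    exact: Rdiv_lt_0_compat.
  exists n; have -> : dist2 (ap f x) (ap f y) = diam Phi * (dist2 (ap f x) (ap f y) / diam Phi) by field; lra.
  exact: Rmult_lt_compat_l.
elim: n f Hf Hxy Hn => [|n IH] f Hf Hxy Hn.
  have := att_diam Phi _ _ (proj2 Hf x Fx) (proj2 Hf y Fy); rewrite /= in Hn; lra.
case: (classic (exists x y, F x /\ F y /\ gap Phi <= dist2 (ap f x) (ap f y))) => [[x' [y' [Fx' [Fy' H]]]] | Hno].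
  exists []; split; first exact: word_nil.
  split; first by move=> z Fz; exists (ap f z); split; [apply: (proj2 Hf) | rewrite ap_id].
  by exists x', y'; rewrite /= Rmult_1_r.
case: (proj1 (att_cyl1 Phi (ap f x)) (proj2 Hf x Fx)) => i [Hi Cx].
have Hr := rat_pos Phi i Hi; have Hw := word1 Phi i Hi; have Hdet := waff_det_neq0 Phi [i] Hw.
have Hcyl z : F z -> cyl Phi [i] (ap f z).
  move=> Fz; case: (proj1 (att_cyl1 Phi (ap f z)) (proj2 Hf z Fz)) => j [Hj Cz].
  case: (Nat.eq_dec i j) => [-> //|Hne]; case: Hno; exists x, z; split=> //; split=> //.
  case: Cx Cz => [x' [Fx' <-]] [z' [Fz' <-]]; rewrite !ap_waff1; exact: att_gap.
pose f1 := acomp (ainv (waff Phi [i])) f.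
have Ef z : ap f z = ap (waff Phi [i]) (ap f1 z) by rewrite /f1 ap_comp apVr.
have Hf1 : emb f1.
  split; first by apply: adet_comp_neq0; [exact: adet_inv_neq0 | case: Hf].
  move=> z Fz; case: (Hcyl z Fz) => w [Fw Ew]; rewrite Ef in Ew.
  by rewrite -(waff_inj Phi [i] w (ap f1 z)).
have Ed z w : dist2 (ap f z) (ap f w) = rat Phi i * dist2 (ap f1 z) (ap f1 w).
  by rewrite !Ef waff_dist // wrat1.
case: (IH f1 Hf1) => [||J [HJ [HJc [x' [y' [Fx' [Fy' HJd]]]]]]].
- by rewrite Ed in Hxy; nra.
- have := mp_hi Phi i Hi; rewrite -/(rat Phi i) => Hri; rewrite Ed /= in Hn.
  have Hp : 0 < diam Phi * rhi Phi ^ n.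
    by apply: Rmult_lt_0_compat; [exact: diam_pos | apply: pow_lt; exact: rhi_pos].
  apply: (Rmult_lt_reg_l (rat Phi i)) => //; nra.
- exists (i :: J); split; first by apply/word_cons.
  split; first by move=> z Fz; apply/(cyl_app Phi [i] J); exists (ap f1 z); split; [exact: HJc | rewrite Ef].
  by exists x', y'; split=> //; split=> //; rewrite Ed /=; nra.
Qed.

Definition normalization g I J : aff := acomp (ainv (waff Phi J)) (acomp g (waff Phi I)).

Lemma normalizationK g I J : word Phi J -> acomp (waff Phi J) (normalization g I J) = acomp g (waff Phi I).
Proof. by move=> HJ; rewrite /normalization acomp_assoc acompVr ?acomp_1l //; apply: waff_det_neq0. Qed.

(** The determinant bound is independent of [I]: the image of the cylinder [I] has size at most
    [frob * r_I * diam], so the ratio [r_J] supplied by [normalize] is at most a constant times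
    [frob * r_I]. *)
Lemma normalization_exists g I : emb g -> word Phi I ->
  exists J, word Phi J /\ emb (normalization g I J) /\
    Rabs (adet g) / frob (fst g) ^ 2 * (gap Phi / diam Phi) ^ 2 <= Rabs (adet (normalization g I J)).
Proof.
move=> Hg HI; have Hgi := emb_comp Phi _ _ Hg (emb_waff Phi I HI).
case: (normalize _ Hgi) => J [HJ [HJc [x [y [Fx [Fy Hxy]]]]]]; exists J; split=> //.
have HdJ := waff_det_neq0 Phi J HJ.
have Hcomp : emb (normalization g I J).
  split; first by apply: adet_comp_neq0; [exact: adet_inv_neq0 | case: Hgi].
  move=> z Fz; case: (HJc z Fz) => w [Fw Ew].
  by rewrite /normalization ap_comp -Ew apVl.
split=> //; have Hri := wrat_pos Phi I HI; have Hrj := wrat_pos Phi J HJ.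
rewrite /normalization !adet_comp adet_inv // !Rabs_mult Rabs_inv !waff_det //.
have Hfr := frob_pos _ (proj1 Hg); have Hd := diam_pos Phi; have Hgp := gap_pos Phi.
have Hda := Rabs_pos_lt _ (proj1 Hg).
have H1 : gap Phi * wrat Phi J <= frob (fst g) * (wrat Phi I * diam Phi).
  apply: Rle_trans Hxy _; rewrite !ap_comp; apply: Rle_trans (ap_lip _ _ _) _; rewrite waff_dist //.
  have := att_diam Phi x y Fx Fy => H; apply: Rmult_le_compat_l; [lra | nra].
have H2 : gap Phi / diam Phi / frob (fst g) <= wrat Phi I / wrat Phi J.
  apply: (Rmult_le_reg_l (diam Phi * frob (fst g) * wrat Phi J)).
    by do 2 apply: Rmult_lt_0_compat => //.
  have -> : diam Phi * frob (fst g) * wrat Phi J * (gap Phi / diam Phi / frob (fst g)) = gap Phi * wrat Phi J.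
    by field; lra.
  have -> : diam Phi * frob (fst g) * wrat Phi J * (wrat Phi I / wrat Phi J) = frob (fst g) * (wrat Phi I * diam Phi).
    by field; lra.
  done.
have -> : Rabs (adet g) / frob (fst g) ^ 2 * (gap Phi / diam Phi) ^ 2 =
  Rabs (adet g) * (gap Phi / diam Phi / frob (fst g)) ^ 2 by field; lra.
have -> : / wrat Phi J ^ 2 * (Rabs (adet g) * wrat Phi I ^ 2) =
  Rabs (adet g) * (wrat Phi I / wrat Phi J) ^ 2 by field; lra.
apply: Rmult_le_compat_l; first lra.
apply: pow_incr; split=> //; left; do 2 apply: Rdiv_lt_0_compat => //.
Qed.

(* A cylinder on which the density of [g^* mu] nearly attains its supremum is carried,
   after normalization, close to a limit embedding, hence by rigidity onto it. *)
Lemma exact_piece g : emb g -> exists I, word Phi I /\ exact_emb (acomp g (waff Phi I)).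
Proof.
move=> Hg; have Hdg := Rabs_pos_lt _ (proj1 Hg).
case: (dominated_exists Phi g (proj1 Hg)) => c0 Hc0.
case: (completeness (fun v => exists I, word Phi I /\ v = mu (imF (acomp g (waff Phi I))) / wwgt Phi I)).
  exists c0 => v [I [HI ->]]; have Hw := wwgt_pos Phi I; apply: (Rmult_le_reg_r (wwgt Phi I)) => //.
  have -> : mu (imF (acomp g (waff Phi I))) / wwgt Phi I * wwgt Phi I = mu (imF (acomp g (waff Phi I))).
    by field; lra.
  exact: Hc0.
  by exists (mu (imF (acomp g (waff Phi []))) / wwgt Phi []), []; split=> //; apply: word_nil.
move=> c [Hub Hlub].
have Hdom : dominated g c.
  move=> I HI; have Hw := wwgt_pos Phi I.
  have := Hub _ (ex_intro _ I (conj HI eq_refl)) => H.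
  have -> : mu (imF (acomp g (waff Phi I))) = mu (imF (acomp g (waff Phi I))) / wwgt Phi I * wwgt Phi I.
    by field; lra.
  apply: Rmult_le_compat_r; lra.
have Hc : 0 < c.
  case: (mu_emb_lower Phi _ Hdg) => m [Hm Hml]; have := Hml g Hg ltac:(lra).
  have := Hdom [] (word_nil Phi); rewrite /= acomp_1r; lra.
have Hsel : forall n : nat, exists IJ : list nat * list nat,
   word Phi (fst IJ) /\ word Phi (snd IJ) /\ emb (normalization g (fst IJ) (snd IJ)) /\
   Rabs (adet g) / frob (fst g) ^ 2 * (gap Phi / diam Phi) ^ 2 <= Rabs (adet (normalization g (fst IJ) (snd IJ))) /\
   (1 - / INR (S n)) * (c * wwgt Phi (fst IJ)) <= mu (imF (acomp g (waff Phi (fst IJ)))).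
  move=> n; have Hn := inv_Sn_pos n.
  have [I [HI Hlt]] : exists I, word Phi I /\ (1 - / INR (S n)) * (c * wwgt Phi I) <= mu (imF (acomp g (waff Phi I))).
    apply: NNPP => Hno; suff : c <= (1 - / INR (S n)) * c by nra.
    apply: Hlub => v [I [HI ->]]; have Hw := wwgt_pos Phi I.
    apply: (Rmult_le_reg_r (wwgt Phi I)) => //.
    have -> : mu (imF (acomp g (waff Phi I))) / wwgt Phi I * wwgt Phi I = mu (imF (acomp g (waff Phi I))).
      by field; lra.
    case: (Rle_lt_dec ((1 - / INR (S n)) * (c * wwgt Phi I)) (mu (imF (acomp g (waff Phi I))))) => H; last lra.
    by case: Hno; exists I.
  by case: (normalization_exists g I Hg HI) => J [HJ [H1 H2]]; exists (I, J).
case: (choice_fun _ Hsel) => IJ HIJ.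
set d := Rabs (adet g) / frob (fst g) ^ 2 * (gap Phi / diam Phi) ^ 2 in HIJ.
have Hd : 0 < d.
  by apply: Rmult_lt_0_compat; [apply: Rdiv_lt_0_compat => // | ]; apply: pow_lt;
    [apply: frob_pos; case: Hg | apply: Rdiv_lt_0_compat; [exact: gap_pos | exact: diam_pos]].
pose u n := normalization g (fst (IJ n)) (snd (IJ n)).
case: (emb_compact d u Hd) => [n|sg [f [Hs [Hf [Hdf Hcv]]]]].
  by case: (HIJ n) => _ [_ [H1 [H2 _]]].
case: (mu_emb_lower Phi d Hd) => m [Hm Hml].
case: (rigid f m Hf Hm) => rho [e [Hr [He Hrig]]].
have Hu n : let c' := c * wwgt Phi (fst (IJ n)) / wwgt Phi (snd (IJ n)) in
   dominated (u n) c' /\ (1 - / INR (S n)) * c' <= mu (imF (u n)) /\ m <= c'.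
  case: (HIJ n) => HI [HJ [H1 [H2 H3]]] /=; have Hw := wwgt_pos Phi (snd (IJ n)).
  set c' := _ / _; have Ec' : c * wwgt Phi (fst (IJ n)) = wwgt Phi (snd (IJ n)) * c' by rewrite /c'; field; lra.
  have Hd' : dominated (u n) c'.
    move=> K HK; apply: (Rmult_le_reg_l (wwgt Phi (snd (IJ n)))) => //.
    rewrite -mu_imF_waff //; first by have [_] := emb_comp Phi _ _ H1 (emb_waff Phi K HK).
    rewrite acomp_assoc normalizationK // -acomp_assoc -waff_app -Rmult_assoc -Ec' Rmult_assoc -wwgt_app.
    by apply: Hdom; apply: word_app.
  split=> //; split.
    apply: (Rmult_le_reg_l (wwgt Phi (snd (IJ n)))) => //.
    rewrite -mu_imF_waff //; first by case: H1.
    rewrite normalizationK // -Rmult_assoc (Rmult_comm (wwgt _ _)) Rmult_assoc -Ec'; exact: H3.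
  apply: Rle_trans (Hml _ H1 H2) _; have := Hd' [] (word_nil Phi); rewrite /= acomp_1r /u; lra.
case: (Hcv rho Hr) => N1 HN1; case: (inv_Sn_small e He) => N2 HN2.
(* Near-optimal density and closeness to [f] together trigger rigidity. *)
have E n : (N1 + N2 <= n)%nat -> u (sg n) = f.
  move=> Hn; case: (Hu (sg n)) => U1 [U2 U3]; have Hsn := extraction_ge _ Hs n.
  apply: (Hrig _ (c * wwgt Phi (fst (IJ (sg n))) / wwgt Phi (snd (IJ (sg n))))) => //.
    by case: (HIJ (sg n)) => _ [_ []].
    by apply: HN1; lia.
    by apply: Rle_trans U2; apply: Rmult_le_compat_r; [lra | have := HN2 (sg n) ltac:(lia); lra].
(* As [f] equals [u (sg n)] for all large [n], it inherits density bounds [c'] that exceed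
   [mu (imF f)] by factors tending to 1. *)
have Hexact : exact_emb f.
  split=> // I HI; apply: le_epsilon => t Ht.
  have Hf1 := mu_le1 Phi (imF f); have Hf0 := mu_ge0 Phi (imF f); have Hw0 := wwgt_pos Phi I; have Hw1 := wwgt_le1 Phi I HI.
  (* In [(1 - s) * c' <= mu (imF f) <= 1], the bound [1 / 2] gives [c' <= 2], and [t / 2] then gives
     [c' <= mu (imF f) + t]. *)
  pose s := Rmin (1 / 2) (t / 2); have Hs0 : 0 < s by apply: Rmin_glb_lt; lra.
  case: (inv_Sn_small s Hs0) => N3 HN3; pose n := (N1 + N2 + N3)%nat.
  have Hsn := extraction_ge _ Hs n.
  have := HN3 (sg n) ltac:(rewrite /n in Hsn *; lia) => Hsm.
  case: (Hu (sg n)) => U1 [U2 U3]; move: U1 U2 U3; rewrite E; first by rewrite /n; lia.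
  set c' := _ / _ => U1 U2 U3; have U4 := U1 I HI.
  have S1 := Rmin_l (1 / 2) (t / 2); have S2 := Rmin_r (1 / 2) (t / 2); rewrite -/s in S1 S2.
  have P := inv_Sn_pos (sg n).
  have B1 : (1 - s) * c' <= mu (imF f) by apply: Rle_trans U2; apply: Rmult_le_compat_r; lra.
  have B2 : c' <= 2 by nra.
  have B3 : c' <= mu (imF f) + t by nra.
  apply: Rle_trans U4 _; nra.
case: (HIJ (sg (N1 + N2)%nat)) => HI [HJ [H1 _]].
exists (fst (IJ (sg (N1 + N2)%nat))); split=> //.
rewrite -(normalizationK _ _ (snd (IJ (sg (N1 + N2)%nat)))) //; apply/exact_post => //.
by have := E (N1 + N2)%nat ltac:(lia); rewrite /u => ->.
Qed.

End Rigidity.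

(** * Powers and inverses of an embedding *)

Fixpoint apow (g : aff) (k : nat) : aff :=
  match k with O => aid | S k' => acomp g (apow g k') end.

Lemma ap_apow g k z : ap (apow g k) z = iterf k (ap g) z.
Proof. by elim: k => [|k IH] /=; rewrite ?ap_id // ap_comp IH. Qed.

Lemma apow_add g m n : apow g (m + n) = acomp (apow g m) (apow g n).
Proof. by elim: m => [|m IH] /=; rewrite ?acomp_1l // IH acomp_assoc. Qed.

Lemma pigeonhole {X : Type} (f : nat -> X) (L : list X) :
  (forall k, (k <= length L)%nat -> In (f k) L) ->
  exists m n, (m < n)%nat /\ (n <= length L)%nat /\ f m = f n.
Proof.
move=> H; apply: NNPP => Hno.
have Hnd : NoDup (map f (seq 0 (S (length L)))).
  apply: Injective_map_NoDup_in; last exact: seq_NoDup.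
  move=> m n /in_seq Hm /in_seq Hn E; apply: NNPP => Hne; apply: Hno.
  by case: (Nat.lt_total m n) => [H1|[//|H1]]; [exists m, n | exists n, m]; split=> //; split; try lia.
have := NoDup_incl_length (l' := L) Hnd _.
rewrite length_map length_seq => H1; suff : (S (length L) <= length L)%nat by lia.
by apply: H1 => x /in_map_iff [k [<- /in_seq Hk]]; apply: H; lia.
Qed.

Section Semigroup.
Context (Phi : ifs).
Local Notation F := (att Phi).
Local Notation mu := (mu Phi).
Local Notation imF := (imF Phi).
Local Notation emb := (emb Phi).
Local Notation exact_emb := (exact_emb Phi).
Local Notation word := (word Phi).
Local Notation waff := (waff Phi).
Implicit Types (E : R2 -> Prop) (I J : list nat) (f g h : aff).

Lemma emb_id : emb aid.
Proof. by split=> [|z]; [rewrite /adet mdet_id; lra | rewrite ap_id]. Qed.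

Lemma emb_pow g k : emb g -> emb (apow g k).
Proof. by move=> Hg; elim: k => [|k IH]; [exact: emb_id | exact: emb_comp]. Qed.

(** Constant density survives passing to a smaller cylinder, so one word can be refined for the
    powers one after the other. *)
Lemma exact_pieces g n : emb g ->
  exists I, word I /\ forall k, (k <= n)%nat -> exact_emb (acomp (apow g k) (waff I)).
Proof.
move=> Hg; elim: n => [|n [I [HI IH]]].
  case: (exact_piece Phi aid emb_id) => I [HI HE]; exists I; split=> // k Hk.
  by have -> : k = 0%nat by lia.
have Hgi := emb_comp Phi _ _ (emb_pow g (S n) Hg) (emb_waff Phi I HI).
case: (exact_piece Phi _ Hgi) => J [HJ HE]; exists (I ++ J); split; first exact: word_app.
move=> k Hk; rewrite waff_app acomp_assoc; case: (Nat.eq_dec k (S n)) => [->|Hne] //.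
by apply: exact_sub => //; apply: IH; lia.
Qed.

(** [kap] bounds the determinants of the normalized pieces of all powers by the same [d]. The list
    [L] depends on [d] only, so it is known in advance how many powers must have constant density on
    a common cylinder. *)
Lemma power_of_words g kap : emb g -> 0 < kap ->
  (forall k, kap <= Rabs (adet (apow g k)) / frob (fst (apow g k)) ^ 2) ->
  exists m J J', (1 <= m)%nat /\ word J /\ word J' /\ acomp (apow g m) (waff J) = waff J'.
Proof.
move=> Hg Hk Hkap; set d := kap * (gap Phi / diam Phi) ^ 2.
have Hgd : 0 < gap Phi / diam Phi by apply: Rdiv_lt_0_compat; [exact: gap_pos | exact: diam_pos].
have Hd : 0 < d by apply: Rmult_lt_0_compat => //; apply: pow_lt.
case: (exact_finite Phi d Hd) => L HL.
case: (exact_pieces g (length L) Hg) => I [HI HE].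
have Hn : forall k, exists J, word J /\ emb (normalization Phi (apow g k) I J) /\
   d <= Rabs (adet (normalization Phi (apow g k) I J)).
  move=> k; case: (normalization_exists Phi _ I (emb_pow g k Hg) HI) => J [HJ [H1 H2]].
  exists J; split=> //; split=> //; apply: Rle_trans H2; apply: Rmult_le_compat_r => //.
  by apply: pow_le; lra.
case: (choice_fun _ Hn) => J HJ.
case: (pigeonhole (fun k => normalization Phi (apow g k) I (J k)) L) => [k Hle|m [n [Hmn [Hn' E]]]].
  case: (HJ k) => H1 [H2 H3]; apply: HL; split=> //.
  by apply/(exact_post Phi (J k)) => //; rewrite normalizationK //; apply: HE.
exists (n - m)%nat, (J m), (J n); split; first lia.
case: (HJ m) => H1 [[H2 _] _]; case: (HJ n) => H3 _; split=> //; split=> //.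
have E1 := normalizationK Phi (apow g m) I (J m) H1.
have E2 := normalizationK Phi (apow g n) I (J n) H3.
rewrite -E in E2; set f := normalization Phi (apow g m) I (J m) in E1 E2 H2; clearbody f.
(* The common piece [f] is invertible and cancels on the right. *)
have E3 : acomp (acomp (apow g (n - m)) (waff (J m))) f = acomp (waff (J n)) f.
  rewrite E2 -acomp_assoc E1 acomp_assoc -apow_add; do 2 f_equal; lia.
have : acomp (acomp (acomp (apow g (n - m)) (waff (J m))) f) (ainv f) = acomp (acomp (waff (J n)) f) (ainv f).
  by rewrite E3.
by rewrite -!acomp_assoc acompVr // !acomp_1r.
Qed.

(** A substitute for density points: with density at most [c] in all cylinders, summing over the
    cylinders of level [n] that meet [E] gives [mu E <= c * cover n E], and in the limit
    [mu E <= c * mu E]. *)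
Lemma dense_cylinder E c : 0 < mu E -> 0 <= c -> c < 1 -> exists J, word J /\ c < mu (wpre Phi J E).
Proof.
move=> HE Hc0 Hc; apply: NNPP => Hno.
have Hall J : word J -> mu (wpre Phi J E) <= c.
  by move=> HJ; case: (Rle_lt_dec (mu (wpre Phi J E)) c) => // Hlt; case: Hno; exists J.
have Hn n : mu E <= c * cover Phi n E.
  elim: n E Hall {Hno HE} => [|n IH] E Hall.
    case: (classic (exists z, F z /\ E z)) => H.
      rewrite (cover0_in _ _ H) Rmult_1_r; have := Hall [] (word_nil Phi).
      by rewrite (mu_ext Phi (wpre Phi [] E) E) // => z _; rewrite /wpre ap_id.
    by rewrite (cover0_out _ _ H) mu_empty; [move=> z Fz Ez; apply: H; exists z | lra].
  rewrite mu_step /= -bsum_scal; apply: bsum_le => i Hi; have Hw := wgt_pos Phi i.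
  suff : mu (wpre Phi [i] E) <= c * cover Phi n (wpre Phi [i] E) by nra.
  apply: IH => J HJ; have := Hall (i :: J) ltac:(by apply/word_cons).
  by rewrite (mu_ext Phi (wpre Phi (i :: J) E) (wpre Phi J (wpre Phi [i] E))) // => z _; apply: wpre_cons.
suff : mu E <= c * mu E by nra.
apply: le_epsilon => e He; case: (cover_near_mu Phi E e He) => n Hne; have := Hn n.
have := cover_ge0 Phi n E; nra.
Qed.

Lemma cylinder_of_size x t : F x -> 0 < t -> t <= 1 ->
  exists I, word I /\ cyl Phi I x /\ wrat Phi I < t /\ rlo Phi * t <= wrat Phi I.
Proof.
move=> Fx Ht; have [n Hn] := rhi_pow_small Phi t Ht.
elim: n x t Fx Ht Hn => [|n IH] x t Fx Ht Hn Ht1; first by rewrite /= in Hn; lra.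
case: (proj1 (att_cyl1 Phi x) Fx) => i [Hi Ci]; have Hr := rat_pos Phi i Hi.
have Hlo := mp_lo Phi i Hi; have Hhi := mp_hi Phi i Hi; rewrite -/(rat Phi i) in Hlo Hhi.
have Hlp := rlo_pos Phi.
case: (Rlt_le_dec (rat Phi i) t) => Hit.
  exists [i]; split; first exact: word1.
  by rewrite wrat1; split=> //; split=> //; nra.
case: Ci => y [Fy Ey].
have Hti : 0 < t / rat Phi i by apply: Rdiv_lt_0_compat.
have Eti : t = rat Phi i * (t / rat Phi i) by field; lra.
case: (IH y (t / rat Phi i) Fy Hti) => [||I [HI [CI [H1 H2]]]].
- rewrite /= in Hn; apply: (Rmult_lt_reg_l (rat Phi i)) => //; rewrite -Eti.
  have : 0 < rhi Phi ^ n by apply: pow_lt; apply: rhi_pos.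
  nra.
- by apply: (Rmult_le_reg_l (rat Phi i)) => //; rewrite -Eti; lra.
- exists (i :: I); split; first by apply/word_cons.
  split; first by apply/(cyl_app Phi [i] I); exists y.
  rewrite /=; split; [rewrite Eti | rewrite {1}Eti]; nra.
Qed.

(** [F] is closed, so a point sent outside [F] has a whole cylinder around it that is sent
    outside. *)
Lemma self_map_gap f : adet f <> 0 ->
  exists e, 0 < e /\ ((forall z, F z -> F (ap f z)) \/ mu (fun z => F (ap f z)) <= 1 - e).
Proof.
move=> Hf; case: (classic (forall z, F z -> F (ap f z))) => H; first by exists 1; split; [lra | left].
have [z [Fz Nz]] : exists z, F z /\ ~ F (ap f z).
  by apply: NNPP => Hno; apply: H => z Fz; apply: NNPP => Nz; apply: Hno; exists z.
have [eta [He Hsep]] : exists eta, 0 < eta /\ forall y, F y -> eta <= dist2 y (ap f z).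
  apply: NNPP => Hno; apply: Nz; apply: att_closed => e He; apply: NNPP => Hn; apply: Hno.
  exists e; split=> // y Fy; case: (Rle_lt_dec e (dist2 y (ap f z))) => // Hlt; case: Hn.
  by exists y; rewrite dist2_sym.
have Hfr := frob_pos _ Hf; have Hd := diam_pos Phi.
case: (rhi_pow_small Phi (eta / (frob (fst f) * diam Phi))) => [|n Hn].
  by apply: Rdiv_lt_0_compat => //; apply: Rmult_lt_0_compat.
case: (att_level Phi n z Fz) => I [HI [HL CI]].
exists (wwgt Phi I); split; first exact: wwgt_pos.
right; apply: mu_miss => // w Cw Fw; have := Hsep _ Fw; apply: Rlt_not_le.
apply: Rle_lt_trans (ap_lip _ _ _) _.
apply: Rle_lt_trans (Rmult_le_compat_l _ _ _ (frob_ge0 _) (cyl_diam Phi I _ _ HI Cw CI)) _.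
have -> : eta = frob (fst f) * (diam Phi * (eta / (frob (fst f) * diam Phi))) by field; lra.
apply: Rmult_lt_compat_l => //; apply: Rmult_lt_compat_l => //.
by have := wrat_le Phi I HI; rewrite HL; lra.
Qed.

(* Some cylinder is almost filled by [g(F)]; as only finitely many normalized pieces
   of [g] occur, it is filled up to measure zero, hence completely. *)
Lemma inverse_embedding g : emb g ->
  exists V, word V /\ forall z, F z -> F (ap (ainv g) (ap (waff V) z)).
Proof.
move=> Hg0; case: (exact_piece Phi g Hg0) => I0 [HI0 HE0].
(* Passing to a piece of constant density is harmless, since [phi_I0] maps [F] into [F]. *)
suff : forall g, exact_emb g -> exists V, word V /\ forall z, F z -> F (ap (ainv g) (ap (waff V) z)).
  move=> /(_ _ HE0) [V [HV HVF]]; exists V; split=> // z Fz; case: HE0 => -[Hdet _] _.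
  have Fw := HVF z Fz; set w := ap (ainv _) _ in Fw.
  have -> : ap (waff V) z = ap g (ap (waff I0) w) by rewrite -ap_comp /w apVr.
  by rewrite apVl; [case: Hg0 | exact: att_waff].
move=> {Hg0 I0 HI0 HE0} {}g HE; have [Hg _] := HE; have [Hdet HgF] := Hg.
have Hfr := frob_pos _ Hdet; have Hda := Rabs_pos_lt _ Hdet.
have Hd := diam_pos Phi; have Hgp := gap_pos Phi; have Hlo := rlo_pos Phi.
(* With this choice [g] sends a cylinder of ratio below [q * wrat J] to a set of diameter below
   [gap * wrat J], which lies in the cylinder [J] as soon as it meets it. *)
pose q := Rmin 1 (gap Phi / (frob (fst g) * diam Phi)).
have Hq : 0 < q by apply: Rmin_glb_lt; [lra | apply: Rdiv_lt_0_compat => //; apply: Rmult_lt_0_compat].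
have Hq1 : q <= 1 by apply: Rmin_l.
have Hq2 : frob (fst g) * diam Phi * q <= gap Phi.
  have := Rmin_r 1 (gap Phi / (frob (fst g) * diam Phi)); rewrite -/q => H.
  have -> : gap Phi = frob (fst g) * diam Phi * (gap Phi / (frob (fst g) * diam Phi)) by field; lra.
  by apply: Rmult_le_compat_l => //; left; apply: Rmult_lt_0_compat.
pose d := Rabs (adet g) * (rlo Phi * q) ^ 2.
have Hrq : 0 < rlo Phi * q by apply: Rmult_lt_0_compat.
have Hd0 : 0 < d by apply: Rmult_lt_0_compat => //; apply: pow_lt.
case: (exact_finite Phi d Hd0) => L HL.
(* Words [K] of this length are so deep that all points of [F] sent by [g] into [J ++ K] lie in the
   single cylinder [I]; see [Hloc]. *)
have [k Hk] := rhi_pow_small Phi (gap Phi * (rlo Phi * q) * Rabs (adet g) / (frob (fst g) * diam Phi))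
  ltac:(by apply: Rdiv_lt_0_compat; apply: Rmult_lt_0_compat => //; apply: Rmult_lt_0_compat).
have [K [HK HKl]] : exists K, word K /\ length K = k.
  by case: (att_inh Phi) => x Fx; case: (att_level Phi k x Fx) => K [HK [HKl _]]; exists K.
have [e [He HeL]] : exists e, 0 < e /\ forall f, In f L -> adet f <> 0 ->
   (forall z, F z -> F (ap (acomp (ainv f) (waff K)) z)) \/
   mu (fun z => F (ap (acomp (ainv f) (waff K)) z)) <= 1 - e.
  elim: L {HL} => [|f L [e [He IH]]]; first by exists 1; split; [lra |].
  case: (classic (adet f = 0)) => Hf.
    by exists e; split=> // f' [<- //|Hin]; apply: IH.
  case: (self_map_gap (acomp (ainv f) (waff K))) => [|e' [He' H]].
    by apply: adet_comp_neq0; [exact: adet_inv_neq0 | exact: waff_det_neq0].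
  exists (Rmin e e'); have H1 := Rmin_l e e'; have H2 := Rmin_r e e'.
  split; first exact: Rmin_glb_lt.
  move=> f' [<-|Hin] Hf'; first by case: H => [|H]; [left | right; lra].
  by case: (IH f' Hin Hf') => [|H3]; [left | right; lra].
pose e1 := Rmin e 1; have He1 : 0 < e1 by apply: Rmin_glb_lt; lra.
have He11 : e1 <= 1 by apply: Rmin_r.
have He1e : e1 <= e by apply: Rmin_l.
have HwK := wwgt_pos Phi K; have HwK1 := wwgt_le1 Phi K HK.
have HmuP : 0 < mu (imF g).
  by case: (mu_emb_lower Phi _ Hda) => m [Hm H]; have := H g Hg ltac:(lra); lra.
(* This density in [J] still leaves a density above [1 - e1] in its subcylinder [J ++ K]. *)
case: (dense_cylinder (imF g) (1 - e1 * wwgt Phi K) HmuP) => [||J [HJ HmJ]]; [nra | nra |].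
have HmJK : 1 - e1 < mu (wpre Phi (J ++ K) (imF g)).
  rewrite (mu_ext Phi _ (wpre Phi K (wpre Phi J (imF g)))); first by move=> z _; apply: wpre_app.
  have := mu_wpre_le Phi (wpre Phi J (imF g)) K HK; nra.
case: (mu_pos_inh Phi (wpre Phi (J ++ K) (imF g))) => [|z0 [Fz0 [x0 [Fx0 Ex0]]]]; first lra.
have HrJ := wrat_pos Phi J HJ; have HrJ1 := wrat_le1 Phi J HJ; have HrK := wrat_pos Phi K HK.
case: (cylinder_of_size x0 (wrat Phi J * q) Fx0) => [||I [HI [CI [HI1 HI2]]]]; [nra | nra |].
have HrI := wrat_pos Phi I HI.
have CJ0 : cyl Phi J (ap g x0).
  by apply: (cyl_prefix Phi J K) => //; rewrite Ex0; exists z0.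
have HgI w : F w -> cyl Phi J (ap g (ap (waff I) w)).
  move=> Fw; have Fiw := att_waff Phi I w HI Fw.
  apply: (cyl_gap Phi J (ap g x0)) => //; first exact: HgF.
  apply: Rle_lt_trans (ap_lip _ _ _) _.
  have Ciw : cyl Phi I (ap (waff I) w) by exists w.
  apply: Rle_lt_trans (Rmult_le_compat_l _ _ _ (frob_ge0 _) (cyl_diam Phi I _ _ HI CI Ciw)) _.
  apply: Rlt_le_trans (_ : frob (fst g) * diam Phi * (wrat Phi J * q) <= _).
    by rewrite -Rmult_assoc; apply: Rmult_lt_compat_l => //; apply: Rmult_lt_0_compat.
  by have := Rmult_le_compat_r (wrat Phi J) _ _ (Rlt_le _ _ HrJ) Hq2; lra.
pose f := normalization Phi g I J.
have HdJ := waff_det_neq0 Phi J HJ.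
have Ef w : ap (waff J) (ap f w) = ap g (ap (waff I) w).
  by rewrite -ap_comp normalizationK // ap_comp.
have Hf : emb f.
  split; first by apply: adet_comp_neq0; [exact: adet_inv_neq0 | apply: adet_comp_neq0 => //; exact: waff_det_neq0].
  move=> w Fw; case: (HgI w Fw) => y [Fy Ey]; rewrite -Ef in Ey.
  by rewrite -(waff_inj Phi J _ _ HJ Ey).
have Hfdet : d <= Rabs (adet f).
  rewrite /f /normalization !adet_comp adet_inv // !Rabs_mult Rabs_inv !waff_det //.
  have -> : / wrat Phi J ^ 2 * (Rabs (adet g) * wrat Phi I ^ 2) =
    Rabs (adet g) * (wrat Phi I / wrat Phi J) ^ 2 by field; lra.
  apply: Rmult_le_compat_l; first lra.
  apply: pow_incr; split; first lra.
  apply: (Rmult_le_reg_r (wrat Phi J)) => //.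
  have -> : wrat Phi I / wrat Phi J * wrat Phi J = wrat Phi I by field; lra.
  lra.
have HfL : In f L.
  apply: HL; split=> //; apply/(exact_post Phi J) => //.
  by rewrite normalizationK //; apply: exact_sub.
have Hloc x : F x -> cyl Phi (J ++ K) (ap g x) -> cyl Phi I x.
  move=> Fx Cx; apply: (cyl_gap Phi I x0) => //.
  have C0 : cyl Phi (J ++ K) (ap g x0) by rewrite Ex0; exists z0.
  have := cyl_diam Phi (J ++ K) _ _ (word_app Phi J K HJ HK) C0 Cx.
  have := ap_expand g x0 x Hdet; rewrite wrat_app => H1 H2.
  apply: (Rmult_lt_reg_l (Rabs (adet g) / frob (fst g))); first exact: Rdiv_lt_0_compat.
  apply: Rle_lt_trans H1 _; apply: Rle_lt_trans H2 _.
  have H3 := wrat_le Phi K HK; rewrite HKl in H3.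
  apply: Rlt_le_trans (_ : diam Phi * (wrat Phi J * (gap Phi * (rlo Phi * q) * Rabs (adet g) / (frob (fst g) * diam Phi))) <= _).
    apply: Rmult_lt_compat_l => //; apply: Rmult_lt_compat_l => //; lra.
  have -> : diam Phi * (wrat Phi J * (gap Phi * (rlo Phi * q) * Rabs (adet g) / (frob (fst g) * diam Phi)))
    = Rabs (adet g) / frob (fst g) * (gap Phi * (rlo Phi * (wrat Phi J * q))) by field; lra.
  apply: Rmult_le_compat_l; first by left; apply: Rdiv_lt_0_compat.
  by apply: Rmult_le_compat_l; lra.
(* Inside [J ++ K] the image of [g] agrees with that of [phi_J f], so losing [e] would contradict
   the density there. *)
have HeF : forall z, F z -> F (ap (acomp (ainv f) (waff K)) z).
  case: (HeL f HfL (proj1 Hf)) => // Hle.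
  suff : mu (wpre Phi (J ++ K) (imF g)) <= mu (fun z => F (ap (acomp (ainv f) (waff K)) z)) by lra.
  apply: mu_mono => z Fz [x [Fx Ex]].
  case: (Hloc x Fx) => [|w [Fw Ew]]; first by rewrite Ex; exists z.
  suff -> : ap (acomp (ainv f) (waff K)) z = w by [].
  rewrite ap_comp -(apVl f w); first by case: Hf.
  f_equal; apply: (waff_inj Phi J) => //.
  by rewrite Ef Ew Ex waff_app ap_comp.
exists (J ++ K); split; first exact: word_app.
move=> z Fz; have := HeF z Fz; rewrite ap_comp; set w := ap (ainv f) _ => Fw.
have -> : ap (waff (J ++ K)) z = ap g (ap (waff I) w).
  by rewrite waff_app ap_comp -Ef /w apVr //; case: Hf.
by rewrite apVl //; apply: att_waff.
Qed.

End Semigroup.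

(** * Closed sets invariant under a homothety and a linear map *)

Lemma int_floor t : exists q : Z, IZR q <= t < IZR q + 1.
Proof. exists (Int_part t); have [H1 H2] := base_Int_part t; lra. Qed.

Lemma int_multiple_below w t : w <> 0 -> exists q : Z, IZR q * w <= t.
Proof.
move=> Hw; case: (int_floor (t / w)) => q Hq.
have E : t = t / w * w by field.
case: (Rlt_le_dec 0 w) => H.
  by exists q; rewrite {1}E; apply: Rmult_le_compat_r; lra.
exists (q + 1)%Z; rewrite plus_IZR {1}E; nra.
Qed.

(** By compactness two fractional parts of [n * x / y] are close, and incommensurability keeps their
    difference nonzero. *)
Lemma small_combination x y : y <> 0 ->
  (forall (m : nat) (q : Z), (1 <= m)%nat -> INR m * x <> IZR q * y) ->
  forall e, 0 < e -> exists (m : nat) (q : Z), INR m * x + IZR q * y <> 0 /\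
    Rabs (INR m * x + IZR q * y) < e.
Proof.
move=> Hy Hind e He; have Hya := Rabs_pos_lt _ Hy.
case: (choice_fun _ (fun n : nat => int_floor (INR n * x / y))) => q Hq.
pose u n := INR n * x / y - IZR (q n).
case: (bolzano u 1) => [n|sg [Hs [v Hv]]].
  by rewrite /u; have := Hq n; rewrite /Rabs; case: Rcase_abs; lra.
case: (Hv (e / Rabs y / 2)) => [|N HN]; first by apply: Rdiv_lt_0_compat; [apply: Rdiv_lt_0_compat | lra].
have := HN N ltac:(lia); have := HN (S N) ltac:(lia); rewrite /Rdist => H1 H2.
have Hlt := Hs N; set i := sg N in H2 Hlt; set j := sg (S N) in H1 Hlt.
have E : INR (j - i) * x + IZR (q i - q j) * y = (u j - u i) * y.
  rewrite minus_INR; first lia.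
  by rewrite minus_IZR /u; field.
exists (j - i)%nat, (q i - q j)%Z; split.
  move=> H0; apply: (Hind (j - i)%nat (q j - q i)%Z); first lia.
  by rewrite minus_IZR; rewrite minus_IZR in H0; lra.
rewrite E Rabs_mult; have -> : e = e / Rabs y * Rabs y by field; lra.
apply: Rmult_lt_compat_r => //.
have -> : u j - u i = (u j - v) + - (u i - v) by ring.
by apply: Rle_lt_trans (Rabs_triang _ _) _; rewrite Rabs_Ropp; lra.
Qed.

(** The coefficient of [x] stays nonnegative because [B] acts by nonnegative powers only, while the
    homothety can be inverted near the origin. *)
Lemma dense_combination x y : y <> 0 ->
  (forall (m : nat) (q : Z), (1 <= m)%nat -> INR m * x <> IZR q * y) ->
  forall v e, 0 < e -> exists (m : nat) (q : Z), Rabs (INR m * x + IZR q * y - v) < e.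
Proof.
move=> Hy Hind v e He; case: (small_combination x y Hy Hind e He) => m0 [q0 [H0 Hlt]].
set d := INR m0 * x + IZR q0 * y in H0 Hlt.
(* Starting from [q1 * y], the target [v] is a nonnegative multiple [s] of the small step [d]. *)
case: (int_multiple_below (y / d) (v / d)) => [|q1 Hq1].
  by rewrite Rdiv_def; apply: Rmult_integral_contrapositive_currified => //; apply: Rinv_neq_0_compat.
pose s := (v - IZR q1 * y) / d.
have Hs : 0 <= s.
  have -> : s = v / d - IZR q1 * (y / d) by rewrite /s; field.
  lra.
case: (int_floor s) => j Hj.
have Hj0 : (0 <= j)%Z.
  have : IZR (-1) < IZR j by lra.
  by move=> /lt_IZR; lia.
have Ej : INR (Z.to_nat j) = IZR j by rewrite INR_IZR_INZ Z2Nat.id.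
exists (Z.to_nat j * m0)%nat, (j * q0 + q1)%Z.
rewrite mult_INR Ej plus_IZR mult_IZR.
have -> : IZR j * INR m0 * x + (IZR j * IZR q0 + IZR q1) * y - v = d * (IZR j - s).
  rewrite /s; transitivity (IZR j * d + IZR q1 * y - v); first by rewrite /d; ring.
  by field.
rewrite Rabs_mult; have := Rabs_pos d; have : Rabs (IZR j - s) <= 1.
  by rewrite /Rabs; case: Rcase_abs; lra.
nra.
Qed.

Lemma powerRZ_exp a q : 0 < a -> powerRZ a q = exp (IZR q * ln a).
Proof. by move=> Ha; rewrite powerRZ_Rpower. Qed.

Lemma pow_exp a n : 0 < a -> a ^ n = exp (INR n * ln a).
Proof. by move=> Ha; rewrite -Rpower_pow. Qed.

Lemma scale_into a p s : 0 < a -> a < 1 -> 0 < p -> 0 < s ->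
  exists q : Z, a * s <= powerRZ a q * p < s.
Proof.
move=> Ha Ha1 Hp Hs; have Hl : ln a < 0 by rewrite -ln_1; apply: ln_increasing.
case: (int_floor ((ln s - ln p) / ln a)) => q0 Hq; exists (q0 + 1)%Z.
have E : ln s - ln p = (ln s - ln p) / ln a * ln a by field; lra.
have -> : powerRZ a (q0 + 1) * p = exp ((IZR q0 + 1) * ln a + ln p).
  by rewrite powerRZ_exp // plus_IZR exp_plus (exp_ln p).
have -> : a * s = exp (ln a + ln s) by rewrite exp_plus !exp_ln.
have -> : s = exp (ln s) by rewrite exp_ln.
rewrite ln_exp; split; last by apply: exp_increasing; nra.
have [H|->] : ln a + ln s <= (IZR q0 + 1) * ln a + ln p by nra.
  by left; apply: exp_increasing.
lra.
Qed.

Section ScaleInvariant.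
(** In the application, [K] is [F] seen from a point fixed by some [phi_w], [a] is the ratio of [w],
    and [e0 = gap * a]. [Hup] is local because it inverts [phi_w] within its own cylinder. *)
Context (K : R2 -> Prop) (a e0 : R) (B : mat2).
Context (HKc : closed2 K) (Ha : 0 < a) (Ha1 : a < 1) (He0 : 0 < e0).
Context (Hdown : forall z, K z -> K (vscal a z)).
Context (Hup : forall z, K z -> vnorm z < e0 -> K (vscal (/ a) z)).
Context (HB : forall z, K z -> K (mapp B z)).
Context (Hseg : forall u c1, u <> (0, 0) -> 0 < c1 -> ~ forall c, 0 < c -> c < c1 -> K (vscal c u)).

Lemma vscal_vscal c d z : vscal c (vscal d z) = vscal (c * d) z.
Proof. plane; ring. Qed.

Lemma vscal_1 z : vscal 1 z = z.
Proof. plane; ring. Qed.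

(** For negative powers each intermediate vector is no longer than the final one, so [Hup] applies
    at every step. *)
Lemma scale_invariant z (q : Z) : K z -> vnorm (vscal (powerRZ a q) z) < e0 -> K (vscal (powerRZ a q) z).
Proof.
move=> Kz; case: q => [|p|p] /=; first by rewrite vscal_1.
  move=> _; elim: (Pos.to_nat p) => [|n IH] /=; first by rewrite vscal_1.
  by rewrite -vscal_vscal; apply: Hdown.
elim: (Pos.to_nat p) => [|n IH] /=; first by rewrite Rinv_1 vscal_1.
have Hn := pow_lt _ n Ha; rewrite Rinv_mult -vscal_vscal => H.
have H' : vnorm (vscal (/ a ^ n) z) < e0.
  apply: Rle_lt_trans H; rewrite [X in _ <= X]vnorm_scal Rabs_pos_eq; first by left; apply: Rinv_0_lt_compat.
  have := vnorm_ge0 (vscal (/ a ^ n) z).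
  have : 1 <= / a by rewrite -Rinv_1; apply: Rinv_le_contravar; lra.
  nra.
by apply: Hup => //; apply: IH.
Qed.

(** Squaring removes the sign of [g]. If [ln (g ^ 2)] and [ln a] were incommensurable, the scales
    [a ^ q * (g ^ 2) ^ m] would be dense in the positive reals. *)
Lemma eigenline_commensurable u g : K u -> u <> (0, 0) -> mapp B u = vscal g u ->
  g <> 0 -> Rabs g < 1 -> exists (m : nat) (q : Z), (1 <= m)%nat /\ (g ^ 2) ^ m = powerRZ a q.
Proof.
move=> Ku Hu HBu Hg Hg1; apply: NNPP => Hno; have Hr : 0 < g ^ 2 by nra.
have Hl : ln a < 0 by rewrite -ln_1; apply: ln_increasing.
have Hn := vnorm_pos _ Hu.
have Kpow m : K (vscal ((g ^ 2) ^ m) u).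
  elim: m => [|m IH] /=; first by rewrite vscal_1.
  have -> : vscal (g * (g * 1) * (g * (g * 1)) ^ m) u = mapp B (mapp B (vscal ((g ^ 2) ^ m) u)).
    by rewrite !(mapp_scal, HBu) !vscal_vscal; f_equal; rewrite /=; ring.
  by do 2 apply: HB.
have Hdense := dense_combination (ln (g ^ 2)) (ln a) ltac:(lra) _.
(* The factor 2 is a margin: an approximating scale [s < 2 * c] still gives a vector shorter than
   [e0]. *)
apply: (Hseg u (e0 / 2 / vnorm u) Hu); first by apply: Rdiv_lt_0_compat; lra.
move=> c Hc Hc1; apply: HKc => e He.
have Hcont := derivable_continuous_pt _ _ (derivable_pt_exp (ln c)).
case: (Hcont (Rmin (e / (vnorm u + 1)) c)) => [|eta [Heta Hclose]].
  by apply: Rmin_glb_lt => //; apply: Rdiv_lt_0_compat; lra.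
have [m [q Hmq]] : exists (m : nat) (q : Z), Rabs (INR m * ln (g ^ 2) + IZR q * ln a - ln c) < eta.
  apply: Hdense => // m q Hm E; apply: Hno; exists m, q; split=> //.
  by rewrite pow_exp // powerRZ_exp // E.
pose s := powerRZ a q * (g ^ 2) ^ m.
have Es : s = exp (INR m * ln (g ^ 2) + IZR q * ln a).
  by rewrite /s pow_exp // powerRZ_exp // -exp_plus Rplus_comm.
have Hsc : Rabs (s - c) < Rmin (e / (vnorm u + 1)) c.
  rewrite Es; case: (Req_dec (INR m * ln (g ^ 2) + IZR q * ln a) (ln c)) => E.
    rewrite E exp_ln // Rminus_diag Rabs_R0; apply: Rmin_glb_lt => //; apply: Rdiv_lt_0_compat; lra.
  rewrite -{1}(exp_ln c Hc); apply: (Hclose (INR m * ln (g ^ 2) + IZR q * ln a)).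
  by split=> //; split=> //; apply: not_eq_sym.
have S1 := Rlt_le_trans _ _ _ Hsc (Rmin_l _ _); have S2 := Rlt_le_trans _ _ _ Hsc (Rmin_r _ _).
have Hs0 : 0 < s by rewrite Es; apply: exp_pos.
exists (vscal s u); split.
  rewrite /s -vscal_vscal; apply: scale_invariant => //.
  rewrite vscal_vscal -/s vnorm_scal Rabs_pos_eq; first lra.
  have : s < 2 * c by have := Rle_abs (s - c); lra.
  move=> H; have E : e0 / 2 / vnorm u * vnorm u = e0 / 2 by field; lra.
  by have := Rmult_lt_compat_r _ _ _ Hn Hc1; rewrite E; nra.
have -> : dist2 (vscal c u) (vscal s u) = Rabs (s - c) * vnorm u.
  rewrite -vnorm_scal dist2_vnorm vnorm_sym; f_equal; plane; ring.
have E : e = e / (vnorm u + 1) * (vnorm u + 1) by field; lra.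
have := Rabs_pos (s - c); nra.
Qed.

(** The vectors may tend to 0; powers of [a] bring them back between the radii [a * e0] and [e0],
    where a subsequence has a nonzero limit on the line of [u]. *)
Lemma limit_direction (z : nat -> R2) (t : nat -> R) (u : R2) : (forall n, K (z n)) ->
  u <> (0, 0) -> (forall n, t n <> 0) ->
  (forall e, 0 < e -> exists N, forall n, (N <= n)%nat -> dist2 (vscal (/ t n) (z n)) u < e) ->
  exists c, c <> 0 /\ K (vscal c u).
Proof.
move=> HK Hu Ht Hlim; have Hn := vnorm_pos _ Hu.
have Hz n : z n = vscal (t n) (vscal (/ t n) (z n)).
  by rewrite vscal_vscal Rinv_r // vscal_1.
have [N0 HN0] : exists N0, forall n, (N0 <= n)%nat -> vnorm u / 2 < vnorm (vscal (/ t n) (z n)).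
  case: (Hlim (vnorm u / 2)) => [|N HN]; first lra.
  exists N => n Hle; have := HN n Hle; rewrite dist2_sym dist2_vnorm => H.
  have := vnorm_triang (vsub u (vscal (/ t n) (z n))) (vscal (/ t n) (z n)).
  have -> : vadd (vsub u (vscal (/ t n) (z n))) (vscal (/ t n) (z n)) = u by plane; ring.
  lra.
have Hzp n : (N0 <= n)%nat -> 0 < vnorm (z n).
  move=> Hle; rewrite Hz vnorm_scal; apply: Rmult_lt_0_compat; first exact: Rabs_pos_lt.
  by have := HN0 n Hle; lra.
have Hq n : exists q : Z, (N0 <= n)%nat -> a * e0 <= powerRZ a q * vnorm (z n) < e0.
  case: (classic (N0 <= n)%nat) => Hle; last by exists 0%Z.
  by case: (scale_into a (vnorm (z n)) e0 Ha Ha1 (Hzp n Hle) He0) => q Hq; exists q.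
case: (choice_fun _ Hq) => q {}Hq.
pose c n := powerRZ a (q (N0 + n)%nat) * t (N0 + n)%nat.
pose d n := vscal (/ t (N0 + n)%nat) (z (N0 + n)%nat).
have Hcd n : vscal (c n) (d n) = vscal (powerRZ a (q (N0 + n)%nat)) (z (N0 + n)%nat).
  by rewrite /c /d -vscal_vscal -Hz.
have Hpz n : 0 < powerRZ a (q n) by apply: powerRZ_lt.
have Hnorm n : a * e0 <= Rabs (c n) * vnorm (d n) < e0.
  rewrite -vnorm_scal Hcd vnorm_scal Rabs_pos_eq; first by left.
  by apply: Hq; lia.
have Kcd n : K (vscal (c n) (d n)).
  rewrite Hcd; apply: scale_invariant => //; rewrite -Hcd vnorm_scal; by case: (Hnorm n).
have Hd n : vnorm u / 2 < vnorm (d n) by apply: HN0; lia.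
have Hc n : Rabs (c n) <= 2 * e0 / vnorm u.
  have [_ H] := Hnorm n; have H' := Hd n; have H0 := Rabs_pos (c n).
  apply: (Rmult_le_reg_r (vnorm u)) => //.
  have -> : 2 * e0 / vnorm u * vnorm u = 2 * e0 by field; lra.
  nra.
case: (bolzano c _ Hc) => sg [Hs [c' Hcv]].
have Hlim' e : 0 < e -> exists y, K y /\ dist2 (vscal c' u) y < e /\ a * e0 <= vnorm y.
  move=> He; pose M := Rabs c' + 1 + vnorm u; have HM : 0 < M by have := Rabs_pos c'; rewrite /M; lra.
  pose e' := Rmin 1 (e / M); have He' : 0 < e' by apply: Rmin_glb_lt; [lra | apply: Rdiv_lt_0_compat].
  have M1 : e' <= 1 by apply: Rmin_l.
  have M2 : e' * M <= e.
    have E : e = e / M * M by field; lra.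
    by rewrite [X in _ <= X]E; apply: Rmult_le_compat_r; [lra | apply: Rmin_r].
  case: (Hlim e' He') => N1 HN1; case: (Hcv e' He') => N2 HN2.
  pose n := sg (N1 + N2)%nat; have Hsn := extraction_ge _ Hs (N1 + N2).
  exists (vscal (c n) (d n)); split; first exact: Kcd.
  split; last by rewrite vnorm_scal; case: (Hnorm n).
  have H1 : dist2 (d n) u < e' by apply: HN1; rewrite /n; lia.
  have H2 : Rabs (c n - c') < e' by apply: HN2; lia.
  rewrite dist2_sym dist2_vnorm.
  have -> : vsub (vscal (c n) (d n)) (vscal c' u) = vadd (vscal (c n) (vsub (d n) u)) (vscal (c n - c') u).
    plane; ring.
  apply: Rle_lt_trans (vnorm_triang _ _) _; rewrite !vnorm_scal -dist2_vnorm.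
  have H3 : Rabs (c n) <= Rabs c' + 1.
    have := Rabs_triang (c n - c') c'; have -> : c n - c' + c' = c n by ring.
    lra.
  have := dist2_ge0 (d n) u; have := Rabs_pos (c n); rewrite /M in M2; nra.
exists c'; split; last by apply: HKc => e He; case: (Hlim' e He) => y [H1 [H2 _]]; exists y; rewrite dist2_sym in H2 *; split.
move=> E; case: (Hlim' (a * e0)) => [|y [_ [H1 H2]]]; first exact: Rmult_lt_0_compat.
move: H1; rewrite E dist2_sym dist2_vnorm.
have -> : vsub y (vscal 0 u) = y by plane; ring.
lra.
Qed.

Lemma iter_K n z : K z -> K (Nat.iter n (mapp B) z).
Proof. by move=> Kz; elim: n => [|n IH] //=; apply: HB. Qed.

Definition shift (g : R) (z : R2) : R2 := vsub (mapp B z) (vscal g z).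

(** Cayley-Hamilton: [(B - g1) (B - g2) = 0], so the image of [B - g2] consists of eigenvectors for
    [g1]. *)
Lemma shift_eigen g1 g2 z : m11 B + m22 B = g1 + g2 -> mdet B = g1 * g2 ->
  mapp B (shift g2 z) = vscal g1 (shift g2 z).
Proof.
rewrite /shift /mdet => Ht Hd; have E : m11 B = g1 + g2 - m22 B by lra.
have E' : m12 B * m21 B = (g1 + g2 - m22 B) * m22 B - g1 * g2 by rewrite -Hd E; ring.
plane; rewrite E; ring [E'].
Qed.

Lemma shift_nonzero g z1 z2 : cross z1 z2 <> 0 -> B <> mscal g mid ->
  shift g z1 <> (0, 0) \/ shift g z2 <> (0, 0).
Proof.
move=> Hx HBg; apply: NNPP => /not_or_and [/NNPP E1 /NNPP E2]; apply: HBg.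
move: E1 E2; rewrite /shift /mapp /vsub /vscal /= => -[E1 E2] [E3 E4].
have Hl p q : p * fst z1 + q * snd z1 = 0 -> p * fst z2 + q * snd z2 = 0 -> p = 0 /\ q = 0.
  move=> H1 H2; have [P Q] := linear_from_two p q z1 z2 Hx.
  by rewrite H1 H2 in P Q; rewrite P Q; split; field.
case: (Hl (m11 B - g) (m12 B)) => [||P1 P2]; [lra | lra |].
case: (Hl (m21 B) (m22 B - g)) => [||P3 P4]; [lra | lra |].
rewrite /mscal; plane; lra.
Qed.

Lemma pow_small r e : Rabs r < 1 -> 0 < e -> exists N, forall n, (N <= n)%nat -> Rabs (r ^ n) < e.
Proof. by move=> Hr He; case: (pow_lt_1_zero r Hr e He) => N HN; exists N => n Hn; apply: HN; lia. Qed.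

Lemma dominant_commensurable g1 g2 z1 z2 : m11 B + m22 B = g1 + g2 -> mdet B = g1 * g2 ->
  Rabs g2 < Rabs g1 -> Rabs g1 < 1 -> K z1 -> K z2 -> cross z1 z2 <> 0 ->
  exists (m : nat) (q : Z), (1 <= m)%nat /\ (g1 ^ 2) ^ m = powerRZ a q.
Proof.
move=> Ht Hd Hg Hg1 K1 K2 Hx.
have G1 : g1 <> 0 by move=> E; rewrite E Rabs_R0 in Hg; have := Rabs_pos g2; lra.
have G12 : g1 - g2 <> 0 by move=> E; have E' : g1 = g2 by [lra]; rewrite E' in Hg; lra.
have HBg : B <> mscal g2 mid by move=> E; rewrite E /mscal /= in Ht; lra.
have [z [Kz Hz]] : exists z, K z /\ shift g2 z <> (0, 0).
  by case: (shift_nonzero g2 z1 z2 Hx HBg) => H; [exists z1 | exists z2].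
(* The decomposition of [z] into eigencomponents; divided by [g1 ^ n], only the dominant one
   survives. *)
have Hiter n : Nat.iter n (mapp B) z =
   vscal (/ (g1 - g2)) (vsub (vscal (g1 ^ n) (shift g2 z)) (vscal (g2 ^ n) (shift g1 z))).
  elim: n => [|n IH] /=; first by rewrite /shift; plane; field.
  rewrite IH mapp_scal mapp_sub !mapp_scal (shift_eigen g1 g2) // (shift_eigen g2 g1); try lra.
  by rewrite !vscal_vscal; f_equal; f_equal; f_equal; ring.
case: (limit_direction (fun n => Nat.iter n (mapp B) z) (fun n => g1 ^ n / (g1 - g2)) (shift g2 z)) => //.
- by move=> n; apply: iter_K.
- move=> n; rewrite Rdiv_def; apply: Rmult_integral_contrapositive_currified.
    exact: pow_nonzero.
  exact: Rinv_neq_0_compat.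
- move=> e He; pose M := vnorm (shift g1 z) + 1; have HM : 0 < M by have := vnorm_ge0 (shift g1 z); rewrite /M; lra.
  have Hq : Rabs (g2 / g1) < 1.
    rewrite Rdiv_def Rabs_mult Rabs_inv; have Hp := Rabs_pos_lt _ G1.
    by apply: (Rmult_lt_reg_r (Rabs g1)) => //; rewrite Rmult_assoc Rinv_l; lra.
  case: (pow_small (g2 / g1) (e / M) Hq) => [|N HN]; first exact: Rdiv_lt_0_compat.
  exists N => n Hn; have := HN n Hn; rewrite Hiter dist2_vnorm.
  have -> : vsub (vscal (/ (g1 ^ n / (g1 - g2))) (vscal (/ (g1 - g2))
      (vsub (vscal (g1 ^ n) (shift g2 z)) (vscal (g2 ^ n) (shift g1 z))))) (shift g2 z)
      = vscal (- (g2 / g1) ^ n) (shift g1 z).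
    have Hp : g1 ^ n <> 0 by apply: pow_nonzero.
    have -> : (g2 / g1) ^ n = g2 ^ n / g1 ^ n by rewrite !Rdiv_def Rpow_mult_distr pow_inv.
    by move: (shift g2 z) (shift g1 z) => v w; plane; field.
  rewrite vnorm_scal Rabs_Ropp => H; have E : e = e / M * M by field; lra.
  have := vnorm_ge0 (shift g1 z); have := Rabs_pos ((g2 / g1) ^ n); rewrite {2}/M in E; nra.
- move=> c [Hc Kc]; apply: (eigenline_commensurable (vscal c (shift g2 z)) g1) => //.
  + move=> E; have := vnorm_scal c (shift g2 z); rewrite E vnorm_0.
    have := Rabs_pos_lt _ Hc; have := vnorm_pos _ Hz; nra.
  + by rewrite mapp_scal (shift_eigen g1 g2) // !vscal_vscal Rmult_comm.
Qed.

(** Relative to [g ^ n] the orbit drifts linearly along [u], so it turns toward the eigenline, and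
    [g] and [a] are commensurable. Undoing the scale by powers of [a] leaves an arithmetic
    progression along [u], which fills a segment when shrunk. *)
Lemma no_jordan_block g z1 z2 : m11 B + m22 B = g + g -> mdet B = g * g -> B <> mscal g mid ->
  g <> 0 -> Rabs g < 1 -> K z1 -> K z2 -> cross z1 z2 <> 0 -> False.
Proof.
move=> Ht Hd HBg Hg Hg1 K1 K2 Hx.
have [z [Kz Hz]] : exists z, K z /\ shift g z <> (0, 0).
  by case: (shift_nonzero g z1 z2 Hx HBg) => H; [exists z1 | exists z2].
set u := shift g z in Hz; have HBu : mapp B u = vscal g u by apply: shift_eigen.
have HBz : mapp B z = vadd (vscal g z) u by rewrite /u /shift; plane; ring.
have Hun := vnorm_pos _ Hz; clearbody u.
have HBadd v w : mapp B (vadd v w) = vadd (mapp B v) (mapp B w) by plane; ring.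
have Hiter n : Nat.iter n (mapp B) z = vscal (g ^ n) (vadd z (vscal (INR n / g) u)).
  elim: n => [|n IH]; first by rewrite /=; plane; field.
  rewrite [Nat.iter _ _ _]/= IH mapp_scal HBadd mapp_scal HBz HBu S_INR /=.
  by plane; field.
have [c [Hc Kc]] : exists c, c <> 0 /\ K (vscal c u).
  (* Starting at [S n] keeps the normalizing factor nonzero. *)
  apply: (limit_direction (fun n => Nat.iter (S n) (mapp B) z) (fun n => INR (S n) * g ^ n)) => //.
    by move=> n; apply: iter_K.
    move=> n; apply: Rmult_integral_contrapositive_currified; last exact: pow_nonzero.
    exact: not_0_INR.
    move=> e He; pose M := Rabs g * vnorm z + 1.
    have HM : 0 < M by have := vnorm_ge0 z; have := Rabs_pos g; rewrite /M; nra.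
    case: (inv_Sn_small (e / M)) => [|N HN]; first exact: Rdiv_lt_0_compat.
    exists N => n Hn; have H := HN n Hn; have Hp := inv_Sn_pos n; rewrite Hiter dist2_vnorm.
    have -> : vsub (vscal (/ (INR (S n) * g ^ n)) (vscal (g ^ S n) (vadd z (vscal (INR (S n) / g) u)))) u
      = vscal (/ INR (S n) * g) z.
      have Hgn : g ^ n <> 0 by apply: pow_nonzero.
      have HS : INR (S n) <> 0 by apply: not_0_INR.
      by move: (INR (S n)) HS => r HS; plane; field.
    rewrite vnorm_scal Rabs_mult (Rabs_pos_eq (/ _)); first by left.
    have E : e = e / M * M by field; lra.
    have : 0 <= Rabs g * vnorm z by apply: Rmult_le_pos; [exact: Rabs_pos | exact: vnorm_ge0].
    rewrite {2}/M in E; nra.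
case: (eigenline_commensurable (vscal c u) g) => //.
  move=> E; have := vnorm_scal c u; rewrite E vnorm_0; have := Rabs_pos_lt _ Hc; nra.
  by rewrite mapp_scal HBu !vscal_vscal Rmult_comm.
move=> m [q [Hm Emq]]; pose s := INR (2 * m) / g.
have Hs : s <> 0.
  rewrite /s Rdiv_def; apply: Rmult_integral_contrapositive_currified; last exact: Rinv_neq_0_compat.
  by apply: not_0_INR; lia.
have Hsa := Rabs_pos_lt _ Hs.
have Kshear n (p : Z) : vnorm (vscal (powerRZ a p) (vadd z (vscal (INR n * s) u))) < e0 ->
    K (vscal (powerRZ a p) (vadd z (vscal (INR n * s) u))).
  have Kn := iter_K (2 * m * n) z Kz; rewrite Hiter in Kn.
  have E1 : g ^ (2 * m * n) = powerRZ a (q * Z.of_nat n).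
    rewrite pow_mult pow_mult Emq pow_exp; first exact: powerRZ_lt.
    rewrite !powerRZ_exp // ln_exp mult_IZR -INR_IZR_INZ; f_equal; ring.
  have E2 : INR (2 * m * n) / g = INR n * s by rewrite mult_INR /s; field.
  rewrite E1 E2 in Kn; have := scale_invariant _ (p - q * Z.of_nat n) Kn.
  rewrite vscal_vscal -powerRZ_add; last by have -> : (p - q * Z.of_nat n + q * Z.of_nat n = p)%Z by lia.
  lra.
pose c1 := e0 / 2 / (Rabs s * vnorm u).
have Hsu : 0 < Rabs s * vnorm u by apply: Rmult_lt_0_compat.
apply: (Hseg (vscal s u) c1).
  move=> E; have := vnorm_scal s u; rewrite E vnorm_0; lra.
  by apply: Rdiv_lt_0_compat => //; lra.
move=> d Hd0 Hd1; apply: HKc => e He.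
pose M := vnorm z + Rabs s * vnorm u + 1; have HM : 0 < M by have := vnorm_ge0 z; rewrite /M; lra.
have Ha2 : Rabs a < 1 by rewrite Rabs_pos_eq; lra.
case: (pow_small a (Rmin (e / M) (e0 / 2 / M)) Ha2) => [|k Hk].
  by apply: Rmin_glb_lt; apply: Rdiv_lt_0_compat => //; lra.
have := Hk k (le_n k); have Hak := pow_lt _ k Ha; rewrite Rabs_pos_eq => [|Hak']; first lra.
have Hak1 : a ^ k * M < e.
  have E : e = e / M * M by field; lra.
  rewrite [X in _ < X]E; apply: Rmult_lt_compat_r => //; apply: Rlt_le_trans Hak' (Rmin_l _ _).
have Hak2 : a ^ k * M < e0 / 2.
  have E : e0 / 2 = e0 / 2 / M * M by field; lra.
  rewrite [X in _ < X]E; apply: Rmult_lt_compat_r => //; apply: Rlt_le_trans Hak' (Rmin_r _ _).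
(* After scaling by [a ^ k] the progression has spacing [a ^ k * s] along [u]; its [j]-th point
   misses [d * s] by at most one spacing, and the offset [a ^ k * z] is small too. *)
case: (int_floor (d / a ^ k)) => j Hj.
have Hda : 0 < d / a ^ k by apply: Rdiv_lt_0_compat.
have Hj0 : (0 <= j)%Z.
  have : IZR (-1) < IZR j by lra.
  by move=> /lt_IZR; lia.
have Ej : INR (Z.to_nat j) = IZR j by rewrite INR_IZR_INZ Z2Nat.id.
have Edk : d = d / a ^ k * a ^ k by field; lra.
set w := vscal (powerRZ a (Z.of_nat k)) (vadd z (vscal (INR (Z.to_nat j) * s) u)).
have Hw : dist2 w (vscal d (vscal s u)) <= a ^ k * M.
  rewrite /w -pow_powerRZ Ej dist2_vnorm.
  have -> : vsub (vscal (a ^ k) (vadd z (vscal (IZR j * s) u))) (vscal d (vscal s u)) =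
     vadd (vscal (a ^ k) z) (vscal (a ^ k * IZR j - d) (vscal s u)) by plane; ring.
  apply: Rle_trans (vnorm_triang _ _) _; rewrite !vnorm_scal (Rabs_pos_eq (a ^ k)); first lra.
  have : Rabs (a ^ k * IZR j - d) <= a ^ k.
    rewrite {1}Edk; have E : a ^ k * IZR j - d / a ^ k * a ^ k = a ^ k * (IZR j - d / a ^ k) by ring.
    rewrite E Rabs_mult (Rabs_pos_eq (a ^ k)); first lra.
    have : Rabs (IZR j - d / a ^ k) <= 1 by rewrite /Rabs; case: Rcase_abs; lra.
    nra.
  move=> H; rewrite /M; nra.
exists w; split; last by rewrite dist2_sym; lra.
apply: Kshear; rewrite -/w.
have -> : w = vadd (vsub w (vscal d (vscal s u))) (vscal d (vscal s u)) by plane; ring.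
apply: Rle_lt_trans (vnorm_triang _ _) _; rewrite -dist2_vnorm !vnorm_scal (Rabs_pos_eq d); first lra.
have : d * (Rabs s * vnorm u) < e0 / 2.
  have -> : e0 / 2 = c1 * (Rabs s * vnorm u) by rewrite /c1; field; split; lra.
  by apply: Rmult_lt_compat_r.
lra.
Qed.

End ScaleInvariant.

(** * Finite rotation group: a common fixed point *)

Fixpoint rep (n : nat) (I : list nat) : list nat :=
  match n with O => [] | S n' => I ++ rep n' I end.

Fixpoint worth (Phi : ifs) (I : list nat) : mat2 :=
  match I with nil => mid | i :: I' => mmul (s_orth (mp Phi i)) (worth Phi I') end.
Fixpoint walpha (Phi : ifs) (I : list nat) : R :=
  match I with nil => 1 | i :: I' => s_alpha (mp Phi i) * walpha Phi I' end.

Section FiniteGroup.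
Context (Phi : ifs).
Local Notation F := (att Phi).
Local Notation emb := (emb Phi).
Local Notation exact_emb := (exact_emb Phi).
Local Notation word := (word Phi).
Local Notation waff := (waff Phi).
Local Notation wrat := (wrat Phi).
Implicit Types (I J : list nat) (f g h : aff).

Lemma word_rep n I : word I -> word (rep n I).
Proof. by move=> HI; elim: n => [|n IH] /=; [exact: word_nil | exact: word_app]. Qed.

Lemma worth_app I J : worth Phi (I ++ J) = mmul (worth Phi I) (worth Phi J).
Proof. by elim: I => [|i I IH] /=; rewrite ?mmul_1l // IH mmul_assoc. Qed.

Lemma walpha_app I J : walpha Phi (I ++ J) = walpha Phi I * walpha Phi J.
Proof. elim: I => [|i I IH] /=; rewrite ?IH; ring. Qed.

Lemma waff_linear I : fst (waff I) = mscal (walpha Phi I) (worth Phi I).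
Proof.
elim: I => [|i I IH] /=; first by rewrite /mscal; plane; ring.
rewrite IH /mscal; plane; ring.
Qed.

Lemma walpha_sq I : walpha Phi I ^ 2 = wrat I ^ 2.
Proof.
elim: I => [|i I IH]; first by [].
by rewrite [walpha _ _]/= [wrat _]/= !Rpow_mult_distr IH /rat pow2_abs.
Qed.

Lemma wrat_rep n I : wrat (rep n I) = wrat I ^ n.
Proof. by elim: n => [|n IH] //=; rewrite wrat_app IH. Qed.

Lemma rep_add m n I : rep (m + n) I = rep m I ++ rep n I.
Proof. by elim: m => [|m IH] //=; rewrite IH app_assoc. Qed.

Lemma worth_orth I : word I -> orthogonal (worth Phi I).
Proof.
rewrite /orthogonal; elim: I => [|i I IH] /=; first by move=> _; plane; ring.
move=> /word_cons [Hi HI]; rewrite mtr_mul -mmul_assoc (mmul_assoc (mtr (s_orth _))) (mp_orth Phi i Hi) mmul_1l.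
exact: IH.
Qed.

(** Only products of generators, without inverses, are controlled here; [words_finite] and
    [group_finite] relate this to [G_finite]. *)
Context (Hfin : exists L : list mat2, forall I, word I -> In (worth Phi I) L).

Lemma worth_torsion I : word I -> exists p, (1 <= p)%nat /\ worth Phi (rep p I) = mid.
Proof.
move=> HI; case: Hfin => L HL.
case: (pigeonhole (fun k => worth Phi (rep k I)) L) => [k _|m [n [Hmn [_ E]]]].
  by apply: HL; apply: word_rep.
exists (n - m)%nat; split; first lia.
have -> : worth Phi (rep (n - m) I) = mmul (mmul (mtr (worth Phi (rep m I))) (worth Phi (rep m I))) (worth Phi (rep (n - m) I)).
  by rewrite (worth_orth _ (word_rep m I HI)) mmul_1l.
rewrite -mmul_assoc -worth_app -rep_add; have -> : (m + (n - m) = n)%nat by lia.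
by rewrite -E; apply: worth_orth; apply: word_rep.
Qed.

Lemma scalar_power I : word I -> exists p, (1 <= p)%nat /\ fst (waff (rep p I)) = mscal (wrat (rep p I)) mid.
Proof.
(* Doubling [p] squares the signed ratio, so the scalar is the positive number [wrat]. *)
move=> HI; case: (worth_torsion I HI) => p [Hp Ep]; exists (p + p)%nat; split; first lia.
rewrite waff_linear rep_add worth_app Ep mmul_1l; f_equal.
rewrite walpha_app wrat_app; have := walpha_sq (rep p I); rewrite /=; lra.
Qed.

Lemma scalar_rep n I c : fst (waff I) = mscal c mid -> fst (waff (rep n I)) = mscal (c ^ n) mid.
Proof.
move=> E; elim: n => [|n IH]; first by rewrite /= /mscal; plane; ring.
by rewrite [rep _ _]/= waff_app /= IH E /mscal; plane; ring.
Qed.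

Lemma wrat_lt1 I : word I -> I <> [] -> wrat I < 1.
Proof.
case: I => [//|i I] /word_cons [Hi HI] _ /=; have := wrat_le1 Phi I HI; have := wrat_pos Phi I HI.
have := mp_hi Phi i Hi; have := rhi_lt1 Phi; rewrite -/(rat Phi i); have := rat_pos Phi i Hi; nra.
Qed.

Lemma exact_scalar_piece g e : emb g -> 0 < e ->
  exists I, word I /\ exact_emb (acomp g (waff I)) /\ fst (waff I) = mscal (wrat I) mid /\ wrat I < e.
Proof.
move=> Hg He; case: (exact_piece Phi g Hg) => I0 [HI0 HE0].
have [i Hi] : exists i, (i < nm Phi)%nat.
  by case: (att_inh Phi) => x Fx; case: (proj1 (att_cyl1 Phi x) Fx) => i [Hi _]; exists i.
(* The extra letter makes the word nonempty, so that its powers become arbitrarily small. *)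
pose I := I0 ++ [i]; have HI : word I by apply: word_app => //; apply: word1.
have HIn : I <> [] by rewrite /I; case: I0 {HI0 HE0 I HI}.
have HE : exact_emb (acomp g (waff I)).
  by rewrite /I waff_app acomp_assoc; apply: exact_sub => //; apply: word1.
case: (scalar_power I HI) => p [Hp Ep]; pose J := rep p I.
have HJ : word J by apply: word_rep.
have HJ1 : wrat J < 1.
  have := wrat_lt1 I HI HIn; have := wrat_pos Phi I HI => H0 H1.
  rewrite /J wrat_rep; case: p Hp {Ep J HJ} => [|p] Hp; first lia.
  have : wrat I ^ p <= 1 by rewrite -(pow1 p); apply: pow_incr; lra.
  have := pow_lt _ p H0; rewrite /=; nra.
have HJ0 := wrat_pos Phi J HJ.
case: (pow_lt_1_zero (wrat J) _ e He) => [|N HN]; first by rewrite Rabs_pos_eq; lra.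
exists (rep (S N) J); split; first exact: word_rep.
split.
  have -> : rep (S N) J = I ++ (rep (p - 1) I ++ rep N J).
    rewrite /= {1}/J; have -> : p = S (p - 1) by lia.
    by rewrite /= Nat.sub_0_r app_assoc.
  rewrite waff_app acomp_assoc; apply: exact_sub => //; apply: word_app; exact: word_rep.
split; first by rewrite (scalar_rep _ _ (wrat J)) // wrat_rep.
by rewrite wrat_rep; have := HN (S N) ltac:(lia); rewrite Rabs_pos_eq //; apply: pow_le; lra.
Qed.

Lemma fixed_point g : (forall z, F z -> F (ap g z)) -> frob (fst g) < 1 -> exists x, F x /\ ap g x = x.
Proof.
move=> Hg Hq; case: (att_inh Phi) => y Fy; case: (att_bounded Phi) => b [Hb HbF].
have Fz n : F (iterf n (ap g) y) by elim: n => [|n IH] //=; apply: Hg.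
have Hq0 := frob_ge0 (fst g); have Hd := diam_pos Phi.
have Hstep n : dist2 (ap g (iterf n (ap g) y)) (iterf n (ap g) y) <= frob (fst g) ^ n * diam Phi.
  elim: n => [|n IH] /=; first by have := att_diam Phi _ _ (Hg y Fy) Fy; lra.
  apply: Rle_trans (ap_lip _ _ _) _; rewrite Rmult_assoc; exact: Rmult_le_compat_l.
case: (bolzano_R2 (fun n => iterf n (ap g) y) b) => [n|sg [Hs [x Hx]]]; first exact: HbF.
exists x; split.
  apply: att_closed => e He; case: (Hx e He) => N HN; exists (iterf (sg N) (ap g) y); split=> //.
  by rewrite dist2_sym; apply: HN.
apply: dist2_eq0; apply: Rle_antisym (dist2_ge0 _ _); apply: le_epsilon => e He.
case: (Hx (e / 3)) => [|N HN]; first lra.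
case: (pow_lt_1_zero (frob (fst g)) _ (e / 3 / diam Phi)) => [||M HM].
  by rewrite Rabs_pos_eq.
  by apply: Rdiv_lt_0_compat; lra.
set n := sg (N + M)%nat; have Hn := extraction_ge _ Hs (N + M).
have H1 := HN (N + M)%nat ltac:(lia); rewrite -/n in H1.
have H2 := HM n ltac:(rewrite /n; lia); rewrite Rabs_pos_eq in H2; first exact: pow_le.
have H3 := Hstep n; have H4 := ap_lip g x (iterf n (ap g) y).
have H5 := dist2_triang (ap g x) (ap g (iterf n (ap g) y)) x.
have H6 := dist2_triang (ap g (iterf n (ap g) y)) (iterf n (ap g) y) x.
rewrite (dist2_sym x) in H4; have H7 := dist2_ge0 (iterf n (ap g) y) x.
have E : e / 3 = e / 3 / diam Phi * diam Phi by field; lra.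
have : frob (fst g) ^ n * diam Phi <= e / 3 by rewrite E; apply: Rmult_le_compat_r; lra.
have : frob (fst g) * dist2 (iterf n (ap g) y) x <= dist2 (iterf n (ap g) y) x by nra.
lra.
Qed.

(** By strong separation a segment in [F] stays in one first-level cylinder. Zooming out repeatedly,
    its length is at most [diam * rhi ^ n] for every [n]. *)
Lemma no_segment x u c1 : u <> (0, 0) -> 0 < c1 -> ~ forall c, 0 < c -> c < c1 -> F (vadd x (vscal c u)).
Proof.
move=> Hu Hc1 Hseg.
have Hlen n : forall x u, (forall c, 0 <= c -> c <= 1 -> F (vadd x (vscal c u))) -> vnorm u <= diam Phi * rhi Phi ^ n.
  move=> {x u Hu Hseg}; elim: n => [|n IH] x u H.
    have := att_diam Phi _ _ (H 1 ltac:(lra) ltac:(lra)) (H 0 ltac:(lra) ltac:(lra)).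
    rewrite dist2_vnorm; have -> : vsub (vadd x (vscal 1 u)) (vadd x (vscal 0 u)) = u by plane; ring.
    by rewrite /= Rmult_1_r.
  case: (proj1 (att_cyl1 Phi _) (H 0 ltac:(lra) ltac:(lra))) => i [Hi C0].
  have Hr := rat_pos Phi i Hi; have Hg := gap_pos Phi; have Hw := word1 Phi i Hi.
  (* The segment is followed in steps of length at most [gap / 2], too short to leave the cylinder
     [i]. *)
  have Hall k : forall c, 0 <= c -> c <= 1 -> c * vnorm u <= INR k * (gap Phi / 2) -> cyl Phi [i] (vadd x (vscal c u)).
    elim: k => [|k IHk] c Hc0 Hc Hk.
      have : vnorm (vscal c u) = 0.
        rewrite vnorm_scal Rabs_pos_eq //; have := vnorm_ge0 u; rewrite /= in Hk; nra.
      move=> /vnorm_eq0 ->; suff <- : vadd x (vscal 0 u) = vadd x (0, 0) by [].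
      plane; ring.
    case: (Rle_lt_dec (c * vnorm u) (INR k * (gap Phi / 2))) => Hk'; first exact: IHk.
    have Hu : 0 < vnorm u.
      case: (vnorm_ge0 u) => // E; move: Hk'; rewrite -E; have := pos_INR k; nra.
    have [c' [Hc'0 [Hc'1 [Hc'2 Hc'3]]]] : exists c', 0 <= c' /\ c' <= c /\ c' * vnorm u <= INR k * (gap Phi / 2)
       /\ (c - c') * vnorm u < gap Phi.
      rewrite S_INR in Hk; have Hk0 := pos_INR k.
      exists (INR k * (gap Phi / 2) / vnorm u).
      have E : INR k * (gap Phi / 2) / vnorm u * vnorm u = INR k * (gap Phi / 2) by field; lra.
      split; first by apply: Rmult_le_pos; [nra | left; exact: Rinv_0_lt_compat].
      split; first by apply: (Rmult_le_reg_r (vnorm u)) => //; lra.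
      split; [lra | nra].
    have C' := IHk c' Hc'0 ltac:(lra) Hc'2.
    case: (proj1 (att_cyl1 Phi _) (H c Hc0 Hc)) => j [Hj Cj].
    case: (Nat.eq_dec i j) => [-> //|Hne].
    case: C' Cj => [y [Fy Ey]] [y' [Fy' Ey']].
    have := att_gap Phi i j y y' Hi Hj Hne Fy Fy'; rewrite -!ap_waff1 Ey Ey' dist2_sym dist2_vnorm.
    have -> : vsub (vadd x (vscal c u)) (vadd x (vscal c' u)) = vscal (c - c') u by plane; ring.
    rewrite vnorm_scal Rabs_pos_eq; lra.
  have [k Hk] : exists k, vnorm u <= INR k * (gap Phi / 2).
    case: (INR_unbounded (vnorm u / (gap Phi / 2))) => k Hk; exists k.
    have -> : vnorm u = vnorm u / (gap Phi / 2) * (gap Phi / 2) by field; lra.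
    by apply: Rmult_le_compat_r; lra.
  have Hdet := waff_det_neq0 Phi [i] Hw.
  pose v := mapp (fst (ainv (waff [i]))) u.
  have Ev : mapp (fst (waff [i])) v = u.
    rewrite /v -mapp_mul /ainv [fst (_, _)]/= minvr //; plane; ring.
  have Hv : vnorm v <= diam Phi * rhi Phi ^ n.
    apply: (IH (ap (ainv (waff [i])) x)) => c Hc0 Hc1'.
    have -> : vadd (ap (ainv (waff [i])) x) (vscal c v) = ap (ainv (waff [i])) (vadd x (vscal c u)).
      rewrite /v /ap; plane; ring.
    case: (Hall k c Hc0 Hc1') => [|y [Fy <-]]; last by rewrite apVl.
    have := vnorm_ge0 u; nra.
  have := waff_norm Phi [i] v Hw; rewrite Ev wrat1 => ->.
  have := mp_hi Phi i Hi; rewrite -/(rat Phi i) /=; have := vnorm_ge0 v; have := rhi_pos Phi.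
  have : 0 <= diam Phi * rhi Phi ^ n.
    by apply: Rmult_le_pos; [left; apply: diam_pos | apply: pow_le; left; apply: rhi_pos].
  nra.
have Hn := vnorm_pos _ Hu.
have H1 n : vnorm (vscal (c1 / 2) u) <= diam Phi * rhi Phi ^ n.
  apply: (Hlen n (vadd x (vscal (c1 / 4) u))) => c Hc0 Hc.
  have -> : vadd (vadd x (vscal (c1 / 4) u)) (vscal c (vscal (c1 / 2) u)) = vadd x (vscal (c1 / 4 + c * (c1 / 2)) u).
    plane; field.
  apply: Hseg; nra.
have Hd := diam_pos Phi; have Hp : 0 < vnorm (vscal (c1 / 2) u).
  by rewrite vnorm_scal Rabs_pos_eq; [lra | apply: Rmult_lt_0_compat; lra].
case: (rhi_pow_small Phi (vnorm (vscal (c1 / 2) u) / diam Phi)) => [|n Hlt]; first exact: Rdiv_lt_0_compat.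
have := H1 n; have E : vnorm (vscal (c1 / 2) u) = diam Phi * (vnorm (vscal (c1 / 2) u) / diam Phi) by field; lra.
have := Rmult_lt_compat_l _ _ _ Hd Hlt; lra.
Qed.

Lemma nested_prefix x I J : word I -> word J -> cyl Phi I x -> cyl Phi J x -> (length I <= length J)%nat ->
  exists w, word w /\ J = I ++ w /\ length J = (length I + length w)%nat.
Proof.
move=> HI HJ CI CJ HL; exists (skipn (length I) J).
have E := firstn_skipn (length I) J.
have [H1 H2] : word (firstn (length I) J) /\ word (skipn (length I) J).
  by apply: word_app_inv; rewrite E.
have EI : I = firstn (length I) J.
  apply: (cyl_disj Phi _ _ x) => //; first by rewrite length_firstn; lia.
  by apply: (cyl_prefix Phi _ (skipn (length I) J)) => //; rewrite E.
split=> //; split; first by rewrite {1}EI E.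
by rewrite length_skipn; lia.
Qed.

(* The maps [phi_{x|n}^{-1} g phi_{x|n}] at the fixed point [x] of [g] have constant
   density and the same determinant, so two of them coincide; their fixed points then coincide as well. *)
Lemma common_fixed_point g : emb g -> exists x u w B,
  F x /\ word u /\ word w /\ w <> [] /\ fst (waff w) = mscal (wrat w) mid /\ ap (waff w) x = x /\
  (forall z, F (vadd x z) -> F (vadd x (mapp B z))) /\ wrat u * frob (fst g) < 1 /\
  exists P, mdet P <> 0 /\ B = mmul (minv P) (mmul (mscal (wrat u) (fst g)) P).
Proof.
move=> Hg; have Hfr := frob_pos _ (proj1 Hg); have Hd := diam_pos Phi; have Hgp := gap_pos Phi.
(* The first bound makes [g phi_u] a contraction; the second makes it map every cylinder around its
   fixed point into itself. *)
pose e := Rmin (/ frob (fst g)) (gap Phi / diam Phi / frob (fst g)).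
have He : 0 < e.
  apply: Rmin_glb_lt; first exact: Rinv_0_lt_compat.
  by do 2 apply: Rdiv_lt_0_compat => //.
case: (exact_scalar_piece g e Hg He) => u [Hu [HE [Eu Hue]]].
set g0 := acomp g (waff u) in HE; have [Hg0 _] := HE.
have Hru := wrat_pos Phi u Hu.
have Elin : fst g0 = mscal (wrat u) (fst g) by rewrite /g0 /= Eu /mscal; plane; ring.
have Efr z : vnorm (mapp (fst g0) z) <= wrat u * frob (fst g) * vnorm z.
  rewrite Elin mapp_mscal vnorm_scal Rabs_pos_eq; first lra.
  rewrite Rmult_assoc; apply: Rmult_le_compat_l; [lra | exact: frob_bound].
have Hq1 : wrat u * frob (fst g) < 1.
  have := Rlt_le_trans _ _ _ Hue (Rmin_l _ _) => H.
  by have := Rmult_lt_compat_r _ _ _ Hfr H; rewrite Rinv_l; lra.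
have Hq2 : wrat u * frob (fst g) * diam Phi < gap Phi.
  have := Rlt_le_trans _ _ _ Hue (Rmin_r _ _) => H.
  have := Rmult_lt_compat_r _ _ _ (Rmult_lt_0_compat _ _ Hfr Hd) H.
  have -> : gap Phi / diam Phi / frob (fst g) * (frob (fst g) * diam Phi) = gap Phi by field; lra.
  lra.
set q := wrat u * frob (fst g) in Efr Hq1 Hq2.
have Hq0 : 0 < q by apply: Rmult_lt_0_compat.
have Hlip x y : dist2 (ap g0 x) (ap g0 y) <= q * dist2 x y by rewrite !dist2_vnorm ap_sub.
have Efrob : frob (fst g0) < 1.
  suff -> : frob (fst g0) = q by [].
  rewrite Elin; apply: sq_eq; [exact: frob_ge0 | lra |].
  rewrite /q Rpow_mult_distr !frob_sq /=; ring.
case: (fixed_point g0 (proj2 Hg0) Efrob) => x0 [F0 E0].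
have HI : forall n : nat, exists I, word I /\ length I = n /\ cyl Phi I x0 by move=> n; apply: att_level.
case: (choice_fun _ HI) => pre Hpre.
pose h n := normalization Phi g0 (pre n) (pre n).
have Ehap n z : ap (waff (pre n)) (ap (h n) z) = ap g0 (ap (waff (pre n)) z).
  by rewrite -ap_comp normalizationK ?ap_comp //; case: (Hpre n).
have Hh n : emb (h n).
  case: (Hpre n) => HIn [HL Cx]; split.
    rewrite /h /normalization; apply: adet_comp_neq0.
      by apply: adet_inv_neq0; apply: waff_det_neq0.
    by apply: adet_comp_neq0; [case: Hg0 | apply: waff_det_neq0].
  move=> z Fz; have Fp := att_waff Phi _ z HIn Fz.
  have Cz : cyl Phi (pre n) (ap g0 (ap (waff (pre n)) z)).
    apply: (cyl_gap Phi _ x0) => //; first by case: Hg0 => _; apply.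
    rewrite -{1}E0; apply: Rle_lt_trans (Hlip _ _) _.
    have Cp : cyl Phi (pre n) (ap (waff (pre n)) z) by exists z.
    have := cyl_diam Phi _ _ _ HIn Cx Cp; have := wrat_pos Phi _ HIn => H1 H2.
    apply: Rle_lt_trans (Rmult_le_compat_l _ _ _ (Rlt_le _ _ Hq0) H2) _.
    by rewrite -Rmult_assoc; apply: Rmult_lt_compat_r.
  case: Cz => y [Fy Ey]; rewrite -Ehap in Ey.
  by rewrite -(waff_inj Phi _ _ _ HIn Ey).
have Hdet n : Rabs (adet (h n)) = Rabs (adet g0).
  have Hnz := waff_det_neq0 Phi _ (proj1 (Hpre n)).
  by rewrite /h /normalization !adet_comp adet_inv //; f_equal; field.
have Hd0 := Rabs_pos_lt _ (proj1 Hg0).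
case: (exact_finite Phi _ Hd0) => L HL.
case: (pigeonhole h L) => [n _|m [n [Hmn [_ Emn]]]].
  apply: HL; split; last by rewrite Hdet; lra.
  case: (Hpre n) => HIn _; apply/(exact_post Phi (pre n)) => //.
  by rewrite normalizationK //; apply: exact_sub.
case: (Hpre m) => HIm [Lm Cm]; case: (Hpre n) => HIn [Ln Cn].
case: Cm => x [Fx Ex]; case: (Cn) => x' [Fx' Ex'].
have Hfix k y : ap (waff (pre k)) y = x0 -> ap (h k) y = y.
  move=> Ey; apply: (waff_inj Phi (pre k)); first by case: (Hpre k).
  by rewrite Ehap Ey.
have Hx : ap (h m) x = x by apply: Hfix.
have Hx' : ap (h m) x' = x' by rewrite Emn; apply: Hfix.
(* [h m] is conjugate to a contraction by a similarity, so its fixed point is unique. The longer of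
   the two words then extends the shorter by a word [w] that fixes [x]. *)
have Exx : x' = x.
  apply: dist2_eq0; have := Hlip (ap (waff (pre m)) x') (ap (waff (pre m)) x).
  rewrite -!Ehap Hx Hx' waff_dist //; have := wrat_pos Phi _ HIm; have := dist2_ge0 x' x => H1 H2 H3.
  have : wrat (pre m) * dist2 x' x * (1 - q) <= 0 by lra.
  have := Rmult_lt_0_compat _ _ H2 (_ : 0 < 1 - q); nra.
subst x'.
have Cm : cyl Phi (pre m) x0 by exists x.
case: (nested_prefix x0 (pre m) (pre n) HIm HIn Cm Cn) => [|w [Hw [Ew Lw]]]; first lia.
have Hwx : ap (waff w) x = x.
  by apply: (waff_inj Phi (pre m)) => //; rewrite -ap_comp -waff_app -Ew Ex' Ex.
case: (scalar_power w Hw) => p [Hp Ep].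
exists x, u, (rep p w), (fst (h m)); do 2 split=> //; split; first exact: word_rep.
split.
  case: p Hp {Ep} => [|p] Hp; first lia.
  by case: w Lw {Hw Ew Hwx} => [|i w] //=; lia.
split=> //; split; first by elim: p {Hp Ep} => [|p IH] /=; rewrite ?ap_id // waff_app ap_comp IH.
split.
  move=> z Fz; have := proj2 (Hh m) _ Fz.
  suff -> : ap (h m) (vadd x z) = vadd x (mapp (fst (h m)) z) by [].
  have -> : ap (h m) (vadd x z) = vadd (ap (h m) x) (mapp (fst (h m)) z) by rewrite /ap; plane; ring.
  by rewrite Hx.
split=> //; exists (fst (waff (pre m))); split; first exact: waff_det_neq0.
by rewrite -Elin.
Qed.

Lemma trace_conj P A : mdet P <> 0 ->
  m11 (mmul (minv P) (mmul A P)) + m22 (mmul (minv P) (mmul A P)) = m11 A + m22 A.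
Proof. by rewrite /mdet => H; rewrite /mmul /minv /mdet /=; field. Qed.

Lemma spanning_pair x : exists z1 z2, F (vadd x z1) /\ F (vadd x z2) /\ cross z1 z2 <> 0.
Proof.
case: (att_tri Phi) => a [b [c [Fa [Fb [Fc Hx]]]]].
have Hv y : vadd x (vsub y x) = y by plane; ring.
(* The signed area of a triangle is the sum of the three areas seen from [x]. *)
have E : cross (vsub b a) (vsub c a) = cross (vsub a x) (vsub b x) + cross (vsub b x) (vsub c x)
   + cross (vsub c x) (vsub a x) by plane; ring.
case: (Req_dec (cross (vsub a x) (vsub b x)) 0) => H1; last by exists (vsub a x), (vsub b x); rewrite !Hv.
case: (Req_dec (cross (vsub b x) (vsub c x)) 0) => H2; last by exists (vsub b x), (vsub c x); rewrite !Hv.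
exists (vsub c x), (vsub a x); rewrite !Hv; split=> //; split=> // H3; apply: Hx; lra.
Qed.

Lemma local_scaling x w : F x -> word w -> w <> [] -> fst (waff w) = mscal (wrat w) mid -> ap (waff w) x = x ->
  closed2 (fun z => F (vadd x z)) /\ 0 < wrat w /\ wrat w < 1 /\ 0 < gap Phi * wrat w /\
  (forall z, F (vadd x z) -> F (vadd x (vscal (wrat w) z))) /\
  (forall z, F (vadd x z) -> vnorm z < gap Phi * wrat w -> F (vadd x (vscal (/ wrat w) z))).
Proof.
move=> Fx Hw Hwn Elin Efix; have Hr := wrat_pos Phi w Hw.
have Eap z : ap (waff w) (vadd x z) = vadd x (vscal (wrat w) z).
  rewrite -{2}Efix /ap Elin /mscal; plane; ring.
split.
  move=> z Hz; apply: att_closed => e He; case: (Hz e He) => y [Fy Hy]; exists (vadd x y); split=> //.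
  suff -> : dist2 (vadd x z) (vadd x y) = dist2 z y by [].
  rewrite !dist2_vnorm; f_equal; plane; ring.
split=> //; split; first exact: wrat_lt1.
split; first by apply: Rmult_lt_0_compat => //; apply: gap_pos.
split; first by move=> z Fz; rewrite -Eap; apply: att_waff.
move=> z Fz Hz.
have Cx : cyl Phi w x by exists x.
case: (cyl_gap Phi w x (vadd x z) Hw Cx Fz) => [|y [Fy Ey]].
  rewrite dist2_sym dist2_vnorm; have -> : vsub (vadd x z) x = z by plane; ring.
  done.
suff -> : vadd x (vscal (/ wrat w) z) = y by [].
apply: (waff_inj Phi w) => //; rewrite Ey Eap vscal_vscal Rinv_r ?vscal_1 //; lra.
Qed.

(** The squares of the two eigenvalues add up to the trace of [A ^ 2], which is at most
    [frob A ^ 2]. *)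
Lemma trace_det_frob A (g1 g2 : R) : m11 A + m22 A = g1 + g2 -> mdet A = g1 * g2 -> Rabs g1 <= frob A.
Proof.
move=> Ht Hd; apply: sq_le; first exact: frob_ge0.
rewrite pow2_abs frob_sq; have E : g1 ^ 2 + g2 ^ 2 = m11 A ^ 2 + m22 A ^ 2 + 2 * (m12 A * m21 A).
  transitivity ((g1 + g2) ^ 2 - 2 * (g1 * g2)); first ring.
  rewrite -Ht -Hd /mdet; ring.
have := pow2_ge_0 g2; have := pow2_ge_0 (m12 A - m21 A); nra.
Qed.

Lemma dominant_eigenvalue g (g1 g2 : R) : emb g -> m11 (fst g) + m22 (fst g) = g1 + g2 -> adet g = g1 * g2 ->
  Rabs g2 < Rabs g1 -> exists u w (m : nat) (q : Z),
  word u /\ word w /\ w <> [] /\ (1 <= m)%nat /\ ((wrat u * g1) ^ 2) ^ m = powerRZ (wrat w) q.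
Proof.
move=> Hg Ht Hdt Hlt; case: (common_fixed_point g Hg) => x [u [w [C [Fx [Hu [Hw [Hwn [Elin [Efix [HC [Hq [P [HP EC]]]]]]]]]]]]].
have Hru := wrat_pos Phi u Hu; have Hrw := wrat_pos Phi w Hw.
case: (local_scaling x w Fx Hw Hwn Elin Efix) => H1 [H2 [H3 [H4 [H5 H6]]]].
case: (spanning_pair x) => z1 [z2 [F1 [F2 Hx]]].
have Htr : m11 C + m22 C = wrat u * g1 + wrat u * g2.
  rewrite EC trace_conj //; transitivity (wrat u * (m11 (fst g) + m22 (fst g))); last by rewrite Ht; ring.
  rewrite /mscal /=; ring.
have Hdet : mdet C = (wrat u * g1) * (wrat u * g2).
  rewrite EC !mdet_mul mdet_inv //; have -> : mdet (mscal (wrat u) (fst g)) = wrat u ^ 2 * adet g.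
    rewrite /adet /mdet /mscal /=; ring.
  by rewrite Hdt; field.
have Hab y : Rabs (wrat u * y) = wrat u * Rabs y by rewrite Rabs_mult Rabs_pos_eq; lra.
have Hfb := trace_det_frob _ _ _ Ht Hdt.
case: (dominant_commensurable (fun z => F (vadd x z)) (wrat w) (gap Phi * wrat w) C H1 H2 H3 H4 H5 H6 HC _
   (wrat u * g1) (wrat u * g2) z1 z2 Htr Hdet _ _ F1 F2 Hx) => [v c1 Hv Hc1|||m [q [Hm E]]].
- exact: no_segment.
- by rewrite !Hab; nra.
- by rewrite Hab; nra.
- by exists u, w, m, q.
Qed.

Lemma no_jordan_embedding g c : emb g -> m11 (fst g) + m22 (fst g) = c + c -> adet g = c * c ->
  fst g = mscal c mid.
Proof.
move=> Hg Ht Hdt; apply: NNPP => Hne.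
case: (common_fixed_point g Hg) => x [u [w [C [Fx [Hu [Hw [Hwn [Elin [Efix [HC [Hq [P [HP EC]]]]]]]]]]]]].
have Hru := wrat_pos Phi u Hu; have Hrw := wrat_pos Phi w Hw.
case: (local_scaling x w Fx Hw Hwn Elin Efix) => H1 [H2 [H3 [H4 [H5 H6]]]].
case: (spanning_pair x) => z1 [z2 [F1 [F2 Hx]]].
have Htr : m11 C + m22 C = wrat u * c + wrat u * c.
  rewrite EC trace_conj //; transitivity (wrat u * (m11 (fst g) + m22 (fst g))); last by rewrite Ht; ring.
  rewrite /mscal /=; ring.
have Hdet : mdet C = (wrat u * c) * (wrat u * c).
  rewrite EC !mdet_mul mdet_inv //; have -> : mdet (mscal (wrat u) (fst g)) = wrat u ^ 2 * adet g.
    rewrite /adet /mdet /mscal /=; ring.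
  by rewrite Hdt; field.
have Hfb := trace_det_frob _ _ _ Ht Hdt.
apply: (no_jordan_block (fun z => F (vadd x z)) (wrat w) (gap Phi * wrat w) C H1 H2 H3 H4 H5 H6 HC _
   (wrat u * c) z1 z2 Htr Hdet _ _ _ F1 F2 Hx).
- by move=> v c1 Hv Hc1; apply: no_segment.
- move=> E; apply: Hne.
  have E1 : mscal (wrat u) (fst g) = mmul P (mmul C (minv P)).
    by rewrite EC -!mmul_assoc minvr // mmul_1r mmul_assoc minvr // mmul_1l.
  have E2 : mmul P (mmul C (minv P)) = mscal (wrat u * c) mid.
    rewrite E; have -> : mmul (mscal (wrat u * c) mid) (minv P) = mscal (wrat u * c) (minv P).
      rewrite /mscal; plane; ring.
    have -> : mmul P (mscal (wrat u * c) (minv P)) = mscal (wrat u * c) (mmul P (minv P)).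
      rewrite /mscal; plane; ring.
    by rewrite minvr.
  rewrite E2 in E1; move: E1; case: (fst g) => p11 p12 p21 p22.
  rewrite /mscal /mid /= => -[e1 e2 e3 e4].
  by f_equal; apply: (Rmult_eq_reg_l (wrat u)); lra.
- move=> E; case: (Rmult_integral _ _ E) => E'; first lra.
  by case: Hg => Hn _; apply: Hn; rewrite Hdt E'; ring.
- rewrite Rabs_mult Rabs_pos_eq; first lra.
  nra.
Qed.

End FiniteGroup.

(** * Infinite rotation group: embeddings are similarities *)

Definition gram (A : mat2) : mat2 := mmul (mtr A) A.
Definition trace (A : mat2) : R := m11 A + m22 A.

Lemma trace_gram A : trace (gram A) = frob A ^ 2.
Proof. rewrite frob_sq /trace /gram /=; ring. Qed.

Lemma trace_mscal c A : trace (mscal c A) = c * trace A.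
Proof. rewrite /trace /=; ring. Qed.

Lemma trace_mul A C : trace (mmul A C) = trace (mmul C A).
Proof. rewrite /trace /=; ring. Qed.

Lemma orthogonal_det O : orthogonal O -> mdet O <> 0.
Proof.
move=> H E; have : mdet (mmul (mtr O) O) = 1 by rewrite H mdet_id.
rewrite mdet_mul E; lra.
Qed.

Lemma orthogonal_tr O : orthogonal O -> mmul O (mtr O) = mid.
Proof.
move=> H; have Hd := orthogonal_det O H.
have <- : minv O = mtr O by rewrite -[minv O]mmul_1l -H -mmul_assoc minvr // mmul_1r.
exact: minvr.
Qed.

Lemma orthogonal_mtr O : orthogonal O -> orthogonal (mtr O).
Proof. by move=> H; apply: (orthogonal_tr O). Qed.

Lemma orthogonal_mul O O' : orthogonal O -> orthogonal O' -> orthogonal (mmul O O').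
Proof.
by rewrite /orthogonal => H H'; rewrite mtr_mul -mmul_assoc (mmul_assoc (mtr O)) H mmul_1l.
Qed.

(* A non-scalar symmetric matrix has two orthogonal eigenlines, which a commuting
   orthogonal matrix fixes up to sign. *)
Lemma commutant_finite A : m12 A = m21 A -> (forall c, A <> mscal c mid) ->
  exists L, forall O, orthogonal O -> mmul O A = mmul A O -> In O L.
Proof.
move=> Hsym Hns; pose d := m11 A - m22 A; pose b := 2 * m12 A.
have Hn : d ^ 2 + b ^ 2 <> 0.
  move=> E; apply: (Hns (m11 A)); rewrite /mscal; have [H1 H2] : d = 0 /\ b = 0 by split; nra.
  by rewrite /d /b in H1 H2; plane; lra.
have Hp : 0 < d ^ 2 + b ^ 2 by have := pow2_ge_0 d; have := pow2_ge_0 b; lra.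
pose r := sqrt (d ^ 2 + b ^ 2); have Hr : 0 < r by apply: sqrt_lt_R0.
have Hr2 : r ^ 2 = d ^ 2 + b ^ 2 by rewrite /r pow2_sqrt; lra.
(* Twice the trace-free part of [A] is the symmetric matrix with rows [(d, b)] and [(b, -d)];
   divided by [r] it is the reflection in an eigenline. The candidates are this reflection, the
   identity and their negatives. *)
exists [mid; mscal (-1) mid; M2 (d / r) (b / r) (b / r) (- (d / r));
        M2 (- (d / r)) (- (b / r)) (- (b / r)) (d / r)] => O HO HC.
have := HO; have := orthogonal_tr O HO; move: HC; case: O {HO} => p s u v.
rewrite /orthogonal /mmul /mtr /mid /= => -[C1 C2 C3 C4] [R1 R2 R3 R4] [O1 O2 O3 O4].
have Hsu : (s - u) * (s + u) = 0 by nra.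
have Hpv : (p - v) * (p + v) = 0 by nra.
have K1 : (s - u) * m12 A = 0 by rewrite -Hsym in C1; lra.
have K2 : (p - v) * m12 A = s * d by rewrite /d; lra.
have K3 : (v - p) * m12 A + u * d = 0 by rewrite -Hsym in C3; rewrite /d; lra.
have K4 : (s - u) * d = 0 by lra.
have Esu : s = u.
  apply: NNPP => Hne; have H0 : s - u <> 0 by lra.
  case: (Rmult_integral _ _ K1) => // E1; case: (Rmult_integral _ _ K4) => // E2.
  by apply: Hn; rewrite /b E1 E2; ring.
subst u; case: (Req_dec v (- p)) => Ev; last first.
  have Evp : v = p by case: (Rmult_integral _ _ Hpv); lra.
  subst v; have Hps : p * s = 0 by lra.
  have Es : s = 0 by case: (Rmult_integral _ _ Hps) => // Ep; case: Ev; lra.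
  subst s; have [->|->] : p = 1 \/ p = -1 by case: (Rle_lt_dec 0 p) => H; [left | right]; nra.
    by left.
  by right; left; rewrite /mscal /mid /=; f_equal; lra.
subst v; have Kb : p * b = s * d by rewrite /b; lra.
have Hps : p * p + s * s = 1 by lra.
(* By [Kb] the unit vector [(p, s)] is parallel to [(d, b)], so their inner product is [r] or
   [- r]. *)
have Ew : (p * d + s * b) ^ 2 = r ^ 2.
  rewrite Hr2; transitivity ((p * p + s * s) * (d ^ 2 + b ^ 2) - (p * b - s * d) ^ 2); first ring.
  rewrite Hps Kb; ring.
have Epd : p * r ^ 2 = d * (p * d + s * b).
  rewrite Hr2; transitivity (d * (p * d) + (p * b) * b); first ring.
  rewrite Kb; ring.
have Esd : s * r ^ 2 = b * (p * d + s * b).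
  rewrite Hr2; transitivity ((s * d) * d + b * (s * b)); first ring.
  rewrite -Kb; ring.
have [E|E] : p * d + s * b = r \/ p * d + s * b = - r.
  have : (p * d + s * b - r) * (p * d + s * b + r) = 0 by lra.
  by move=> /Rmult_integral [H|H]; [left | right]; lra.
- right; right; left; rewrite E in Epd Esd.
  have -> : p = d / r by apply: (Rmult_eq_reg_r (r ^ 2)); [rewrite Epd; field; lra | nra].
  have -> : s = b / r by apply: (Rmult_eq_reg_r (r ^ 2)); [rewrite Esd; field; lra | nra].
  done.
- right; right; right; left; rewrite E in Epd Esd.
  have -> : p = - (d / r) by apply: (Rmult_eq_reg_r (r ^ 2)); [rewrite Epd; field; lra | nra].
  have -> : s = - (b / r) by apply: (Rmult_eq_reg_r (r ^ 2)); [rewrite Esd; field; lra | nra].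
  by rewrite Ropp_involutive.
Qed.

(** Any two solutions differ by an element of the commutant of [A]. *)
Lemma conjugator_finite A T : m12 A = m21 A -> (forall c, A <> mscal c mid) ->
  exists L, forall O, orthogonal O /\ mmul (mtr O) (mmul A O) = T -> In O L.
Proof.
move=> Hsym Hns; case: (commutant_finite A Hsym Hns) => L HL.
case: (classic (exists O, orthogonal O /\ mmul (mtr O) (mmul A O) = T)) => [[O0 [H0 E0]] | Hno]; last first.
  by exists [] => O HO; case: Hno; exists O.
exists (map (fun Q => mmul Q O0) L) => O [HO EO]; apply/in_map_iff; exists (mmul O (mtr O0)); split.
  by rewrite -mmul_assoc H0 mmul_1r.
apply: HL; first by apply: orthogonal_mul => //; apply: orthogonal_mtr.
have E : mmul A O = mmul O T by rewrite -EO mmul_assoc orthogonal_tr // mmul_1l.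
have E' : mmul (mtr O0) A = mmul T (mtr O0).
  by rewrite -E0 -!mmul_assoc orthogonal_tr // mmul_1r.
by rewrite mmul_assoc E -!mmul_assoc E'.
Qed.

Lemma finite_fibres {X Y : Type} (P : X -> Prop) (f : X -> Y) (LY : list Y) :
  (forall x, P x -> In (f x) LY) -> (forall y, exists L, forall x, P x /\ f x = y -> In x L) ->
  exists L, forall x, P x -> In x L.
Proof.
move=> HP Hf; suff [L HL] : exists L, forall x, P x /\ In (f x) LY -> In x L.
  by exists L => x Px; apply: HL; split=> //; apply: HP.
elim: LY {HP} => [|y LY [L HL]]; first by exists [] => x [].
case: (Hf y) => L' HL'; exists (L' ++ L) => x [Px [E|Hin]]; apply/in_app_iff.
  by left; apply: HL'.
by right; apply: HL.
Qed.

Section InfiniteGroup.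
Context (Phi : ifs).
Local Notation F := (att Phi).
Local Notation emb := (emb Phi).
Local Notation exact_emb := (exact_emb Phi).
Local Notation word := (word Phi).
Local Notation waff := (waff Phi).
Local Notation wrat := (wrat Phi).

Lemma in_G_worth I : word I -> in_G (nm Phi) (mp Phi) (worth Phi I).
Proof.
elim: I => [|i I IH] /=; first by move=> _; apply: G_id.
by move=> /word_cons [Hi HI]; apply: G_mul => //; apply: IH.
Qed.

Lemma words_finite : G_finite (nm Phi) (mp Phi) -> exists L, forall I, word I -> In (worth Phi I) L.
Proof. by move=> [L HL]; exists L => I HI; apply: HL; apply: in_G_worth. Qed.

(** Finiteness makes each generator a torsion element, so its inverse is itself a product of
    generators. *)
Lemma group_finite : (exists L, forall I, word I -> In (worth Phi I) L) -> G_finite (nm Phi) (mp Phi).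
Proof.
move=> Hfin; suff Hw : forall M, in_G (nm Phi) (mp Phi) M -> exists I, word I /\ worth Phi I = M.
  case: Hfin => L HL; exists L => M HM; case: (Hw M HM) => I [HI <-]; exact: HL.
move=> M; elim=> [|i M' Hi _ [I [HI <-]] | i M' Hi _ [I [HI <-]]].
  by exists []; split; first exact: word_nil.
  by exists (i :: I); split; first by apply/word_cons.
have Hi1 := word1 Phi i Hi; case: (worth_torsion Phi Hfin [i] Hi1) => p [Hp Ep].
exists (rep (p - 1) [i] ++ I); split.
  by apply: word_app => //; apply: word_rep.
rewrite worth_app; f_equal.
have Eq : mmul (s_orth (mp Phi i)) (worth Phi (rep (p - 1) [i])) = mid.
  by rewrite -Ep; case: p Hp {Ep} => [|p] Hp; [lia | rewrite /= Nat.sub_0_r].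
have Ho := mp_orth Phi i Hi.
by rewrite -[LHS]mmul_1l -Ho -mmul_assoc Eq mmul_1r.
Qed.

Lemma gram_mul_worth A I : gram (mmul A (fst (waff I))) =
  mscal (wrat I ^ 2) (mmul (mtr (worth Phi I)) (mmul (gram A) (worth Phi I))).
Proof. rewrite -walpha_sq waff_linear /gram /mscal; plane; ring. Qed.

Lemma gram_waff_mul A J : word J -> gram (mmul (fst (waff J)) A) = mscal (wrat J ^ 2) (gram A).
Proof.
move=> HJ; rewrite /gram mtr_mul -mmul_assoc (mmul_assoc (mtr (fst _))) waff_gram //.
rewrite /mscal; plane; ring.
Qed.

Lemma mscal_mscal c d A : mscal c (mscal d A) = mscal (c * d) A.
Proof. rewrite /mscal; plane; ring. Qed.

(* Distinct orthogonal parts [O_I] give distinct Gram matrices [O_I^T A^T A O_I], hence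
   distinct normalized pieces of [g], of which there are only finitely many. *)
Lemma nonconformal_finite g : emb g -> (forall c, gram (fst g) <> mscal c mid) ->
  G_finite (nm Phi) (mp Phi).
Proof.
move=> Hg Hns; apply: group_finite.
case: (exact_piece Phi g Hg) => I0 [HI0 HE0]; set g' := acomp g (waff I0) in HE0; have [Hg' _] := HE0.
have Hr0 := wrat_pos Phi I0 HI0; pose A := fst g'.
(* Composing with a similarity cannot make a non-conformal matrix conformal. *)
have HnsA c : gram A <> mscal c mid.
  rewrite /A /g' [fst _]/= gram_mul_worth => E; apply: (Hns (c / wrat I0 ^ 2)).
  set O := worth Phi I0 in E; have HO : orthogonal O by apply: worth_orth.
  have E1 : mmul (mtr O) (mmul (gram (fst g)) O) = mscal (c / wrat I0 ^ 2) mid.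
    have -> : mscal (c / wrat I0 ^ 2) mid = mscal (/ wrat I0 ^ 2) (mscal c mid).
      by rewrite mscal_mscal; f_equal; rewrite Rdiv_def Rmult_comm.
    rewrite -E mscal_mscal Rinv_l; first by apply: pow_nonzero; lra.
    rewrite /mscal; plane; ring.
  have -> : gram (fst g) = mmul O (mmul (mmul (mtr O) (mmul (gram (fst g)) O)) (mtr O)).
    by rewrite -!mmul_assoc orthogonal_tr // mmul_1r mmul_assoc orthogonal_tr // mmul_1l.
  rewrite E1; have -> : mmul O (mmul (mscal (c / wrat I0 ^ 2) mid) (mtr O)) = mscal (c / wrat I0 ^ 2) (mmul O (mtr O)).
    rewrite /mscal; plane; ring.
  by rewrite orthogonal_tr.
set d := Rabs (adet g') / frob (fst g') ^ 2 * (gap Phi / diam Phi) ^ 2.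
have Hfr := frob_pos _ (proj1 Hg').
have Hd : 0 < d.
  apply: Rmult_lt_0_compat.
    by apply: Rdiv_lt_0_compat; [apply: Rabs_pos_lt; case: Hg' | apply: pow_lt].
  by apply: pow_lt; apply: Rdiv_lt_0_compat; [exact: gap_pos | exact: diam_pos].
case: (exact_finite Phi d Hd) => L HL.
(* Rescaling the Gram matrix to the trace of [gram A] removes the unknown ratio of [J]: the key of a
   piece depends on its linear part alone. *)
pose key N := mscal (frob A ^ 2 / frob N ^ 2) (gram N).
have Hkey I : word I -> In (mmul (mtr (worth Phi I)) (mmul (gram A) (worth Phi I))) (map (fun f => key (fst f)) L).
  move=> HI; case: (normalization_exists Phi g' I Hg' HI) => J [HJ [Hn Hnd]].
  have HEn : exact_emb (normalization Phi g' I J).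
    by apply/(exact_post Phi J) => //; rewrite normalizationK //; apply: exact_sub.
  apply/in_map_iff; exists (normalization Phi g' I J); split; last by apply: HL.
  have EK := f_equal (fun f => gram (fst f)) (normalizationK Phi g' I J HJ).
  set N := fst (normalization Phi g' I J) in EK *.
  have HN : 0 < frob N by apply: frob_pos; case: Hn.
  have EK' : mscal (wrat J ^ 2) (gram N) = mscal (wrat I ^ 2) (mmul (mtr (worth Phi I)) (mmul (gram A) (worth Phi I))).
    by rewrite -gram_waff_mul // -gram_mul_worth.
  have HI0' := wrat_pos Phi I HI; have HJ0 := wrat_pos Phi J HJ.
  have Et := f_equal trace EK'; rewrite !trace_mscal trace_mul -mmul_assoc orthogonal_tr in Et; first exact: worth_orth.
  rewrite mmul_1r !trace_gram in Et.
  have -> : mmul (mtr (worth Phi I)) (mmul (gram A) (worth Phi I)) = mscal (/ wrat I ^ 2) (mscal (wrat J ^ 2) (gram N)).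
    rewrite EK' mscal_mscal Rinv_l; first by apply: pow_nonzero; lra.
    rewrite /mscal; plane; ring.
  rewrite /key mscal_mscal; f_equal.
  apply: (Rmult_eq_reg_l (wrat I ^ 2 * frob N ^ 2)); last by apply: Rmult_integral_contrapositive_currified; apply: pow_nonzero; lra.
  transitivity (wrat I ^ 2 * frob A ^ 2); first by field; lra.
  by rewrite -Et; field; lra.
have Hsym : m12 (gram A) = m21 (gram A) by rewrite /gram /=; ring.
case: (finite_fibres (fun O => exists I, word I /\ O = worth Phi I)
   (fun O => mmul (mtr O) (mmul (gram A) O)) (map (fun f => key (fst f)) L)).
- by move=> O [I [HI ->]]; apply: Hkey.
- move=> T; case: (conjugator_finite (gram A) T Hsym HnsA) => L' HL'; exists L' => O [[I [HI E]] ET].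
  by apply: HL'; split=> //; rewrite E; apply: worth_orth.
- by move=> L' HL'; exists L' => I HI; apply: HL'; exists I.
Qed.

End InfiniteGroup.

(** * Conclusion *)

Lemma finite_min n (f : nat -> R) : (forall i, (i < n)%nat -> 0 < f i) ->
  exists m, 0 < m /\ forall i, (i < n)%nat -> m <= f i.
Proof.
elim: n => [|n IH] H; first by exists 1; split; [lra | move=> i Hi; lia].
case: (IH (fun i Hi => H i ltac:(lia))) => m [Hm Hmi]; exists (Rmin m (f n)); split.
  by apply: Rmin_glb_lt => //; apply: H; lia.
move=> i Hi; case: (Nat.eq_dec i n) => [->|Hne]; first exact: Rmin_r.
by apply: Rle_trans (Rmin_l _ _) _; apply: Hmi; lia.
Qed.

Lemma finite_gap n (P : nat -> nat -> R -> Prop) :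
  (forall i j e e', e' <= e -> P i j e -> P i j e') ->
  (forall i j, (i < n)%nat -> (j < n)%nat -> exists e, 0 < e /\ P i j e) ->
  exists e, 0 < e /\ forall i j, (i < n)%nat -> (j < n)%nat -> P i j e.
Proof.
move=> Hmono H.
have Hrow i : (i < n)%nat -> exists e, 0 < e /\ forall j, (j < n)%nat -> P i j e.
  move=> Hi; have Hj j : exists e, 0 < e /\ ((j < n)%nat -> P i j e).
    case: (classic (j < n)%nat) => Hj; last by exists 1; split; [lra |].
    by case: (H i j Hi Hj) => e [He HP]; exists e.
  case: (choice_fun _ Hj) => f Hf; case: (finite_min n f) => [j _|e [He Hej]]; first by case: (Hf j).
  by exists e; split=> // j Hjn; apply: Hmono (Hej j Hjn) _; apply: (proj2 (Hf j)).
have Hi i : exists e, 0 < e /\ ((i < n)%nat -> forall j, (j < n)%nat -> P i j e).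
  case: (classic (i < n)%nat) => Hi; last by exists 1; split; [lra |].
  by case: (Hrow i Hi) => e [He HP]; exists e.
case: (choice_fun _ Hi) => f Hf; case: (finite_min n f) => [i _|e [He Hei]]; first by case: (Hf i).
by exists e; split=> // i j Hin Hj; apply: Hmono (Hei i Hin) _; apply: (proj2 (Hf i)).
Qed.

Lemma compact_images_gap (F : R2 -> Prop) f g : compact2 F ->
  (forall x y, F x -> F y -> ap f x <> ap g y) ->
  exists e, 0 < e /\ forall x y, F x -> F y -> e <= dist2 (ap f x) (ap g y).
Proof.
move=> [Hc [b Hb]] Hfg; apply: NNPP => Hno.
have Hb' z : F z -> vnorm z <= b.
  move=> Fz; have := Hb z Fz; rewrite dist2_vnorm; have -> : vsub z (0, 0) = z by plane; ring.
  done.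
have Hn : forall n : nat, exists p : R2 * R2, F (fst p) /\ F (snd p) /\ dist2 (ap f (fst p)) (ap g (snd p)) < / INR (S n).
  move=> n; apply: NNPP => Hn; apply: Hno; exists (/ INR (S n)); split; first exact: inv_Sn_pos.
  move=> x y Fx Fy; case: (Rle_lt_dec (/ INR (S n)) (dist2 (ap f x) (ap g y))) => // Hlt.
  by case: Hn; exists (x, y).
case: (choice_fun _ Hn) => p Hp.
case: (bolzano_R2 (fun n => fst (p n)) b) => [n|sg [Hs [x Hx]]]; first by apply: Hb'; case: (Hp n).
case: (bolzano_R2 (fun n => snd (p (sg n))) b) => [n|tau [Ht [y Hy]]]; first by apply: Hb'; case: (Hp (sg n)) => _ [].
have Fx : F x.
  apply: Hc => e He; case: (Hx e He) => N HN; exists (fst (p (sg N))); split; first by case: (Hp (sg N)).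
  by rewrite dist2_sym; apply: HN.
have Fy : F y.
  apply: Hc => e He; case: (Hy e He) => N HN; exists (snd (p (sg (tau N)))); split; first by case: (Hp (sg (tau N))) => _ [].
  by rewrite dist2_sym; apply: HN.
apply: (Hfg x y Fx Fy); apply: dist2_eq0; apply: Rle_antisym (dist2_ge0 _ _).
apply: le_epsilon => e He; pose C := 1 + frob (fst f) + frob (fst g).
have Hf0 := frob_ge0 (fst f); have Hg0 := frob_ge0 (fst g).
have HeC : 0 < e / C by apply: Rdiv_lt_0_compat => //; rewrite /C; lra.
case: (Hx (e / C) HeC) => N1 H1; case: (Hy (e / C) HeC) => N2 H2; case: (inv_Sn_small (e / C) HeC) => N3 H3.
pose n := (N1 + N2 + N3)%nat; have G1 := extraction_ge _ Ht n; have G2 := extraction_ge _ Hs (tau n).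
have K1 := H1 (tau n) ltac:(rewrite /n in G1 *; lia); have K2 := H2 n ltac:(rewrite /n; lia).
have K3 := H3 (sg (tau n)) ltac:(rewrite /n in G1 G2 *; lia).
case: (Hp (sg (tau n))) => _ [_ K4]; move: K1 K2 K4; set u := fst _; set v := snd (p _) => K1 K2 K4.
have := dist2_triang (ap f x) (ap f u) (ap g y); have := dist2_triang (ap f u) (ap g v) (ap g y).
have := ap_lip f x u; have := ap_lip g v y; rewrite (dist2_sym x u) => L1 L2.
have : frob (fst g) * dist2 v y <= frob (fst g) * (e / C) by apply: Rmult_le_compat_l; lra.
have : frob (fst f) * dist2 u x <= frob (fst f) * (e / C) by apply: Rmult_le_compat_l; lra.
have E : e = (1 + frob (fst f) + frob (fst g)) * (e / C) by rewrite /C; field; lra.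
lra.
Qed.

Lemma continuity_bsum n (f : nat -> R -> R) : (forall i, (i < n)%nat -> continuity (f i)) ->
  continuity (fun x => bsum n (fun i => f i x)).
Proof.
elim: n => [|n IH] H /=; first by apply: continuity_const => x y.
apply: (continuity_plus (fun x => bsum n (fun i => f i x))); last by apply: H; lia.
by apply: IH => i Hi; apply: H; lia.
Qed.

(** Intermediate values: the sum is [n] at exponent 0, and at most [n * hi ^ N <= 1] at a large
    integer [N]. *)
Lemma similarity_dimension n (r : nat -> R) hi : (1 <= n)%nat -> 0 < hi < 1 ->
  (forall i, (i < n)%nat -> 0 < r i <= hi) -> exists s, 0 <= s /\ bsum n (fun i => Rpower (r i) s) = 1.
Proof.
move=> Hn Hhi Hr; have Hconst c : bsum n (fun _ => c) = INR n * c.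
  elim: n {Hn Hr} => [|n IH]; first by rewrite /=; ring.
  rewrite S_INR [bsum _ _]/= IH; ring.
have Hn0 : 1 <= INR n by apply: (le_INR 1).
case: (pow_lt_1_zero hi _ (/ INR n)) => [||N HN]; first by rewrite Rabs_pos_eq; lra.
  by apply: Rinv_0_lt_compat; lra.
have HNN := HN N (le_n N); rewrite Rabs_pos_eq in HNN; first by apply: pow_le; lra.
case: (IVT_cor (fun s => bsum n (fun i => Rpower (r i) s) - 1) 0 (INR N)).
- apply: (continuity_minus (fun s => bsum n (fun i => Rpower (r i) s))); last by apply: continuity_const => x y.
  apply: (continuity_bsum n (fun i => Rpower (r i))) => i Hi.
  rewrite /Rpower; apply: (continuity_comp (fun s => s * ln (r i)) exp); last exact: derivable_continuous derivable_exp.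
  apply: (continuity_mult id); first exact: derivable_continuous derivable_id.
  by apply: continuity_const => x y.
- exact: pos_INR.
- have H0 : 0 <= bsum n (fun i => Rpower (r i) 0) - 1.
    have : bsum n (fun i => Rpower (r i) 0) = bsum n (fun _ => 1).
      by apply: bsum_ext => i Hi; apply: Rpower_O; case: (Hr i Hi).
    rewrite Hconst => ->; lra.
  have H1 : bsum n (fun i => Rpower (r i) (INR N)) - 1 <= 0.
    have : bsum n (fun i => Rpower (r i) (INR N)) <= bsum n (fun _ => hi ^ N).
      by apply: bsum_le => i Hi; rewrite Rpower_pow; [case: (Hr i Hi) | apply: pow_incr; have := Hr i Hi; lra].
    rewrite Hconst => H; have : INR n * hi ^ N <= INR n * / INR n by apply: Rmult_le_compat_l; lra.
    rewrite Rinv_r; lra.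
  nra.
- by move=> s [Hs E]; exists s; split; lra.
Qed.

Lemma not_in_line_triangle (F : R2 -> Prop) : (exists x, F x) -> ~ in_affine_line F ->
  exists a b c, F a /\ F b /\ F c /\ cross (vsub b a) (vsub c a) <> 0.
Proof.
move=> [a Fa] Hline.
have Hoff p q : (p <> 0 \/ q <> 0) -> exists x, F x /\ p * (fst x - fst a) + q * (snd x - snd a) <> 0.
  move=> Hpq; apply: NNPP => Hno; apply: Hline; exists p, q, (p * fst a + q * snd a); split=> // x Fx.
  by apply: NNPP => Hx; apply: Hno; exists x; split=> // E; apply: Hx; lra.
(* First a point [b] off the vertical line through [a], then a point [c] off the line through [a]
   and [b]. *)
case: (Hoff 1 0) => [|b [Fb Hb]]; first by left; lra.
case: (Hoff (- (snd b - snd a)) (fst b - fst a)) => [|c [Fc Hc]]; first by right; lra.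
exists a, b, c; do 3 split=> //; rewrite /cross /vsub /=; lra.
Qed.

Lemma attractor_ifs l phi F : (2 <= l)%nat -> (forall i, (i < l)%nat -> contracting_sim (phi i)) ->
  is_attractor l phi F -> SSC l phi F -> ~ in_affine_line F ->
  exists Phi : ifs, nm Phi = l /\ mp Phi = phi /\ att Phi = F.
Proof.
move=> Hl Hcontr [Hne [Hcomp Hself]] Hssc Hline; have [Hcl [b Hb]] := Hcomp.
case: (finite_min l (fun i => Rabs (s_alpha (phi i)))) => [i Hi|lo [Hlo Hloi]].
  by apply: Rabs_pos_lt; case: (Hcontr i Hi) => -[].
case: (finite_min l (fun i => 1 - Rabs (s_alpha (phi i)))) => [i Hi|m [Hm Hmi]].
  by case: (Hcontr i Hi) => _; lra.
have Hhi i : (i < l)%nat -> Rabs (s_alpha (phi i)) <= 1 - m by move=> Hi; have := Hmi i Hi; lra.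
have Hhi0 : 0 < 1 - m < 1 by have := Hloi 0%nat ltac:(lia); have := Hhi 0%nat ltac:(lia); lra.
have Hself' x i : (i < l)%nat -> F x -> F (sim_app (phi i) x).
  by move=> Hi Fx; apply/Hself; exists i; split=> //; exists x.
case: (similarity_dimension l (fun i => Rabs (s_alpha (phi i))) (1 - m)) => [||i Hi|s [Hs Es]] //; first lia.
  by have := Hloi i Hi; have := Hhi i Hi; lra.
case: (finite_gap l (fun i j e => i <> j -> forall x y, F x -> F y -> e <= dist2 (sim_app (phi i) x) (sim_app (phi j) y)))
    => [i j e e' He H Hij x y Fx Fy|i j Hi Hj|gp [Hgp Hgap]].
- by apply: Rle_trans He _; apply: H.
- case: (Nat.eq_dec i j) => Hij; first by exists 1; split; [lra |].
  case: (compact_images_gap F (simaff (phi i)) (simaff (phi j)) Hcomp) => [x y Fx Fy|e [He H]].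
    rewrite !ap_simaff => E; apply: (Hssc i j Hi Hj Hij (sim_app (phi i) x)).
    by split; [exists x | exists y].
  by exists e; split=> // _ x y Fx Fy; rewrite -!ap_simaff; apply: H.
(* The summand 1 makes the diameter bound strictly positive whatever [b] is. *)
- have Hdiam x y : F x -> F y -> dist2 x y <= 2 * Rabs b + 1.
    move=> Fx Fy; apply: Rle_trans (dist2_triang x (0, 0) y) _; rewrite (dist2_sym (0, 0)).
    have := Hb x Fx; have := Hb y Fy; have := Rle_abs b; lra.
  have Hdp : 0 < 2 * Rabs b + 1 by have := Rabs_pos b; lra.
  have Ho i : (i < l)%nat -> orthogonal (s_orth (phi i)) by move=> Hi; case: (Hcontr i Hi) => -[].
  have Hm1 : 1 - m < 1 by lra.
  have Hgap' i j x y : (i < l)%nat -> (j < l)%nat -> i <> j -> F x -> F y ->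
     gp <= dist2 (sim_app (phi i) x) (sim_app (phi j) y).
    by move=> Hi Hj Hij; apply: Hgap.
  by exists (Ifs l phi F s (2 * Rabs b + 1) gp lo (1 - m) Ho Hloi Hhi Hlo Hm1 Hne Hcl Hself
     Hdiam Hdp Hgap' Hgp Hs Es (not_in_line_triangle F Hne Hline)).
Qed.

(** * Maps whose powers stay away from degeneration *)

Lemma gram_mul_conformal A C c d : gram A = mscal c mid -> gram C = mscal d mid ->
  gram (mmul A C) = mscal (c * d) mid.
Proof.
rewrite /gram => H1 H2; rewrite mtr_mul -mmul_assoc (mmul_assoc (mtr A)) H1.
have -> : mmul (mtr C) (mmul (mscal c mid) C) = mscal c (mmul (mtr C) C) by rewrite /mscal; plane; ring.
by rewrite H2 mscal_mscal.
Qed.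

(** Conformal maps attain the maximum allowed by [det_le_frob]. As their powers are conformal too,
    [/ 2] serves as [kap] in [power_of_words]. *)
Lemma conformal_ratio A c : mdet A <> 0 -> gram A = mscal c mid -> Rabs (mdet A) / frob A ^ 2 = / 2.
Proof.
move=> Hd E; have Hf := frob_pos A Hd.
have E1 := trace_gram A; rewrite E trace_mscal in E1.
have E2 : mdet A ^ 2 = c ^ 2.
  have := f_equal mdet E; rewrite /gram mdet_mul.
  have -> : mdet (mtr A) = mdet A by rewrite /mdet /=; ring.
  move=> E2; rewrite /mdet /mscal /= in E2 *; lra.
have Hc : 0 < c by move: E1; rewrite /trace /=; nra.
have E3 : Rabs (mdet A) = c by apply: sq_eq; [exact: Rabs_pos | lra | rewrite pow2_abs].
rewrite E3 -E1 /trace /=; field; lra.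
Qed.

Lemma conformal_powers g c k : gram (fst g) = mscal c mid -> gram (fst (apow g k)) = mscal (c ^ k) mid.
Proof.
move=> E; elim: k => [|k IH] /=; first by rewrite /gram /mscal; plane; ring.
exact: gram_mul_conformal.
Qed.

Lemma frob_columns A : frob A ^ 2 = vnorm (mapp A (1, 0)) ^ 2 + vnorm (mapp A (0, 1)) ^ 2.
Proof. rewrite frob_sq !vnorm_sq /mapp /=; ring. Qed.

(* The quadratic form [cross z (A z)] is multiplied by [det A] under [A], and it is
   definite when [A] has no real eigenvalue. *)
Lemma elliptic_ratio g : (m11 (fst g) + m22 (fst g)) ^ 2 < 4 * adet g ->
  exists kap, 0 < kap /\ forall k, kap <= Rabs (adet (apow g k)) / frob (fst (apow g k)) ^ 2.
Proof.
set A := fst g; rewrite /adet -/A => Hdisc.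
pose q z := cross z (mapp A z).
(* [- del] is the discriminant of the quadratic form [q]; [Hqlow] completes the square in either
   variable. *)
pose del := 4 * mdet A - (m11 A + m22 A) ^ 2; have Hdel : 0 < del by rewrite /del; lra.
have Hdet : 0 < mdet A by have := pow2_ge_0 (m11 A + m22 A); lra.
pose s := 4 * (Rabs (m12 A) + Rabs (m21 A) + 1).
have Hs : 0 < s by have := Rabs_pos (m12 A); have := Rabs_pos (m21 A); rewrite /s; lra.
have Hqlow z : del * vnorm z ^ 2 <= s * Rabs (q z).
  have E1 : 4 * m21 A * q z = (2 * m21 A * fst z + (m22 A - m11 A) * snd z) ^ 2 + del * snd z ^ 2.
    rewrite /q /del /cross /mapp /mdet /=; ring.
  have E2 : 4 * - m12 A * q z = (2 * m12 A * snd z - (m22 A - m11 A) * fst z) ^ 2 + del * fst z ^ 2.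
    rewrite /q /del /cross /mapp /mdet /=; ring.
  have B1 : 4 * m21 A * q z <= 4 * (Rabs (m21 A) * Rabs (q z)).
    by rewrite -Rabs_mult Rmult_assoc; have := Rle_abs (m21 A * q z); lra.
  have B2 : 4 * - m12 A * q z <= 4 * (Rabs (m12 A) * Rabs (q z)).
    by rewrite -Rabs_mult; have := Rle_abs (- (m12 A * q z)); rewrite Rabs_Ropp; lra.
  have P1 := pow2_ge_0 (2 * m21 A * fst z + (m22 A - m11 A) * snd z).
  have P2 := pow2_ge_0 (2 * m12 A * snd z - (m22 A - m11 A) * fst z).
  rewrite vnorm_sq /s; have := Rabs_pos (q z); lra.
have Hqup z : Rabs (q z) <= frob A * vnorm z ^ 2.
  apply: Rle_trans (cross_le _ _) _; have := frob_bound A z; have := vnorm_ge0 z; nra.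
have Hqk k z : q (mapp (fst (apow g k)) z) = mdet A ^ k * q z.
  elim: k => [|k IH].
    by rewrite /= Rmult_1_l; f_equal; plane; ring.
  have -> : q (mapp (fst (apow g (S k))) z) = mdet A * q (mapp (fst (apow g k)) z).
    rewrite [fst _]/= mapp_mul -/A; move: (mapp (fst (apow g k)) z) => w.
    rewrite /q /cross /mapp /mdet /=; ring.
  by rewrite IH /=; ring.
have Hfr : 0 < frob A by apply: frob_pos; lra.
exists (del / (2 * s * frob A)); split; first by apply: Rdiv_lt_0_compat => //; do 2 apply: Rmult_lt_0_compat => //; lra.
move=> k; have Hpk := pow_lt _ k Hdet.
have Hdk : adet (apow g k) = mdet A ^ k.
  by elim: k {Hpk} => [|k IH]; [exact: mdet_id | rewrite [apow _ _]/= adet_comp IH].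
rewrite -/(adet (apow g k)) Hdk Rabs_pos_eq; first lra.
have Hcol z : vnorm z = 1 -> del * vnorm (mapp (fst (apow g k)) z) ^ 2 <= s * frob A * mdet A ^ k.
  move=> Hz; apply: Rle_trans (Hqlow _) _; rewrite Hqk Rabs_mult (Rabs_pos_eq (_ ^ k)); first lra.
  rewrite Rmult_assoc; apply: Rmult_le_compat_l; first lra.
  have := Hqup z; rewrite Hz; nra.
have V1 : vnorm (1, 0) = 1 by rewrite /vnorm /= !Rmult_1_l !Rmult_0_l Rplus_0_r sqrt_1.
have V2 : vnorm (0, 1) = 1 by rewrite /vnorm /= !Rmult_1_l !Rmult_0_l Rplus_0_l sqrt_1.
have C1 := Hcol _ V1; have C2 := Hcol _ V2; have Ef := frob_columns (fst (apow g k)).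
have Hfk : 0 < frob (fst (apow g k)).
  by apply: frob_pos; rewrite -/(adet (apow g k)) Hdk; lra.
have Hfk2 : 0 < frob (fst (apow g k)) ^ 2 by apply: pow_lt.
apply: (Rmult_le_reg_r (2 * s * frob A * frob (fst (apow g k)) ^ 2)).
  by do 3 apply: Rmult_lt_0_compat => //; lra.
have -> : del / (2 * s * frob A) * (2 * s * frob A * frob (fst (apow g k)) ^ 2) = del * frob (fst (apow g k)) ^ 2.
  by field; lra.
have -> : mdet A ^ k / frob (fst (apow g k)) ^ 2 * (2 * s * frob A * frob (fst (apow g k)) ^ 2) = 2 * (s * frob A * mdet A ^ k).
  by field; lra.
rewrite Ef; lra.
Qed.

(** * Eigenvalues, rational exponents and diagonalization *)

Lemma root_of_powerRZ lam x n (q : Z) : 0 < lam -> 0 < x -> (1 <= n)%nat -> x ^ n = powerRZ lam q ->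
  exists p : Q, x = Rpower lam (Q2R p).
Proof.
move=> Hlam Hx Hn E; exists (q # Pos.of_nat n)%Q.
have Hn0 : 0 < INR n by apply: lt_0_INR; lia.
rewrite pow_exp // powerRZ_exp // in E; have {}E := exp_inv _ _ E.
have Eden : IZR (QDen (q # Pos.of_nat n)) = INR n by rewrite INR_IZR_INZ; f_equal; rewrite /=; lia.
rewrite /Rpower /Q2R Eden [Qnum _]/=.
rewrite -{1}(exp_ln x Hx); f_equal; apply: (Rmult_eq_reg_l (INR n)); last lra.
rewrite E; field; lra.
Qed.

Lemma Cmod_Cof x : Cmod (Cof x) = Rabs x.
Proof. apply: sq_eq; [exact: sqrt_pos | exact: Rabs_pos | rewrite pow2_abs /Cmod pow2_sqrt /=; nra]. Qed.

(** The two candidates are, up to sign, the columns of the adjugate of [A - g]; both vanish only for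
    a scalar matrix. *)
Lemma real_eigenvector A g : g ^ 2 - (m11 A + m22 A) * g + mdet A = 0 ->
  exists v, v <> (0, 0) /\ mapp A v = vscal g v.
Proof.
rewrite /mdet => H.
case: (classic ((m12 A, g - m11 A) = (0, 0))) => [[E1 E2] | Hn]; last first.
  by exists (m12 A, g - m11 A); split=> //; plane; [ring | nra].
case: (classic ((g - m22 A, m21 A) = (0, 0))) => [[E3 E4] | Hn]; last first.
  by exists (g - m22 A, m21 A); split=> //; plane; [nra | ring].
by exists (1, 0); split=> [[]|]; [lra | plane; nra].
Qed.

Lemma real_diagonalizes A g1 g2 : m11 A + m22 A = g1 + g2 -> mdet A = g1 * g2 -> g1 <> g2 ->
  diagonalizes_C A (Cof g1) (Cof g2).
Proof.
move=> Ht Hd Hne; case: (real_eigenvector A g1) => [|v [Hv Ev]]; first by rewrite Ht Hd; ring.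
case: (real_eigenvector A g2) => [|w [Hw Ew]]; first by rewrite Ht Hd; ring.
have Hx : cross v w <> 0.
  move=> Hx; have Hn := vnorm_pos _ Hv; have Hn2 : 0 < vnorm v ^ 2 by apply: pow_lt.
  have E1 : vscal (vnorm v ^ 2) w = vscal (dot v w) v.
    rewrite vnorm_sq; move: Hx; rewrite /cross => Hx; plane.
      transitivity ((fst v * fst w + snd v * snd w) * fst v - snd v * (fst v * snd w - snd v * fst w)); first ring.
      rewrite Hx; ring.
    transitivity ((fst v * fst w + snd v * snd w) * snd v + fst v * (fst v * snd w - snd v * fst w)); first ring.
    rewrite Hx; ring.
  have E2 : vscal (g2 - g1) (vscal (vnorm v ^ 2) w) = (0, 0).
    have -> : vscal (g2 - g1) (vscal (vnorm v ^ 2) w) = vsub (mapp A (vscal (vnorm v ^ 2) w)) (vscal g1 (vscal (vnorm v ^ 2) w)).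
      by rewrite mapp_scal Ew; plane; ring.
    by rewrite {1}E1 mapp_scal Ev E1; plane; ring.
  have := vnorm_pos _ Hw; have := f_equal vnorm E2; rewrite !vnorm_scal vnorm_0 (Rabs_pos_eq (_ ^ 2)); first lra.
  have : 0 < Rabs (g2 - g1) by apply: Rabs_pos_lt; lra.
  move=> P1 P2 P3; have := Rmult_lt_0_compat _ _ P1 (Rmult_lt_0_compat _ _ Hn2 P3); lra.
exists ((fst v, 0), (snd v, 0)), ((fst w, 0), (snd w, 0)).
move: Ev Ew Hx; rewrite /eigpair /Cadd /Cmul /Cof /mapp /vscal /cross /= => -[a1 a2] [b1 b2] Hx.
split; first by move=> [E _]; apply: Hx; lra.
by split; split; f_equal; lra.
Qed.

Lemma complex_diagonalizes A w : 0 < w -> 4 * w ^ 2 = 4 * mdet A - (m11 A + m22 A) ^ 2 ->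
  diagonalizes_C A ((m11 A + m22 A) / 2, w) ((m11 A + m22 A) / 2, - w).
Proof.
(* A triangular matrix has real eigenvalues, so [m12 A] is nonzero and can serve as the first
   coordinate of both eigenvectors. *)
rewrite /mdet => Hw E; have Hb : m12 A <> 0.
  move=> H; rewrite H in E; have := pow2_ge_0 (m11 A - m22 A); nra.
have E' : w * w = m11 A * m22 A - m12 A * m21 A - (m11 A + m22 A) * (m11 A + m22 A) / 4 by lra.
exists ((m12 A, 0), ((m22 A - m11 A) / 2, w)), ((m12 A, 0), ((m22 A - m11 A) / 2, - w)).
rewrite /eigpair /Cadd /Cmul /Cof /=; split.
  move=> [_ H]; have H' : m12 A * w = 0 by lra.
  by case: (Rmult_integral _ _ H') => // H''; lra.
by split; split; f_equal; lra.
Qed.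

Lemma scalar_diagonalizes c : diagonalizes_C (mscal c mid) (Cof c) (Cof c).
Proof.
exists ((1, 0), (0, 0)), ((0, 0), (1, 0)); rewrite /eigpair /Cadd /Cmul /Cof /=; split.
  by move=> [H _]; lra.
by split; split; f_equal; lra.
Qed.

Section UniformRatio.
Context (Phi : ifs) (lam : R).
Context (Hlam : 0 < lam < 1) (Hunif : forall i, (i < nm Phi)%nat -> rat Phi i = lam).

Lemma wrat_uniform I : word Phi I -> wrat Phi I = powerRZ lam (Z.of_nat (length I)).
Proof.
rewrite -pow_powerRZ; elim: I => [|i I IH] //= /word_cons [Hi HI].
by rewrite Hunif // IH.
Qed.

Lemma powerRZ_pow x (q : Z) n : 0 < x -> powerRZ x q ^ n = powerRZ x (q * Z.of_nat n).
Proof.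
move=> Hx; rewrite pow_exp; first exact: powerRZ_lt.
rewrite !powerRZ_exp // ln_exp mult_IZR -INR_IZR_INZ; f_equal; ring.
Qed.

Lemma powerRZ_ratio (x : R) (a b : Z) : powerRZ lam a * x = powerRZ lam b -> x = powerRZ lam (b - a).
Proof.
have Hl : lam <> 0 by lra.
move=> E; have Hp := powerRZ_lt lam a (proj1 Hlam).
apply: (Rmult_eq_reg_l (powerRZ lam a)); last lra.
by rewrite E -powerRZ_add //; f_equal; lia.
Qed.

(** Determinants are compared in [g^m phi_J = phi_J'], where all ratios are powers of [lam]. *)
Lemma determinant_power g kap : emb Phi g -> 0 < kap ->
  (forall k, kap <= Rabs (adet (apow g k)) / frob (fst (apow g k)) ^ 2) ->
  exists (m : nat) (q : Z), (1 <= m)%nat /\ Rabs (adet g) ^ m = powerRZ lam q.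
Proof.
move=> Hg Hk Hkap; case: (power_of_words Phi g kap Hg Hk Hkap) => m [J [J' [Hm [HJ [HJ' E]]]]].
exists m, (Z.of_nat (length J') * 2 - Z.of_nat (length J) * 2)%Z; split=> //.
have := f_equal (fun f => Rabs (adet f)) E; rewrite adet_comp Rabs_mult !waff_det // !wrat_uniform //.
rewrite !powerRZ_pow; try lra.
have -> : Rabs (adet (apow g m)) = Rabs (adet g) ^ m.
  elim: m {Hm E} => [|m IH] /=; first by rewrite /adet mdet_id Rabs_R1.
  by rewrite adet_comp Rabs_mult IH.
move=> E'; apply: powerRZ_ratio; rewrite Rmult_comm; exact: E'.
Qed.

Lemma commensurable_power (x : R) I w m (q : Z) : x <> 0 -> word Phi I -> word Phi w -> (1 <= m)%nat ->
  ((wrat Phi I * x) ^ 2) ^ m = powerRZ (wrat Phi w) q ->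
  exists n (q' : Z), (1 <= n)%nat /\ Rabs x ^ n = powerRZ lam q'.
Proof.
move=> Hx HI Hw Hm E; exists (2 * m)%nat, (Z.of_nat (length w) * q - Z.of_nat (length I) * Z.of_nat (2 * m))%Z.
split; first lia.
apply: powerRZ_ratio; rewrite -powerRZ_pow; first lra.
rewrite -wrat_uniform // -Rpow_mult_distr !pow_mult.
have -> : (wrat Phi I * Rabs x) ^ 2 = (wrat Phi I * x) ^ 2 by rewrite !Rpow_mult_distr pow2_abs.
rewrite E wrat_uniform // powerRZ_exp; first by apply: powerRZ_lt; lra.
rewrite !powerRZ_exp; try lra.
rewrite ln_exp mult_IZR; f_equal; ring.
Qed.

Lemma inverse_dominant g (g1 g2 : R) : G_finite (nm Phi) (mp Phi) -> emb Phi g ->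
  m11 (fst g) + m22 (fst g) = g1 + g2 -> adet g = g1 * g2 -> Rabs g2 < Rabs g1 ->
  exists n (q : Z), (1 <= n)%nat /\ Rabs g2 ^ n = powerRZ lam q.
Proof.
move=> Hfin Hg Ht Hd Hlt; have Hw := words_finite Phi Hfin; have [Hdet _] := Hg.
have G2 : g2 <> 0 by move=> E; apply: Hdet; rewrite Hd E; ring.
have G1 : g1 <> 0 by move=> E; apply: Hdet; rewrite Hd E; ring.
case: (inverse_embedding Phi g Hg) => V [HV HVF].
(* A power of [V] with scalar linear part [r] makes [r / g1] and [r / g2] the eigenvalues of
   [g^{-1} phi_W], so the smaller eigenvalue of [g] becomes the dominant one. *)
case: (scalar_power Phi Hw V HV) => p [Hp Ep]; set W := rep p V in Ep.
have HW : word Phi W by apply: word_rep.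
have Hr := wrat_pos Phi W HW; set r := wrat Phi W in Ep Hr.
pose e := acomp (ainv g) (waff Phi W).
have He : emb Phi e.
  split; first by apply: adet_comp_neq0; [exact: adet_inv_neq0 | exact: waff_det_neq0].
  move=> z Fz; rewrite /e ap_comp /W; case: p Hp {Ep W HW r Hr e} => [|p] Hp; first lia.
  by rewrite [rep _ _]/= waff_app ap_comp; apply: HVF; apply: att_waff => //; apply: word_rep.
have Elin : fst e = mscal r (minv (fst g)) by rewrite /e /= Ep /mscal; plane; ring.
have Ht' : m11 (fst e) + m22 (fst e) = r / g2 + r / g1.
  rewrite Elin /mscal /minv /= -/(adet g); transitivity (r * (m11 (fst g) + m22 (fst g)) / adet g).
    by field.
  by rewrite Ht Hd; field.
have Hd' : adet e = r / g2 * (r / g1).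
  have -> : adet e = r ^ 2 / adet g.
    rewrite /adet Elin; have -> : mdet (mscal r (minv (fst g))) = r ^ 2 * mdet (minv (fst g)).
      rewrite /mdet /mscal /=; ring.
    by rewrite mdet_inv.
  by rewrite Hd; field.
have Hp1 := Rabs_pos_lt _ G1; have Hp2 := Rabs_pos_lt _ G2.
have Hlt' : Rabs (r / g1) < Rabs (r / g2).
  rewrite !Rdiv_def !Rabs_mult !Rabs_inv (Rabs_pos_eq r); first lra.
  by apply: Rmult_lt_compat_l => //; apply: Rinv_lt_contravar => //; apply: Rmult_lt_0_compat.
case: (dominant_eigenvalue Phi Hw e _ _ He Ht' Hd' Hlt') => u [w [m [q [Hu [Hw' [_ [Hm E]]]]]]].
case: (commensurable_power (r / g2) u w m q _ Hu Hw' Hm E) => [|n [q' [Hn E']]].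
  rewrite Rdiv_def; apply: Rmult_integral_contrapositive_currified; [lra | exact: Rinv_neq_0_compat].
exists n, (Z.of_nat (length W) * Z.of_nat n - q')%Z; split=> //.
apply: powerRZ_ratio; rewrite -E' -powerRZ_pow; first lra.
rewrite -wrat_uniform // -/r -Rpow_mult_distr; f_equal.
rewrite Rdiv_def Rabs_mult Rabs_inv (Rabs_pos_eq r); first lra.
by field; lra.
Qed.

Lemma finite_group_case g : G_finite (nm Phi) (mp Phi) -> emb Phi g ->
  exists g1 g2 : Cx, diagonalizes_C (fst g) g1 g2 /\
    exists p q : Q, Cmod g1 = Rpower lam (Q2R p) /\ Cmod g2 = Rpower lam (Q2R q).
Proof.
move=> Hfin Hg; have Hw := words_finite Phi Hfin; have [Hdet _] := Hg.
have Hda := Rabs_pos_lt _ Hdet.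
set A := fst g; pose tr := m11 A + m22 A; have Edet : adet g = mdet A by [].
(* When both eigenvalues have modulus [x], the determinant alone determines [x]. *)
have Hequal x kap : 0 < x -> x ^ 2 = Rabs (mdet A) -> 0 < kap ->
   (forall k, kap <= Rabs (adet (apow g k)) / frob (fst (apow g k)) ^ 2) -> exists p : Q, x = Rpower lam (Q2R p).
  move=> Hx Ex Hk Hkap; case: (determinant_power g kap Hg Hk Hkap) => m [q [Hm E]].
  by apply: (root_of_powerRZ lam x (2 * m) q); [lra | | lia | rewrite pow_mult Ex].
case: (Rtotal_order (tr ^ 2) (4 * mdet A)) => [Hlt|[Heq|Hgt]].
- pose w := sqrt (4 * mdet A - tr ^ 2) / 2.
  have Hw0 : 0 < w by apply: Rdiv_lt_0_compat; [apply: sqrt_lt_R0; lra | lra].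
  have Ew : 4 * w ^ 2 = 4 * mdet A - tr ^ 2.
    have := pow2_sqrt (4 * mdet A - tr ^ 2) ltac:(lra); rewrite /w => E.
    transitivity (sqrt (4 * mdet A - tr ^ 2) ^ 2); [field | exact: E].
  exists (tr / 2, w), (tr / 2, - w); split; first exact: complex_diagonalizes.
  have Hd0 : 0 < mdet A by have := pow2_ge_0 tr; lra.
  case: (elliptic_ratio g Hlt) => kap [Hk Hkap].
  case: (Hequal (sqrt (mdet A)) kap) => // [||p Ep].
  + exact: sqrt_lt_R0.
  + by rewrite pow2_sqrt ?Rabs_pos_eq; lra.
  + exists p, p; rewrite -Ep /Cmod /=; split; f_equal; lra.
- have Ec : fst g = mscal (tr / 2) mid.
    apply: (no_jordan_embedding Phi Hw) => //; [rewrite -/A -/tr; lra | rewrite Edet; lra].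
  have Hc : tr <> 0 by move=> E; apply: Hdet; rewrite Edet; rewrite E in Heq; lra.
  exists (Cof (tr / 2)), (Cof (tr / 2)); split; first by rewrite /A Ec; apply: scalar_diagonalizes.
  have Eg : gram (fst g) = mscal ((tr / 2) ^ 2) mid by rewrite Ec /gram /mscal; plane; ring.
  case: (Hequal (Rabs (tr / 2)) (/ 2)) => [||||p Ep].
  + apply: Rabs_pos_lt; lra.
  + have H0 := pow2_ge_0 tr; rewrite pow2_abs (Rabs_pos_eq (mdet A)); first lra.
    transitivity (tr ^ 2 / 4); [field | lra].
  + lra.
  + move=> k; right; symmetry; apply: (conformal_ratio _ (((tr / 2) ^ 2) ^ k)).
      by case: (emb_pow Phi g k Hg).
    exact: conformal_powers.
  + by exists p, p; rewrite Cmod_Cof.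
- pose s := sqrt (tr ^ 2 - 4 * mdet A); have Hs : 0 < s by apply: sqrt_lt_R0; lra.
  have Hs2 : s ^ 2 = tr ^ 2 - 4 * mdet A by rewrite /s pow2_sqrt; lra.
  have Hreal (g1 g2 : R) : tr = g1 + g2 -> mdet A = g1 * g2 -> Rabs g2 < Rabs g1 -> exists h1 h2 : Cx,
      diagonalizes_C A h1 h2 /\ exists p q : Q, Cmod h1 = Rpower lam (Q2R p) /\ Cmod h2 = Rpower lam (Q2R q).
    move=> Ht Hd Hlt; exists (Cof g1), (Cof g2); split.
      by apply: real_diagonalizes => // E; rewrite E in Hlt; lra.
    have G1 : g1 <> 0 by move=> E; rewrite E Rabs_R0 in Hlt; have := Rabs_pos g2; lra.
    have G2 : g2 <> 0 by move=> E; apply: Hdet; rewrite Edet Hd E; ring.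
    case: (dominant_eigenvalue Phi Hw g g1 g2 Hg Ht Hd Hlt) => u [w [m [q [Hu [Hw' [_ [Hm E]]]]]]].
    case: (commensurable_power g1 u w m q G1 Hu Hw' Hm E) => n1 [q1 [Hn1 E1]].
    case: (inverse_dominant g g1 g2 Hfin Hg Ht Hd Hlt) => n2 [q2 [Hn2 E2]].
    case: (root_of_powerRZ lam (Rabs g1) n1 q1 (proj1 Hlam) (Rabs_pos_lt _ G1) Hn1 E1) => p1 Ep1.
    case: (root_of_powerRZ lam (Rabs g2) n2 q2 (proj1 Hlam) (Rabs_pos_lt _ G2) Hn2 E2) => p2 Ep2.
    by exists p1, p2; rewrite !Cmod_Cof.
  pose g1 := (tr + s) / 2; pose g2 := (tr - s) / 2.
  have Ht : tr = g1 + g2 by rewrite /g1 /g2; field.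
  have Hd : mdet A = g1 * g2.
    have : g1 * g2 = (tr ^ 2 - s ^ 2) / 4 by rewrite /g1 /g2; field.
    rewrite Hs2; lra.
  case: (Rtotal_order (Rabs g1) (Rabs g2)) => [Hlt|[Heq|Hgt']].
  + by apply: (Hreal g2 g1) => //; lra.
  (* Distinct real eigenvalues of equal modulus are opposite. Then [g] need not be conformal, but
     the linear part of its square is scalar, and [determinant_power] applies to the square. *)
  + have Htr : tr = 0.
      have := pow2_abs g1; rewrite Heq pow2_abs => E; have : s * tr = g1 ^ 2 - g2 ^ 2 by rewrite /g1 /g2; field.
      by rewrite E Rminus_diag => /Rmult_integral [H|//]; lra.
    have E12 : g2 = - g1 by lra.
    have G1 : g1 <> 0 by move=> E; apply: Hdet; rewrite Edet Hd E; ring.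
    exists (Cof g1), (Cof g2); split; first by apply: real_diagonalizes => // E; move: E; rewrite /g1 /g2; lra.
    have Hgg : emb Phi (acomp g g) by apply: emb_comp.
    have Elin : fst (acomp g g) = mscal (g1 ^ 2) mid.
      have E22 : m22 A = - m11 A by move: Htr; rewrite /tr; lra.
      have Ea : m11 A * m11 A + m12 A * m21 A = g1 ^ 2.
        by move: Hd; rewrite /mdet E22 E12; lra.
      rewrite /= -/A /mscal; plane; rewrite ?E22; lra.
    have Eg : gram (fst (acomp g g)) = mscal ((g1 ^ 2) ^ 2) mid by rewrite Elin /gram /mscal; plane; ring.
    case: (determinant_power (acomp g g) (/ 2) Hgg) => [|k|m [q [Hm E]]]; first lra.
      right; symmetry; apply: (conformal_ratio _ (((g1 ^ 2) ^ 2) ^ k)).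
        by case: (emb_pow Phi _ k Hgg).
      exact: conformal_powers.
    (* The determinant of the square is [g1 ^ 4]. *)
    have Ex : Rabs g1 ^ (4 * m) = powerRZ lam q.
      rewrite -E pow_mult; f_equal; rewrite adet_comp Edet Hd E12 Rabs_mult.
      have -> : Rabs (g1 * - g1) = Rabs g1 * Rabs g1 by rewrite Rabs_mult Rabs_Ropp.
      ring.
    case: (root_of_powerRZ lam (Rabs g1) (4 * m) q (proj1 Hlam) (Rabs_pos_lt _ G1) ltac:(lia) Ex) => p Ep.
    by exists p, p; rewrite !Cmod_Cof -Heq.
  + by apply: (Hreal g1 g2).
Qed.

End UniformRatio.

Lemma infinite_group_case (Phi : ifs) g : ~ G_finite (nm Phi) (mp Phi) -> emb Phi g ->
  is_similarity_map (ap g) /\ exists (k : nat) (I J : list nat),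
    (1 <= k)%nat /\ word Phi I /\ word Phi J /\
    forall z, iterf k (ap g) (phiw (mp Phi) I z) = phiw (mp Phi) J z.
Proof.
move=> Hinf Hg; have [Hdet _] := Hg.
have [c Ec] : exists c, gram (fst g) = mscal c mid.
  apply: NNPP => Hno; apply: Hinf; apply: (nonconformal_finite Phi g Hg) => c E; apply: Hno; by exists c.
have Hc : 0 < c.
  have := trace_gram (fst g); rewrite Ec trace_mscal /trace /=; have := frob_pos _ Hdet; nra.
have Hsc := sqrt_lt_R0 c Hc; have Es := pow2_sqrt c (Rlt_le _ _ Hc).
split.
  (* [A^T A = c] exhibits [A] as [sqrt c] times an orthogonal matrix. *)
  exists (Sim (sqrt c) (mscal (/ sqrt c) (fst g)) (snd g)); split; last first.
    move=> z; rewrite -ap_simaff /simaff /=; f_equal; case: (g) => B s /=; f_equal.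
    rewrite mscal_mscal Rinv_r; first lra.
    rewrite /mscal; plane; ring.
  split=> /=; first lra.
  rewrite /orthogonal; have -> : mmul (mtr (mscal (/ sqrt c) (fst g))) (mscal (/ sqrt c) (fst g))
    = mscal ((/ sqrt c) ^ 2) (gram (fst g)) by rewrite /gram /mscal; plane; ring.
  rewrite Ec mscal_mscal pow_inv Es Rinv_l; first lra.
  rewrite /mscal; plane; ring.
case: (power_of_words Phi g (/ 2) Hg) => [|k|m [J [J' [Hm [HJ [HJ' E]]]]]]; first lra.
  right; symmetry; apply: (conformal_ratio _ (c ^ k)); last exact: conformal_powers.
  by case: (emb_pow Phi g k Hg).
exists m, J, J'; do 3 split=> //; move=> z.
by rewrite -ap_apow -!ap_waff -E ap_comp.
Qed.

Theorem theorem1p1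
  (l : nat) (phi : nat -> sim) (F : R2 -> Prop) (A : mat2) (t : R2)
  (Hl : (2 <= l)%nat)
  (Hcontr : forall i, (i < l)%nat -> contracting_sim (phi i))
  (HF : is_attractor l phi F)
  (Hssc : SSC l phi F)
  (Hline : ~ in_affine_line F)
  (Hdim : exists d, is_dimH F d /\ 0 < d < 2)
  (HA : mdet A <> 0)
  (HgF : forall z, F z -> F (affg A t z)) :
  (~ G_finite l phi ->
     is_similarity_map (affg A t) /\
     exists (k : nat) (I J : list nat),
       (1 <= k)%nat /\ word_ok l I /\ word_ok l J /\
       forall z, iterf k (affg A t) (phiw phi I z) = phiw phi J z)
  /\
  (G_finite l phi ->
   forall lam : R, 0 < lam < 1 ->
     (forall i, (i < l)%nat -> Rabs (s_alpha (phi i)) = lam) ->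
     exists g1 g2 : Cx,
       diagonalizes_C A g1 g2 /\
       exists p q : Q, Cmod g1 = Rpower lam (Q2R p) /\ Cmod g2 = Rpower lam (Q2R q)).
Proof.
case: (attractor_ifs l phi F Hl Hcontr HF Hssc Hline) => Phi [El [Ephi EF]].
subst l phi F; have Hg : emb Phi (A, t) by split.
split=> [Hinf | Hfin lam Hlam Hunif]; first exact: (infinite_group_case Phi (A, t)).
exact: (finite_group_case Phi lam Hlam Hunif (A, t)).
Qed.
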